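(* Let $(\mathcal E,\mathcal F)$ be a regular symmetric Dirichlet form on $L^2(E;m)$ whose associated Hunt process $X=(\mathbf P_x,X_t,\zeta)$ is irreducible (I) and strong Feller (SF). Then for $x\in E$: (i) $\mathbf P_x(\zeta=\zeta^p<\infty)=\mathbf E^{\mathrm{res}}_x\big(e^{-A^k_\zeta};\zeta<\infty\big)$. (ii) $\mathbf P_x(\zeta=\zeta^i<\infty)=1-\mathbf E^{\mathrm{res}}_x\big(e^{-A^k_\zeta}\big)$. (iii) $\mathbf P_x(\zeta=\infty)=\mathbf E^{\mathrm{res}}_x\big(e^{-A^k_\infty};\zeta=\infty\big)$.
   Context: $E$ is a locally compact separable metric space, $m$ a positive Radon measure on $E$ with full topological support; $\zeta$ is the lifetime of $X$; $p_tf(x)=\mathbf E_x(f(X_t);t<\zeta)$. (I): any Borel set $A$ with $p_t(1_Af)=1_Ap_tf$ $m$-a.e. for all bounded Borel $f\in L^2(E;m)$, $t>0$, satisfies $m(A)=0$ or $m(E\setminus A)=0$. (SF): $p_t$ maps bounded Borel functions to bounded continuous functions for each $t>0$. Resurrected process: let $k$ be the killing measure in the Beurling–Deny formula of $(\mathcal E,\mathcal F)$. The resurrected form $(\mathcal E^{\mathrm{res}},\mathcal F^{\mathrm{res}})$ is the regular Dirichlet form on $L^2(E;m)$ obtained by removing the killing part: $\mathcal F=\mathcal F^{\mathrm{res}}\cap L^2(E;k)$, $\mathcal F^{\mathrm{res}}\cap C_0(E)=\mathcal F\cap C_0(E)$ and $\mathcal E(u,v)=\mathcal E^{\mathrm{res}}(u,v)+\int_Euv\,dk$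 for $u,v\in\mathcal F$. $X^{\mathrm{res}}=(\mathbf P^{\mathrm{res}}_x,X_t,\zeta)$ is the Hunt process generated by it and $A^k_t$ its positive continuous additive functional in Revuz correspondence with $k$. $X$ is the subprocess of $X^{\mathrm{res}}$ by the multiplicative functional $\exp(-A^k_t)$; in particular $p_tf(x)=\mathbf E^{\mathrm{res}}_x(e^{-A^k_t}f(X_t);t<\zeta)$. Convention $e^{-\infty}=0$. Parts of the lifetime: let $\{K_n\}$ be compact sets with $K_n\subset\mathring K_{n+1}$, $K_n\uparrow E$, and $\tau_n=\inf\{t>0:X_t\notin K_n\}$. Put $\Omega^p=\bigcap_n\{\tau_n<\zeta<\infty\}$, $\Omega^i=(\Omega^p)^c$; $\zeta^p$ equals $\zeta$ on $\Omega^p$ and $\infty$ on $\Omega^i$; $\zeta^i$ equals $\zeta$ on $\Omega^i$ and $\infty$ on $\Omega^p$. *)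

(* Defs.v *)
From HB Require Import structures.
From mathcomp Require Import all_boot all_order all_algebra.
From mathcomp Require Import all_classical all_reals all_analysis.
From mathcomp Require Import measurable_realfun one_point_compactification metric_structure.
Import Order.TTheory GRing.Theory Num.Theory.
Import numFieldNormedType.Exports.

Set Implicit Arguments.
Unset Strict Implicit.
Unset Printing Implicit Defensive.

Local Open Scope classical_set_scope.
Local Open Scope ring_scope.

(* Measurable types of the library are pointed, so a metric space that is to
   carry a Borel sigma-algebra needs a distinguished point as well; for a
   non-empty space this is no restriction. *)
#[short(type="pmetricType")]
HB.structure Definition PMetric (R : numDomainType) :=
  {T of Pointed T & Metric R T}.

Notation borel T := (g_sigma_algebraType (@open T)).

(* E_Delta; [None] is the cemetery, an isolated point when E is compact. *)
Notation cemetery E := (one_point_compactification E).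

Definition separable (T : topologicalType) : Prop :=
  exists2 S : set T, countable S & dense S.

Section StateSpace.
Context {R : realType} {E : pmetricType R}.
Implicit Types (m k : {measure set (borel E) -> \bar R}) (u v f : E -> R).

Definition borel_fun u : Prop :=
  measurable_fun [set: borel E] (u : borel E -> R).

(* Finiteness on compact sets gives regularity of Borel measures on a locally
   compact separable metric space. *)
Definition radon m : Prop := forall K : set E, compact K -> (m K < +oo)%E.

Definition full_support m : Prop :=
  forall U : set E, open U -> U !=set0 -> (0 < m U)%E.

Definition bounded u : Prop := exists C : R, forall x, `|u x| <= C.

Definition tsupport u : set E := closure [set x | u x != 0].

Definition C0 : set (E -> R) := [set u | continuous u /\ compact (tsupport u)].

(* Square-integrable Borel functions, not yet identified m-a.e. *)
Definition L2 m : set (E -> R) :=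
  [set u | (u : borel E -> R) \in Lfun m 2%:E].

Definition aeeq m u v : Prop := {ae m, forall x, u x = v x}.

Definition inner m u v : R := \int[m]_x (u x * v x).

(* A bilinear form with its domain; L^2-classes are handled through
   representatives, see [df_ae_dom] and [df_ae_form] below. *)
Record L2form := Form {
  fdom : set (E -> R);
  eform : (E -> R) -> (E -> R) -> R
}.
Implicit Types D : L2form.

Definition eform1 m D u v : R := eform D u v + inner m u v.

Definition nonneg_symmetric_form (S : set (E -> R))
    (B : (E -> R) -> (E -> R) -> R) : Prop :=
  [/\ forall (a : R) u v w, S u -> S v -> S w ->
        B (fun x => a * u x + v x) w = a * B u w + B v w,
      forall u v, S u -> S v -> B u v = B v u &
      forall u, S u -> 0 <= B u u].

Record dirichlet_form m D : Prop := {
  df_L2 : fdom D `<=` L2 m;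
  df_0 : fdom D (cst 0);
  df_lin : forall (a : R) u v, fdom D u -> fdom D v -> fdom D (fun x => a * u x + v x);
  df_ae_dom : forall u v, fdom D u -> borel_fun v -> aeeq m u v -> fdom D v;
  df_ae_form : forall u v w, fdom D u -> fdom D v -> fdom D w ->
    aeeq m u v -> eform D u w = eform D v w;
  df_sym : nonneg_symmetric_form (fdom D) (eform D);
  df_dense : forall f, L2 m f -> forall e : R, 0 < e ->
    exists2 u, fdom D u & inner m (f \- u) (f \- u) < e;
  df_closed : forall u_ : nat -> E -> R, (forall n, fdom D (u_ n)) ->
    (forall e : R, 0 < e -> exists N, forall i j, (N <= i)%N -> (N <= j)%N ->
       eform1 m D (u_ i \- u_ j) (u_ i \- u_ j) < e) ->
    exists2 u, fdom D u &
      eform1 m D (u_ n \- u) (u_ n \- u) @[n --> \oo] --> (0 : R);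
  df_markov : forall u, fdom D u ->
    let v := fun x => Num.min (Num.max 0 (u x)) 1 in
    fdom D v /\ eform D v v <= eform D u u
}.

Record regular_dirichlet_form m D : Prop := {
  rdf_dirichlet : dirichlet_form m D;
  rdf_form_core : forall u, fdom D u -> forall e : R, 0 < e ->
    exists v, [/\ fdom D v, C0 v & eform1 m D (u \- v) (u \- v) < e];
  rdf_unif_core : forall f, C0 f -> forall e : R, 0 < e ->
    exists v, [/\ fdom D v, C0 v & forall x, `|f x - v x| < e]
}.

Definition jump_measure (J : {measure set (borel E * borel E) -> \bar R})
    : Prop :=
  [/\ J diagonal = 0%E,
      forall K : set (E * E), compact K -> K `&` diagonal = set0 ->
        (J K < +oo)%E &
      forall A B : set (borel E), measurable A -> measurable B ->
        J (A `*` B) = J (B `*` A)].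

Definition strongly_local D (Ec : (E -> R) -> (E -> R) -> R) : Prop :=
  forall u v, fdom D u -> C0 u -> fdom D v -> C0 v ->
    (exists c : R, exists U : set E,
       [/\ open U, tsupport u `<=` U & forall x, U x -> v x = c]) ->
    Ec u v = 0.

(* k is the killing measure in the Beurling-Deny formula of D. *)
Definition killing_measure D k : Prop :=
  radon k /\
  exists (Ec : (E -> R) -> (E -> R) -> R)
         (J : {measure set (borel E * borel E) -> \bar R}),
    [/\ nonneg_symmetric_form (fdom D `&` C0) Ec, strongly_local D Ec,
        jump_measure J,
        forall u, fdom D u -> C0 u ->
          (\int[J]_z (((u z.1 - u z.2) ^+ 2)%:E) < +oo)%E &
        forall u v, fdom D u -> C0 u -> fdom D v -> C0 v ->
          eform D u v = Ec u v
            + \int[J]_z ((u z.1 - u z.2) * (v z.1 - v z.2))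
            + inner k u v].

Definition open_capacity m D (O : set E) : \bar R :=
  ereal_inf [set (eform1 m D u u)%:E |
    u in [set u | fdom D u /\ {ae m, forall x, O x -> 1 <= u x}]].

Definition quasi_continuous m D u : Prop :=
  forall e : R, 0 < e -> exists O : set E,
    [/\ open O, (open_capacity m D O < e%:E)%E &
        {within ~` O, continuous u}].

Definition qc_version m D u v : Prop :=
  [/\ borel_fun v, quasi_continuous m D v & aeeq m u v].

(* k may charge m-null sets: membership in L^2(E; k) and integrals with
   respect to k refer to quasi-continuous versions. *)
Definition resurrected_form m D k Dres : Prop :=
  [/\ regular_dirichlet_form m Dres,
      forall u, fdom D u <->
        fdom Dres u /\ exists2 v, qc_version m Dres u v & L2 k v,
      fdom Dres `&` C0 = fdom D `&` C0 &
      forall u v u' v', fdom D u -> fdom D v ->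
        qc_version m Dres u u' -> qc_version m Dres v v' ->
        eform D u v = eform Dres u v + inner k u' v'].

Record compact_exhaustion (K : nat -> set E) : Prop := {
  exh_compact : forall n, compact (K n);
  exh_interior : forall n, K n `<=` interior (K n.+1);
  exh_cover : \bigcup_n K n = [set: E]
}.

End StateSpace.
Arguments L2form {R} E.

(* [path_at X t w] is X_t(w), [theta X t] the shift theta_t and [Prob X z] the
   law P_z; only the times t >= 0 are relevant. *)
Record process (R : realType) (E : pmetricType R) (d : measure_display)
    (W : measurableType d) := Process {
  path_at : R -> W -> cemetery E;
  theta : R -> W -> W;
  Prob : cemetery E -> probability W R
}.

Section Process.
Context {R : realType} {E : pmetricType R} {d : measure_display}
  {W : measurableType d}.
Implicit Types (X : process E W) (m k : {measure set (borel E) -> \bar R}).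

Definition lifetime X (w : W) : \bar R :=
  ereal_inf [set t%:E | t in [set t : R | 0 <= t /\ path_at X t w = None]].

Definition filtration0 X (t : R) : set (set W) :=
  <<s [set A | exists s (B : set (borel (cemetery E))),
         [/\ 0 <= s <= t, measurable B & A = path_at X s @^-1` B]] >>.

Definition filtration0_infty X : set (set W) :=
  <<s [set A | exists s (B : set (borel (cemetery E))),
         [/\ 0 <= s, measurable B & A = path_at X s @^-1` B]] >>.

Definition filtration0_right X (t : R) : set (set W) :=
  [set A | forall s, t < s -> filtration0 X s A].

(* Completion of G, intersected over all the initial distributions nu. *)
Definition augmented X (G : set (set W)) : set (set W) :=
  [set A | forall nu : probability (borel (cemetery E)) R,
     exists B N, [/\ G B, filtration0_infty X N,
       (\int[nu]_z Prob X z N = 0)%E & (A `\` B) `|` (B `\` A) `<=` N]].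

Definition stopping_time X (sigma : W -> \bar R) : Prop :=
  (forall w, (0 <= sigma w)%E) /\
  forall t : R, 0 <= t ->
    filtration0_right X t [set w | (sigma w <= t%:E)%E].

Definition prior X (sigma : W -> \bar R) : set (set W) :=
  [set L | measurable L /\ forall t : R, 0 <= t ->
     filtration0_right X t (L `&` [set w | (sigma w <= t%:E)%E])].

Record hunt_process X : Prop := {
  hunt_measurable : forall t : R, 0 <= t ->
    measurable_fun [set: W] (path_at X t : W -> borel (cemetery E));
  hunt_kernel : forall (t : R) (B : set (borel (cemetery E))),
    0 <= t -> measurable B ->
    measurable_fun [set: borel (cemetery E)]
      (fun z : borel (cemetery E) => Prob X z (path_at X t @^-1` B));
  hunt_normal : forall z, Prob X z [set w | path_at X 0 w = z] = 1%E;
  hunt_shift : forall (s t : R) w, 0 <= s -> 0 <= t ->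
    path_at X s (theta X t w) = path_at X (t + s) w;
  hunt_absorbing : forall (s t : R) w, 0 <= s -> s <= t ->
    path_at X s w = None -> path_at X t w = None;
  hunt_right_continuous : forall (t : R) w, 0 <= t ->
    path_at X s w @[s --> t^'+] --> path_at X t w;
  hunt_left_limits : forall (t : R) w, 0 < t ->
    exists z : cemetery E, path_at X s w @[s --> t^'-] --> z;
  hunt_strong_markov : forall sigma, stopping_time X sigma ->
    forall L, prior X sigma L ->
    forall (s : R) (B : set (borel (cemetery E))) z, 0 <= s -> measurable B ->
    Prob X z [set w | [/\ L w, (sigma w < +oo)%E &
                       B (path_at X (fine (sigma w) + s) w)]] =
    (\int[Prob X z]_(w in L `&` [set w | (sigma w < +oo)%E])
       Prob X (path_at X (fine (sigma w)) w) (path_at X s @^-1` B))%E;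
  hunt_quasi_left_continuous :
    forall (sigma_ : nat -> W -> \bar R) (sigma : W -> \bar R),
    (forall n, stopping_time X (sigma_ n)) ->
    (forall n w, (sigma_ n w <= sigma_ n.+1 w)%E) ->
    (forall w, sigma_ n w @[n --> \oo] --> sigma w) ->
    forall z, {ae Prob X z, forall w, (sigma w < +oo)%E ->
      path_at X (fine (sigma_ n w)) w @[n --> \oo] -->
      path_at X (fine (sigma w)) w}
}.

(* p_t f (x) = E_x (f (X_t); t < zeta) *)
Definition esemigroup X (t : R) (f : E -> \bar R) (x : E) : \bar R :=
  (\int[Prob X (Some x)]_(w in [set w | (t%:E < lifetime X w)%E])
     oapp f 0 (path_at X t w))%E.

Definition semigroup X (t : R) (f : E -> R) (x : E) : R :=
  fine (esemigroup X t (EFin \o f) x).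

(* X is m-symmetric and D is the Dirichlet form on L^2(E; m) of its
   semigroup: u is in the domain iff (1/t) (u - p_t u, u) has a finite limit
   as t decreases to 0, and E(u, v) = lim (1/t) (u - p_t u, v). *)
Definition associated m X (D : L2form E) : Prop :=
  [/\ forall (t : R) (f g : E -> R), 0 < t ->
        borel_fun f -> borel_fun g ->
        (forall x, 0 <= f x) -> (forall x, 0 <= g x) ->
        (\int[m]_x (esemigroup X t (EFin \o f) x * (g x)%:E) =
         \int[m]_x ((f x)%:E * esemigroup X t (EFin \o g) x))%E,
      forall u, fdom D u <-> L2 m u /\
        exists l : R,
          t^-1 * inner m (u \- semigroup X t u) u @[t --> 0^'+] --> l &
      forall u v, fdom D u -> fdom D v ->
        t^-1 * inner m (u \- semigroup X t u) v @[t --> 0^'+] --> eform D u v].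

Definition irreducible m X : Prop :=
  forall A : set (borel E), measurable A ->
    (forall (f : E -> R) (t : R), borel_fun f -> bounded f -> L2 m f -> 0 < t ->
       aeeq m (semigroup X t (fun x => \1_A x * f x))
              (fun x => \1_A x * semigroup X t f x)) ->
    m A = 0%E \/ m (~` A) = 0%E.

Definition strong_feller X : Prop :=
  forall (t : R) (f : E -> R), 0 < t -> borel_fun f -> bounded f ->
    bounded (semigroup X t f) /\ continuous (semigroup X t f).

(* Positive continuous additive functional in the strict sense: its defining
   set has full measure under P_x for every x. *)
Definition pcaf X (A : R -> W -> \bar R) : Prop :=
  (forall (t : R) (U : set (\bar R)), 0 <= t -> measurable U ->
     augmented X (filtration0 X t) (A t @^-1` U)) /\
  exists L : set W,
    [/\ augmented X (filtration0_infty X) L,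
        forall x : E, {ae Prob X (Some x), forall w, L w},
        forall (t : R) w, 0 <= t -> L w -> L (theta X t w) &
        forall w, L w ->
          [/\ A 0 w = 0%E,
              forall t : R, 0 <= t -> (0 <= A t w)%E,
              forall t : R, 0 <= t -> (t%:E < lifetime X w)%E ->
                (A t w < +oo)%E,
              forall t : R, (lifetime X w <= t%:E)%E ->
                A t w = A (fine (lifetime X w)) w &
              (forall s t : R, 0 <= s -> 0 <= t ->
                 A (t + s) w = (A t w + A s (theta X t w))%E) /\
              {within `[0, +oo[%classic, continuous (fun t : R => A t w)}]].

(* mu is the Lebesgue-Stieltjes measure of a on ]0, z[, where a is finite. *)
Definition stieltjes (a : R -> \bar R) (z : \bar R)
    (mu : {measure set (measurableTypeR R) -> \bar R}) : Prop :=
  (forall s t : R, 0 <= s -> s < t -> (t%:E < z)%E ->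
     mu (`]s, t]%classic : set R) = (a t - a s)%E) /\
  mu (~` [set t : R | 0 < t /\ (t%:E < z)%E]) = 0%E.

(* int f dk = lim_(t -> 0) (1/t) E_m (int_0^t f(X_s) dA_s) *)
Definition revuz m X (A : R -> W -> \bar R) k : Prop :=
  exists dA : W -> {measure set (measurableTypeR R) -> \bar R},
    (forall x : E, {ae Prob X (Some x), forall w,
       stieltjes (fun t => A t w) (lifetime X w) (dA w)}) /\
    forall f : E -> R, borel_fun f -> (forall x, 0 <= f x) ->
      ((t^-1)%:E * \int[m]_x \int[Prob X (Some x)]_w
         \int[dA w]_(s in `]0%R, t]%classic)
           oapp (EFin \o f) 0 (path_at X s w))%E
        @[t --> 0^'+] --> (\int[k]_x (f x)%:E)%E.

(* A_z for z in [0, +oo], A_oo being the limit. *)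
Definition at_time (A : R -> W -> \bar R) (z : \bar R) (w : W) : \bar R :=
  match z with
  | t%:E => A t w
  | +oo%E => lim (A t w @[t --> +oo])
  | -oo%E => 0%E
  end.

Definition exit_time X (F : set E) (w : W) : \bar R :=
  ereal_inf [set t%:E |
    t in [set t : R | 0 < t /\ ~ (Some @` F) (path_at X t w)]].

Definition Omega_p X (K : nat -> set E) : set W :=
  [set w | forall n, (exit_time X (K n) w < lifetime X w < +oo)%E].

Definition lifetime_p X (K : nat -> set E) (w : W) : \bar R :=
  if `[< Omega_p X K w >] then lifetime X w else +oo%E.

Definition lifetime_i X (K : nat -> set E) (w : W) : \bar R :=
  if `[< Omega_p X K w >] then +oo%E else lifetime X w.

End Process.

(* The transition function of the subprocess of Y by exp(-A_t); note that
   [expeR -oo = 0]. *)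
Definition subprocess (R : realType) (E : pmetricType R)
    (d d' : measure_display) (W : measurableType d) (W' : measurableType d')
    (X : process E W) (Y : process E W') (A : R -> W' -> \bar R) : Prop :=
  forall (t : R) (f : E -> R) (x : E), 0 < t -> borel_fun f ->
    (forall y, 0 <= f y) ->
    esemigroup X t (EFin \o f) x =
    (\int[Prob Y (Some x)]_(w in [set w | (t%:E < lifetime Y w)%E])
       (expeR (- A t w) * oapp (EFin \o f) 0 (path_at Y t w)))%E.

(* Main.v *)
Require Import Defs.
From HB Require Import structures.
From mathcomp Require Import all_boot all_order all_algebra.
From mathcomp Require Import all_classical all_reals all_analysis.
From mathcomp Require Import measurable_realfun one_point_compactification metric_structure.
From mathcomp Require Import giry lra.
Import Order.TTheory GRing.Theory Num.Theory.
Import numFieldNormedType.Exports.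
Local Open Scope classical_set_scope.
Local Open Scope ring_scope.

Set Implicit Arguments.
Unset Strict Implicit.
Unset Printing Implicit Defensive.

(* Write U_n for the complement of K_n. Iterating the subprocess identity along
   the grid T/N, 2T/N, ..., T by the Markov property gives
     P_x(X visits U_n on the grid)
       = E^res_x(max of exp(- A_t) over the grid times t with X_t in U_n).
   As N -> oo the maximum tends, by right-continuity, to its analogue over all
   t in ]0, T]; as n -> oo quasi-left-continuity identifies the limit of the exit
   times with zeta; with T -> oo this is (i), except that the right-hand side is
   integrated over Omega^p instead of {zeta < oo}.

   X^res is not killed inside E. For u in F^res and C_0(E), and a cutoff v = 1
   near the support of u,
     (1/t) int u P^res(zeta <= t) dm <= (1/t) (v - p_t v, u) -> E^res(v, u),
   and E^res(v, u) involves only jumps out of {v = 1}, hence is small when v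
   increases to 1. Cutting [0, T] into N pieces, the probability of jumping from
   K_n to the cemetery before T is therefore m-a.e. zero. Symmetry, the strong
   Feller property of X and the full support of m turn this into a statement for
   every starting point.

   (iii) is dominated convergence in P_x(zeta > n) = E^res_x(exp(- A_n); zeta > n),
   and (ii) is the complement of (i) and (iii). *)

(** The subprocess hypothesis concerns one time only, and X and X^res live on different path spaces,
    so only events of finite grids can be compared. Since exp(- A_t) decreases, the grid maximum is
    its value at the first grid visit, which is where the path of X must still be alive.

    The Markov property is given for a single future time, whereas grid maxima depend on many: it is
    extended first to cylinders, then to the whole future. A_t is measurable only after a completion
    that depends on the initial law, so each use of A passes through a version; for a shifted path
    that law is the law of X_t.

    In the argument against inside killing, symmetry makes the transition semigroup contract L^1(m),
    so the bound for one step does not depend on its starting time, and N steps of length T/N have a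
    total cost independent of N. The strong Feller property is given for X and not for X^res; its
    consequence that m-null sets are not charged at positive times passes to X^res because exp(-
    A_t) > 0 before the lifetime. *)

Section RestrictedMeasure.
Context {d : measure_display} {T : measurableType d} {R : realType}.

Lemma integral_mrestr (mu : {measure set T -> \bar R}) (D : set T)
    (mD : measurable D) (f : T -> \bar R) :
  measurable_fun setT f -> (forall x, 0 <= f x)%E ->
  (\int[mrestr mu mD]_x f x = \int[mu]_(x in D) f x)%E.
Proof.
move=> mf f0.
rewrite (@ge0_negligible_integral _ _ _ _ setT (~` D))//; [|exact: measurableC|].
  2: by rewrite /= /mrestr setICl measure0.
rewrite setDE setCK setTI; apply: eq_measure_integral => A mA AD.
by rewrite /= /mrestr setIidl.
Qed.

Section SubProbability.
Variables (P : probability T R) (D : set T) (mD : measurable D).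

Let restr := mrestr P mD.

HB.instance Definition _ := Measure.on restr.

Let restr_le1 : (restr setT <= 1)%E.
Proof. by rewrite /restr /mrestr setTI probability_le1. Qed.

HB.instance Definition _ := Measure_isSubProbability.Build _ _ _ restr restr_le1.

(** Restriction to an event leaves a sub-probability, which [giry] admits; an integral over an event
    of the past thus becomes a bind. *)
Definition restrp : giry T R := restr.

End SubProbability.
End RestrictedMeasure.

(** * The Borel sigma-algebra of the state space with cemetery *)

Section CemeteryBorel.
Context {R : realType} {E : pmetricType R}.

Lemma measurable_Some_image (B : set (borel E)) : measurable B ->
  measurable (Some @` B : set (borel (cemetery E))).
Proof.
have mT : measurable (Some @` [set: E] : set (borel (cemetery E))).
  by apply: sub_sigma_algebra; apply: one_point_compactification_open_some; exact: openT.
pose H := [set B : set E | measurable (Some @` B : set (borel (cemetery E)))].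
suff /(_ B) : <<s @open E >> `<=` H by [].
apply: smallest_sub; last first.
  move=> U oU; apply: sub_sigma_algebra.
  exact: one_point_compactification_open_some.
split.
- by rewrite /H /= image_set0; exact: measurable0.
- move=> A HA; rewrite /H /= (_ : _ @` _ = Some @` [set: E] `\` Some @` A).
    exact: measurableD.
  apply/seteqP; split => [_ [z [_ nAz] <-]|_ [[z _ <-] nAz]].
    by split; [exists z|move=> -[z' Az' [zz']]; apply: nAz; rewrite -zz'].
  by exists z => //; split => // Az; apply: nAz; exists z.
- move=> F HF; rewrite /H /= image_bigcup.
  by apply: bigcupT_measurable => i; exact: HF.
Qed.

Lemma measurable_Some : measurable_fun setT (Some : borel E -> borel (cemetery E)).
Proof.
apply: (@measurability _ _ (borel E) (borel (cemetery E)) setT Some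
  (@open (cemetery E))) => // _ [U oU <-].
rewrite setTI; apply: sub_sigma_algebra.
by apply: open_comp => // x _; exact: one_point_compactification_some_continuous.
Qed.

Lemma measurable_None : measurable ([set None] : set (borel (cemetery E))).
Proof.
rewrite (_ : [set None] = ~` (Some @` setT)).
  by apply: measurableC; apply: measurable_Some_image; exact: measurableT.
apply/seteqP; split => [_ -> [] //|[z|]//= nz].
by exfalso; apply: nz; exists z.
Qed.

Lemma measurable_oapp d (T : measurableType d) (c : T) (f : E -> T) :
  measurable_fun [set: borel E] (f : borel E -> T) ->
  measurable_fun setT (oapp f c : borel (cemetery E) -> T).
Proof.
move=> mf _ Y mY; rewrite setTI.
rewrite (_ : _ @^-1` _ = Some @` (f @^-1` Y) `|` ([set None] `&` [set _ | Y c])).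
  apply: measurableU.
    by apply: measurable_Some_image; rewrite -[X in measurable X]setTI; exact: mf.
  have [Yc|nYc] := pselect (Y c).
    by rewrite setIidl; [exact: measurable_None|].
  by rewrite (_ : _ `&` _ = set0); [|apply/seteqP; split => // ? [_ /nYc]].
apply/seteqP; split => [[z Yz|Yc]|_ [[z Yz <-]|[-> Yc]]] //=.
- by left; exists z.
- by right.
Qed.

Lemma open_None_compl (K : set E) : compact K ->
  open (~` (Some @` K) : set (cemetery E)).
Proof.
move=> cK; have clK : closed K by apply: compact_closed => //; exact: metric_hausdorff.
rewrite openE => -[z nKz|nK].
  have nz : ~ K z by move=> Kz; apply: nKz; exists z.
  have : nbhs z (~` K) by apply: open_nbhs_nbhs; split => //; exact: closed_openC.
  by apply: filterS => y Ky -[y' Ky' [yy']]; apply: Ky; rewrite -yy'.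
exists K => // _ [[y nKy <-] [y' Ky' [yy']]|->].
  by apply: nKy; rewrite -yy'.
by case.
Qed.

End CemeteryBorel.

(** A kernel identity for sets says that the image of [mu] under [b] and the bind of [k] are the
    same measure; integrating [f] against it extends the identity to functions. *)
Lemma bind_integral (R : realType) d1 d2 d3 (T1 : measurableType d1)
    (T2 : measurableType d2) (T3 : measurableType d3) (mu : giry T1 R)
    (a : T1 -> T2) (b : T1 -> T3) (k : T2 -> giry T3 R) :
  measurable_fun setT a -> measurable_fun setT b -> measurable_fun setT k ->
  (forall B, measurable B -> mu (b @^-1` B) = (\int[mu]_w k (a w) B)%E) ->
  forall f : T3 -> \bar R, measurable_fun setT f -> (forall y, 0 <= f y)%E ->
  (\int[mu]_w f (b w) = \int[mu]_w \int[k (a w)]_y f y)%E.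
Proof.
move=> ma mb mk muE f mf f0.
have -> : (\int[mu]_w f (b w) = giry_int (giry_map mb mu) f)%E.
  by rewrite giry_int_map.
have -> : (\int[mu]_w \int[k (a w)]_y f y =
           giry_int (giry_bind (giry_map ma mu) mk) f)%E.
  rewrite giry_int_bind// giry_int_map//.
    exact: measurableT_comp (measurable_giry_int mf f0) mk.
  by move=> y; exact: integral_ge0.
apply: eq_measure_integral => B mB _; rewrite /= /pushforward muE//.
rewrite /giry_bind /= giry_int_map; last 2 first.
- exact: measurable_giry_ev.
- by [].
rewrite giry_int_map//; last first.
- exact: measurableT_comp (measurable_giry_ev mB) mk.
Qed.

(** * The Markov property for events of the future *)

Section Markov.
Context {R : realType} {E : pmetricType R} {d : measure_display}
  {W : measurableType d}.
Implicit Types (X : process E W).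

Definition path_events X (D : set R) : set (set W) :=
  [set A | exists s (B : set (borel (cemetery E))),
     [/\ D s, measurable B & A = path_at X s @^-1` B]].

Notation history X t := (g_sigma_algebraType (path_events X [set s | 0 <= s <= t])).
Notation future X := (g_sigma_algebraType (path_events X [set s | 0 <= s])).
Notation cem := (borel (cemetery E)).

Lemma path_events_sub X (D D' : set R) : D `<=` D' ->
  <<s path_events X D >> `<=` <<s path_events X D' >>.
Proof.
move=> DD'; apply: sub_sigma_algebra2 => _ [s [B [Ds mB ->]]].
by exists s, B; split => //; exact: DD'.
Qed.

Variables (X : process E W) (hX : hunt_process X).

Lemma measurable_path (t : R) : 0 <= t ->
  measurable_fun setT (path_at X t : W -> cem).
Proof. exact: hunt_measurable. Qed.

Lemma path_events_measurable (D : set R) : D `<=` [set s | 0 <= s] ->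
  <<s path_events X D >> `<=` (@measurable _ W).
Proof.
move=> D0; apply: smallest_sub; first exact: sigma_algebra_measurable.
move=> _ [s [B [/D0 /= s0 mB ->]]].
by rewrite -[X in measurable X]setTI; exact: measurable_path.
Qed.

Lemma history_measurable t A : filtration0 X t A -> measurable A.
Proof.
by apply: (@path_events_measurable [set s | 0 <= s <= t]) => s /= /andP[].
Qed.

Lemma future_measurable (A : set W) :
  measurable (A : set (future X)) -> measurable A.
Proof. exact: (@path_events_measurable [set s | 0 <= s]). Qed.

Lemma measurable_path_future (t : R) : 0 <= t ->
  measurable_fun setT (path_at X t : future X -> cem).
Proof.
move=> t0 _ B mB; rewrite setTI; apply: sub_sigma_algebra.
by exists t, B.
Qed.

Lemma measurable_path_history (t s : R) : 0 <= s <= t ->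
  measurable_fun setT (path_at X s : history X t -> cem).
Proof.
move=> t0 _ B mB; rewrite setTI; apply: sub_sigma_algebra.
by exists s, B.
Qed.

Lemma measurable_id_future : measurable_fun setT (idfun : W -> future X).
Proof. by move=> _ B mB; rewrite setTI; exact: future_measurable. Qed.

Lemma measurable_id_history t : measurable_fun setT (idfun : W -> history X t).
Proof. by move=> _ B mB; rewrite setTI; exact: history_measurable mB. Qed.

Lemma measurable_theta (t : R) : 0 <= t ->
  measurable_fun setT (theta X t : W -> future X).
Proof.
move=> t0; apply: (@measurability _ _ W (future X) setT _
  (path_events X [set s | 0 <= s])) => // _ [_ [s [B [/= s0 mB ->]]] <-].
rewrite setTI (_ : _ @^-1` _ = path_at X (t + s) @^-1` B).
  rewrite -[X in measurable X]setTI; apply: measurable_path => //.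
  exact: addr_ge0.
by apply/seteqP; split => w /=; rewrite (hunt_shift hX).
Qed.

(** The constant time t is a stopping time and L is prior to it, so this is a case of the strong
    Markov property. *)
Lemma markov_time (t s : R) L z (B : set cem) : 0 <= t -> 0 <= s -> filtration0 X t L ->
  measurable B ->
  Prob X z (L `&` path_at X (t + s) @^-1` B) =
  (\int[Prob X z]_(w in L) Prob X (path_at X t w) (path_at X s @^-1` B))%E.
Proof.
move=> t0 s0 FL mB.
have stop : stopping_time X (cst t%:E).
  split=> [w|u u0 v uv]; first by rewrite lee_fin.
  have [tu|tu] := leP t u.
    rewrite (_ : [set _ | _] = setT); first exact: (@measurableT _ (history X v)).
    by apply/seteqP; split => // w _ /=; rewrite lee_fin.
  rewrite (_ : [set _ | _] = set0); first exact: (@measurable0 _ (history X v)).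
  by apply/seteqP; split => // w /=; rewrite lee_fin leNgt tu.
have prL : prior X (cst t%:E) L.
  split=> [|u u0 v uv]; first exact: history_measurable FL.
  have [tu|tu] := leP t u.
    rewrite (_ : [set _ | _] = setT).
      rewrite setIT; apply: (@path_events_sub _ [set s | 0 <= s <= t]) FL => r /= /andP[-> /=] /le_trans; apply.
      exact: le_trans tu (ltW uv).
    by apply/seteqP; split => // w _ /=; rewrite lee_fin.
  rewrite (_ : [set _ | _] = set0).
    by rewrite setI0; exact: (@measurable0 _ (history X v)).
  by apply/seteqP; split => // w /=; rewrite lee_fin leNgt tu.
have := hunt_strong_markov hX stop prL z s0 mB; rewrite /=.
rewrite [X in L `&` X](_ : _ = setT) ?setIT; last first.
  by apply/seteqP; split => // w _ /=; rewrite ltry.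
move=> <-; congr (Prob X z _).
by apply/seteqP; split => w /= => [[]|[]]; split; rewrite ?ltry.
Qed.

Definition transition (t : R) (t0 : 0 <= t) (z : cem) : giry cem R :=
  giry_map (measurable_path t0) (Prob X z).

Lemma measurable_transition (t : R) (t0 : 0 <= t) : measurable_fun setT (transition t0).
Proof.
apply: measurable_giry_codensity => // B mB.
exact: hunt_kernel.
Qed.

Lemma measurable_Eat t (f : cem -> \bar R) : 0 <= t ->
  measurable_fun setT f -> (forall y, 0 <= f y)%E ->
  measurable_fun setT (fun z : cem => \int[Prob X z]_w f (path_at X t w))%E.
Proof.
move=> t0 mf f0.
rewrite (_ : (fun _ => _) = giry_int ^~ f \o transition t0).
  apply: measurableT_comp; last exact: measurable_transition.
  exact: measurable_giry_int.
by apply/funext => z /=; rewrite [RHS]giry_int_map.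
Qed.

Lemma markov_fun (t s : R) L z (f : cem -> \bar R) : 0 <= t -> 0 <= s ->
  filtration0 X t L ->
  measurable_fun setT f -> (forall y, 0 <= f y)%E ->
  (\int[Prob X z]_(w in L) f (path_at X (t + s) w) =
   \int[Prob X z]_(w in L) \int[Prob X (path_at X t w)]_w' f (path_at X s w'))%E.
Proof.
move=> t0 s0 FL mf f0.
have mL := history_measurable FL.
have ts0 : 0 <= t + s by rewrite addr_ge0.
have mK (B : set cem) : measurable B ->
    measurable_fun setT (fun w => Prob X (path_at X t w) (path_at X s @^-1` B)).
  move=> mB.
  exact: measurableT_comp (hunt_kernel hX s0 mB) (measurable_path t0).
have bindE (B : set cem) : measurable B -> restrp (Prob X z) mL (path_at X (t + s) @^-1` B)
    = (\int[restrp (Prob X z) mL]_w transition s0 (path_at X t w) B)%E.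
  move=> mB; rewrite integral_mrestr//; last exact: mK.
  by rewrite /transition /giry_map /= /pushforward /restrp /mrestr setIC markov_time.
have := bind_integral (measurable_path t0) (measurable_path ts0)
  (measurable_transition s0) bindE mf f0.
have tE w : (\int[transition s0 (path_at X t w)]_y f y =
    \int[Prob X (path_at X t w)]_w' f (path_at X s w'))%E by exact: giry_int_map.
under [X in _ = X -> _]eq_integral do rewrite tE.
rewrite !integral_mrestr//.
- exact: (measurableT_comp (measurable_Eat s0 mf f0) (measurable_path t0)).
- by move=> w; exact: integral_ge0.
- exact: measurableT_comp mf (measurable_path ts0).
Qed.

(* A list of increments [p.1] between successive observation times, each with the
   set [p.2] to be visited; relative times keep the family stable under the shifts. *)
Fixpoint cylinder t (S : seq (R * set cem)) : set W :=
  if S is p :: S' then path_at X (t + p.1) @^-1` p.2 `&` cylinder (t + p.1) S'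
  else setT.

Fixpoint cyl_ok (S : seq (R * set cem)) : Prop :=
  if S is p :: S' then [/\ 0 <= p.1, measurable p.2 & cyl_ok S'] else True.

(** Two lists are merged by taking the smaller head increment first and subtracting it from the head
    increment of the other list; hence the induction on the total length. *)
Lemma cylinderI S S' : cyl_ok S -> cyl_ok S' ->
  exists2 S'', cyl_ok S'' &
    forall t, cylinder t S `&` cylinder t S' = cylinder t S''.
Proof.
have [n] := ubnP (size S + size S').
elim: n S S' => // n IH [|[r B] S] [|[r' B'] S'] /=.
- by exists [::] => // t; rewrite setIT.
- by move=> _ _ okS'; exists ((r', B') :: S') => // t; rewrite setTI.
- by move=> _ okS _; exists ((r, B) :: S) => // t; rewrite setIT.
rewrite !addSn ltnS => szn [r0 mB okS] [r'0 mB' okS'].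
have [rr'|rr'] := leP r r'.
  have [||S'' okS'' SS''] := IH S ((r' - r, B') :: S') _ okS.
  - by rewrite /= addnS; rewrite addnS in szn.
  - by split => //=; rewrite subr_ge0.
  exists ((r, B) :: S'') => // t /=; rewrite -SS''/=.
  by rewrite -!setIA -addrA [r + _]addrC subrK.
have [||S'' okS'' SS''] := IH ((r - r', B) :: S) S' _ _ okS'.
- by rewrite /= addSn; rewrite addnS in szn.
- by split => //=; rewrite subr_ge0 ltW.
exists ((r', B') :: S'') => // t /=; rewrite -SS''/=.
by rewrite -!setIA -addrA [r' + _]addrC subrK [in LHS](setICA (cylinder _ S)) setICA.
Qed.

Lemma theta_cylinder (u t : R) S : 0 <= u -> 0 <= t -> cyl_ok S ->
  theta X u @^-1` cylinder t S = cylinder (u + t) S.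
Proof.
move=> u0; elim: S t => [|[r B] S IH] t t0 //= [r0 mB okS].
rewrite preimage_setI IH//; last exact: addr_ge0.
rewrite addrA; congr (_ `&` _); apply/seteqP; split => w /=.
  by rewrite (hunt_shift hX)// ?addr_ge0// addrA.
by rewrite (hunt_shift hX)// ?addr_ge0// addrA.
Qed.

Lemma cylinder_future (t : R) S : 0 <= t -> cyl_ok S ->
  measurable (cylinder t S : set (future X)).
Proof.
elim: S t => [|[r B] S IH] t t0 /=; first by move=> _; exact: measurableT.
move=> [r0 mB okS]; apply: measurableI; last by apply: IH => //; exact: addr_ge0.
by rewrite -[X in measurable X]setTI; apply: measurable_path_future => //; exact: addr_ge0.
Qed.

Lemma future_cylinder : @measurable _ (future X) =
  <<s [set A | exists2 S, cyl_ok S & A = cylinder 0 S] >>.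
Proof.
apply/seteqP; split.
  apply: sub_sigma_algebra2 => _ [s [B [/= s0 mB ->]]].
  by exists [:: (s, B)] => //=; rewrite add0r setIT.
apply: smallest_sub; first exact: sigma_algebra_measurable.
by move=> _ [S okS ->]; exact: cylinder_future.
Qed.

Lemma cylinder_pi : setI_closed [set A | exists2 S, cyl_ok S & A = cylinder 0 S].
Proof.
move=> _ _ [S okS ->] [S' okS' ->].
by have [S'' okS'' SS''] := cylinderI okS okS'; exists S''.
Qed.

(** Measurability and the Markov property go through one induction: conditioning at the first
    observation time leaves the integrand [phi], which contains the probability of the remaining
    cylinder and must be measurable before [markov_fun] applies to it. *)
Lemma markov_cylinder S : cyl_ok S ->
  measurable_fun setT (fun z : cem => Prob X z (cylinder 0 S)) /\
  forall (t : R) L z, 0 <= t -> filtration0 X t L ->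
    Prob X z (L `&` cylinder t S) =
    (\int[Prob X z]_(w in L) Prob X (path_at X t w) (cylinder 0 S))%E.
Proof.
elim: S => [_|[r B] S IH] /=.
  split; first by under eq_fun do rewrite probability_setT; exact: measurable_cst.
  move=> t L z t0 FL; under eq_integral do rewrite probability_setT.
  by rewrite integral_cst ?mul1e ?setIT//; exact: history_measurable FL.
move=> [r0 mB okS]; have {IH} [mS mkS] := IH okS.
pose phi (z : cem) : \bar R := ((\1_B z)%:E * Prob X z (cylinder 0 S))%E.
have mphi : measurable_fun setT (phi : cem -> \bar R).
  apply: emeasurable_funM => //.
  by apply/measurable_EFinP; exact: measurable_indic.
have phi0 y : (0 <= phi y)%E by rewrite mule_ge0// lee_fin.
have stepE (t : R) L z : 0 <= t -> filtration0 X t L ->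
    Prob X z (L `&` (path_at X (t + r) @^-1` B `&` cylinder (t + r) S)) =
    (\int[Prob X z]_(w in L) phi (path_at X (t + r) w))%E.
  move=> t0 FL; rewrite setIA mkS; last 2 first.
  - exact: addr_ge0.
  - apply: (@measurableI _ (history X (t + r))).
      by apply: (@path_events_sub _ [set s | 0 <= s <= t]) FL => u /= /andP[-> /=] /le_trans; apply; rewrite lerDl.
    rewrite -[X in measurable X]setTI.
    by apply: measurable_path_history => //; rewrite lexx addr_ge0.
  rewrite integral_mkcondr; apply: eq_integral => w _; rewrite /phi patchE indicE.
  have [Bw|Bw] := pselect (B (path_at X (t + r) w)).
    by rewrite !mem_set// mul1e.
  by rewrite !memNset// mul0e.
have ProbE z : Prob X z (path_at X (0 + r) @^-1` B `&` cylinder (0 + r) S) =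
    (\int[Prob X z]_w phi (path_at X r w))%E.
  rewrite -(setTI (_ `&` _)) stepE ?add0r//.
  exact: (@measurableT _ (history X 0)).
split.
  by under eq_fun do rewrite ProbE; exact: measurable_Eat.
move=> t L z t0 FL; rewrite stepE// markov_fun//.
by apply: eq_integral => w _; rewrite ProbE.
Qed.

Lemma measurable_Prob_future (G : set W) : measurable (G : set (future X)) ->
  measurable_fun setT (fun z : cem => Prob X z G).
Proof.
rewrite future_cylinder; move: G.
apply: (@dynkin_induction _ (future X) _
  (fun G => measurable_fun setT (fun z : cem => Prob X z G))
  future_cylinder cylinder_pi).
- apply: (eq_measurable_fun (cst 1%E)) => // z _.
  by rewrite [RHS]probability_setT.
- move=> _ [S okS ->]; have [mS _] := markov_cylinder okS; exact: mS.
- move=> S mS mPS.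
  apply: (eq_measurable_fun (fun z : cem => 1 - Prob X z S)%E).
    by move=> z _; rewrite probability_setC//; exact: future_measurable.
  exact: emeasurable_funB.
- move=> F mF tF mPF.
  apply: (eq_measurable_fun (fun z : cem => \sum_(0 <= k <oo) Prob X z (F k))%E).
    move=> z _; rewrite measure_semi_bigcup// => [k|]; first exact: future_measurable.
    by apply: bigcupT_measurable => k; exact: future_measurable.
  exact: ge0_emeasurable_sum.
Qed.

Definition future_law (z : cem) : giry (future X) R :=
  giry_map measurable_id_future (Prob X z).

Lemma measurable_future_law : measurable_fun setT future_law.
Proof.
by apply: measurable_giry_codensity => // B mB; exact: measurable_Prob_future.
Qed.

Lemma integral_future_law z (f : future X -> \bar R) :
  measurable_fun setT f -> (forall w, 0 <= f w)%E ->
  (\int[future_law z]_w f w = \int[Prob X z]_w f w)%E.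
Proof. by move=> mf f0; exact: (giry_int_map measurable_id_future). Qed.

Lemma measurable_expectation (f : future X -> \bar R) :
  measurable_fun setT f -> (forall w, 0 <= f w)%E ->
  measurable_fun setT (fun z : cem => \int[Prob X z]_w f w)%E.
Proof.
move=> mf f0; under eq_fun do rewrite -integral_future_law//.
exact: measurableT_comp (measurable_giry_int mf f0) measurable_future_law.
Qed.

(** Both sides are finite measures in G that agree on the cylinders, a generating pi-system of the
    future. *)
Lemma markov_set (t : R) L z (G : set W) : 0 <= t -> filtration0 X t L ->
  measurable (G : set (future X)) ->
  Prob X z (L `&` theta X t @^-1` G) =
  (\int[Prob X z]_(w in L) Prob X (path_at X t w) G)%E.
Proof.
move=> t0 FL mG.
have mL := history_measurable FL.
have mPG H : measurable (H : set (future X)) ->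
    measurable_fun setT (fun w => Prob X (path_at X t w) H).
  by move=> mH; exact: measurableT_comp (measurable_Prob_future mH) (measurable_path t0).
pose mu1 : giry (future X) R := giry_map (measurable_theta t0) (restrp (Prob X z) mL).
pose mu2 : giry (future X) R :=
  giry_bind (giry_map (measurable_path t0) (restrp (Prob X z) mL)) measurable_future_law.
have mu1E H : mu1 H = Prob X z (L `&` theta X t @^-1` H).
  by rewrite /mu1 /giry_map /= /pushforward /restrp /mrestr setIC.
have mu2E H : measurable (H : set (future X)) ->
    mu2 H = (\int[Prob X z]_(w in L) Prob X (path_at X t w) H)%E.
  move=> mH; rewrite /mu2 /giry_bind /= giry_int_map; last 2 first.
  - exact: measurable_giry_ev.
  - by [].
  rewrite giry_int_map//; last first.
    exact: measurableT_comp (measurable_giry_ev mH) measurable_future_law.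
  by rewrite /giry_int integral_mrestr//; exact: mPG.
rewrite -mu1E -mu2E//.
apply: (measure_unique _ (fun=> setT) future_cylinder cylinder_pi) => //.
- by move=> _; exists [::].
- by rewrite bigcup_const.
- move=> _ [S okS ->]; apply: etrans (mu1E _) _.
  apply: etrans (esym (mu2E _ _)); last exact: cylinder_future.
  rewrite theta_cylinder// addr0.
  by have [_ ->] := markov_cylinder okS.
- by move=> _; apply: (@le_lt_trans _ _ 1%E); [exact: sprobability_setT|exact: ltry].
Qed.

Lemma markov_future (t : R) L z (f : future X -> \bar R) : 0 <= t ->
  filtration0 X t L -> measurable_fun setT f -> (forall w, 0 <= f w)%E ->
  (\int[Prob X z]_(w in L) f (theta X t w) =
   \int[Prob X z]_(w in L) \int[Prob X (path_at X t w)]_w' f w')%E.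
Proof.
move=> t0 FL mf f0; have mL := history_measurable FL.
have bindE (B : set (future X)) : measurable B ->
    restrp (Prob X z) mL (theta X t @^-1` B)
    = (\int[restrp (Prob X z) mL]_w future_law (path_at X t w) B)%E.
  move=> mB; rewrite integral_mrestr//; last first.
    exact: measurableT_comp (measurable_Prob_future mB) (measurable_path t0).
  by rewrite /restrp /= /mrestr setIC; exact: markov_set.
have := bind_integral (measurable_path t0) (measurable_theta t0)
  measurable_future_law bindE mf f0.
under [X in _ = X -> _]eq_integral do rewrite integral_future_law//.
rewrite !integral_mrestr//.
- exact: (measurableT_comp (measurable_expectation mf f0) (measurable_path t0)).
- by move=> w; exact: integral_ge0.
- exact: measurableT_comp mf (measurable_theta t0).
Qed.

End Markov.

(** * Weights measurable with respect to a sub-sigma-algebra *)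

Section SubSigmaAlgebra.
Context {d : measure_display} {T : measurableType d} {R : realType}.
Variables (mu : {measure set T -> \bar R}) (G : set (set T)).
Hypothesis subG : <<s G >> `<=` (@measurable _ T).
Variables a b : T -> \bar R.
Hypotheses (ma : measurable_fun setT a) (mb : measurable_fun setT b).
Hypotheses (a01 : forall x, (0 <= a x <= 1)%E) (b01 : forall x, (0 <= b x <= 1)%E).

Import HBNNSimple.

Let intM_nnsfun (h : {nnsfun g_sigma_algebraType G >-> R}) c :
  measurable_fun setT c -> (forall x, (0 <= c x <= 1)%E) ->
  (\int[mu]_x ((h x)%:E * c x) =
   \sum_(r \in range h) r%:E * \int[mu]_(x in h @^-1` [set r]) c x)%E.
Proof.
move=> mc c01; have c0 x : (0 <= c x)%E by case/andP: (c01 x).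
have mh r : measurable (h @^-1` [set r] : set T).
  by apply: subG; exact: (measurable_sfunP h).
transitivity (\int[mu]_x \sum_(r \in range h)
    ((r * \1_(h @^-1` [set r]) x)%:E * c x))%E.
  apply: eq_integral => x _; rewrite fimfunE -fsumEFin// ge0_mule_fsuml// => r.
  by rewrite EFinM nnfun_muleindic_ge0.
rewrite ge0_integral_fsum//; last 2 first.
- move=> r; apply: emeasurable_funM => //.
  apply/measurable_EFinP; apply: measurable_funM => //.
- by move=> r x _; rewrite mule_ge0// EFinM nnfun_muleindic_ge0.
apply: eq_fsbigr => r _; have [r0|r0] := leP 0 r.
  under eq_integral do rewrite EFinM -muleA.
  rewrite ge0_integralZl//; last 2 first.
  - apply: emeasurable_funM => //.
    by apply/measurable_EFinP; exact: (@measurable_indic _ T).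
  - by move=> x _; rewrite mule_ge0// lee_fin.
  congr (_ * _)%E; rewrite [RHS]integral_mkcond epatch_indic.
  by apply: eq_integral => x _; rewrite muleC.
rewrite preimage_nnfun0// integral_set0 mule0.
by apply: integral0_eq => x _; rewrite indic0 mulr0 mul0e.
Qed.

(** The hypothesis says that [a] and [b] have the same conditional expectation given G. It is used
    with [a] a functional of the shifted path, [b] its expectation from the present state and [g] a
    weight depending on the past; [g] is approximated by simple functions. *)
Lemma integral_sub_sigma_weight (g : g_sigma_algebraType G -> \bar R) :
  measurable_fun setT g -> (forall x, 0 <= g x)%E ->
  (forall L, <<s G >> L -> \int[mu]_(x in L) a x = \int[mu]_(x in L) b x)%E ->
  (\int[mu]_x (g x * a x) = \int[mu]_x (g x * b x))%E.
Proof.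
move=> mg g0 ab.
pose h := nnsfun_approx measurableT mg.
have cvg_int c : measurable_fun setT c -> (forall x, (0 <= c x <= 1)%E) ->
    (\int[mu]_x ((h n x)%:E * c x) @[n --> \oo] --> \int[mu]_x (g x * c x))%E.
  move=> mc c01; have c0 x : (0 <= c x)%E by case/andP: (c01 x).
  have cfin x : c x \is a fin_num.
    by rewrite ge0_fin_numE//; case/andP: (c01 x) => _ /le_lt_trans; apply; rewrite ltry.
  rewrite (_ : (\int[mu]_x (g x * c x) =
                \int[mu]_x limn (fun n => (h n x)%:E * c x))%E).
    apply: cvg_monotone_convergence => //.
    - move=> n; apply: emeasurable_funM => //; apply/measurable_EFinP.
      move=> _ Y mY; rewrite setTI; apply: subG.
      have mhn : measurable_fun [set: g_sigma_algebraType G] (h n) by [].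
      by have := mhn measurableT Y mY; rewrite setTI.
    - by move=> n x _; rewrite mule_ge0// lee_fin.
    - move=> x _ m n mn; rewrite lee_wpmul2r// lee_fin.
      by have /lefP := nd_nnsfun_approx measurableT mg mn.
  apply: eq_integral => x _; apply/esym/cvg_lim => //.
  by apply: cvgeZr => //; exact: cvg_nnsfun_approx.
apply: (cvg_unique _ (cvg_int _ ma a01)) => //.
rewrite (_ : (fun n => _) = (fun n => \int[mu]_x ((h n x)%:E * b x))%E).
  exact: cvg_int.
apply/funext => n; rewrite !intM_nnsfun//; apply: eq_fsbigr => r _.
by rewrite ab//; exact: (measurable_sfunP (h n)).
Qed.

End SubSigmaAlgebra.

Section ExpeR.
Context {R : realType}.

(** Infinite arguments matter: A may reach +oo at the lifetime, and A_oo may be infinite. *)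
Lemma expeR_continuous : continuous (@expeR R).
Proof.
move=> [r| |].
- by move=> A nA; exact: (@continuous_expR R r _ nA).
- have F : Filter (nbhs (+oo%E : \bar R)) by exact: nbhs_filter.
  apply/(@cvgeyPge _ _ _ F) => M; near=> y.
  apply: le_trans (expeR_ge1Dx y).
  rewrite (@le_trans _ _ y)//.
    by apply: ltW; near: y; exact: nbhs_open_ereal_pinfty.
  by rewrite leeDr.
- have F : Filter (nbhs (-oo%E : \bar R)) by exact: nbhs_filter.
  apply/(@fine_cvgP _ _ _ F); split.
    near=> y; rewrite ge0_fin_numE ?expeR_ge0// ltey expeR_eqy.
    apply/negP => /eqP yoo; suff : (y < 0%:E)%E by rewrite yoo.
    by near: y; exists 0; split => //; exact: num_real.
  apply/cvgrPdist_lt => e e0; near=> y.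
  have ye : (y < (ln e)%:E)%E by near: y; exists (ln e); split => //; exact: num_real.
  rewrite sub0r normrN ger0_norm ?fine_ge0 ?expeR_ge0//.
  rewrite -lte_fin fineK.
    rewrite -[e]lnK ?posrE// -[(expR _)%:E]/(expeR (ln e)%:E).
    by rewrite lte_expeR.
  rewrite ge0_fin_numE ?expeR_ge0// ltey expeR_eqy.
  by apply/negP => /eqP yoo; rewrite yoo in ye.
Unshelve. all: by end_near. Qed.

Lemma measurable_expeR : measurable_fun setT (@expeR R).
Proof.
rewrite (_ : expeR = fun x => if x == +oo%E then +oo%E else
    if x == -oo%E then 0%E else (expR (fine x))%:E); last first.
  by apply/funext => -[].
apply: measurable_fun_ifT.
- exact: measurable_fun_eqe.
- exact: measurable_cst.
- apply: measurable_fun_ifT.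
  + exact: measurable_fun_eqe.
  + exact: measurable_cst.
  + apply/measurable_EFinP; apply: measurableT_comp; first exact: measurable_expR.
    exact: fine_measurable.
Qed.

End ExpeR.

(** * Functionals adapted to a completed filtration *)

(* A functional adapted to a completed filtration is only equal a.e. to a
   measurable function, and the integrals of the statement are then the lower
   integrals of non-measurable functions. *)
Section AeMeasurable.
Context {d : measure_display} {T : measurableType d} {R : realType}.
Implicit Types (mu : {measure set T -> \bar R}) (f g : T -> \bar R).

Definition ae_measurable mu f : Prop :=
  exists2 g, measurable_fun setT g & {ae mu, forall x, f x = g x}.

Lemma measurable_ae_measurable mu f : measurable_fun setT f -> ae_measurable mu f.
Proof. by move=> mf; exists f => //; exact: aeW. Qed.

Lemma ae_measurable_eq mu f g : {ae mu, forall x, f x = g x} ->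
  ae_measurable mu g -> ae_measurable mu f.
Proof.
move=> fg [h mh gh]; exists h => //.
by move: fg gh; apply: filterS2 => x ->.
Qed.

Lemma ae_measurable2 mu f g (op : \bar R -> \bar R -> \bar R) :
  (forall f' g', measurable_fun setT f' -> measurable_fun setT g' ->
     measurable_fun setT (fun x : T => op (f' x) (g' x))) ->
  ae_measurable mu f -> ae_measurable mu g ->
  ae_measurable mu (fun x => op (f x) (g x)).
Proof.
move=> mop [f' mf' ff'] [g' mg' gg'].
exists (fun x => op (f' x) (g' x)); first exact: mop.
by move: ff' gg'; apply: filterS2 => x -> ->.
Qed.

Lemma ae_measurableM mu f g : ae_measurable mu f -> ae_measurable mu g ->
  ae_measurable mu (fun x => f x * g x)%E.
Proof. by apply: ae_measurable2 => *; exact: emeasurable_funM. Qed.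

Lemma ae_measurable_max mu f g : ae_measurable mu f -> ae_measurable mu g ->
  ae_measurable mu (fun x => maxe (f x) (g x)).
Proof. by apply: ae_measurable2 => *; exact: measurable_maxe. Qed.

Lemma ae_measurable_ge0 mu f : (forall x, 0 <= f x)%E -> ae_measurable mu f ->
  exists2 g, measurable_fun setT g /\ (forall x, 0 <= g x)%E &
    {ae mu, forall x, f x = g x}.
Proof.
move=> f0 [g mg fg]; exists (fun x => `|g x|%E).
  by split => // ; exact: measurableT_comp.
by apply: filterS fg => x <-; rewrite gee0_abs.
Qed.

Import HBNNSimple.

(** The integral of a nonnegative function is a supremum over the simple functions below it, so
    monotonicity asks for no measurability. *)
Lemma ge0_le_lower_integral mu f g : (forall x, 0 <= f x)%E ->
  (forall x, f x <= g x)%E -> (\int[mu]_x f x <= \int[mu]_x g x)%E.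
Proof.
move=> f0 fg; rewrite !ge0_integralTE//; last by move=> x; exact: le_trans (fg x).
apply: le_ereal_sup => _ [h hf <-]; exists h => // x.
exact: le_trans (hf x) (fg x).
Qed.

(** A simple function below f is a.e. below g, which bounds the lower integral of f. Conversely, g
    restricted to the complement of the exceptional set is measurable, has the integral of g and
    lies below f everywhere. *)
Lemma ge0_integral_ae_version mu f g : measurable_fun setT g ->
  (forall x, 0 <= f x)%E -> (forall x, 0 <= g x)%E ->
  {ae mu, forall x, f x = g x} -> (\int[mu]_x f x = \int[mu]_x g x)%E.
Proof.
move=> mg f0 g0 [N [mN N0 fgN]]; apply/eqP; rewrite eq_le; apply/andP; split.
  rewrite [leLHS]ge0_integralTE//; apply: ge_ereal_sup => _ [h hf <-].
  rewrite -integralT_nnsfun; apply: ae_ge0_le_integral => //.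
  - by move=> x _; rewrite lee_fin.
  - exact/measurable_EFinP.
  - exists N; split => // x /= hg; apply: fgN => /= fgx.
    by apply: hg => _; rewrite -fgx.
rewrite (ge0_negligible_integral mN)// setTD integral_mkcond.
apply: ge0_le_lower_integral => x; rewrite patchE; case: ifPn => //.
rewrite inE /= => nN; suff -> : f x = g x by [].
by apply: contrapT => fg; apply: nN; exact: fgN.
Qed.

Lemma ge0_integral_ae mu f g : ae_measurable mu g ->
  (forall x, 0 <= f x)%E -> (forall x, 0 <= g x)%E ->
  {ae mu, forall x, f x = g x} -> (\int[mu]_x f x = \int[mu]_x g x)%E.
Proof.
move=> mg f0 g0 fg; have [h [mh h0] gh] := ae_measurable_ge0 g0 mg.
rewrite (ge0_integral_ae_version mh g0 h0 gh).
apply: ge0_integral_ae_version => //.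
by move: fg gh; apply: filterS2 => x ->.
Qed.

Lemma ge0_integralD_ae mu f g : ae_measurable mu f -> ae_measurable mu g ->
  (forall x, 0 <= f x)%E -> (forall x, 0 <= g x)%E ->
  (\int[mu]_x (f x + g x) = \int[mu]_x f x + \int[mu]_x g x)%E.
Proof.
move=> mf mg f0 g0.
have [f' [mf' f'0] ff'] := ae_measurable_ge0 f0 mf.
have [g' [mg' g'0] gg'] := ae_measurable_ge0 g0 mg.
rewrite (ge0_integral_ae_version mf' f0 f'0 ff').
rewrite (ge0_integral_ae_version mg' g0 g'0 gg').
rewrite -ge0_integralD//; apply: ge0_integral_ae_version.
- exact: emeasurable_funD.
- by move=> x; rewrite adde_ge0.
- by move=> x; rewrite adde_ge0.
- by move: ff' gg'; apply: filterS2 => x -> ->.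
Qed.

Lemma ge0_integral_setT_split mu (D : set T) f : measurable D ->
  ae_measurable mu f -> (forall x, 0 <= f x)%E ->
  (\int[mu]_x f x = \int[mu]_(x in D) f x + \int[mu]_(x in ~` D) f x)%E.
Proof.
move=> mD [g mg fg] f0.
rewrite (integral_mkcond D) (integral_mkcond (~` D)) -ge0_integralD_ae.
- apply: eq_integral => x _; rewrite !patchE in_setC.
  by case: (x \in D); rewrite ?adde0 ?add0e.
- exists (g \_ D).
    exact: (iffLR (measurable_restrictT g mD) (measurable_funTS mg)).
  by apply: filterS fg => x; rewrite !patchE => ->.
- exists (g \_ (~` D)).
    exact: (iffLR (measurable_restrictT g (measurableC mD)) (measurable_funTS mg)).
  by apply: filterS fg => x; rewrite !patchE => ->.
- by move=> x; rewrite patchE; case: ifP.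
- by move=> x; rewrite patchE; case: ifP.
Qed.

(** The limit inherits a measurable version, the upper limit of versions of the [f_ n] truncated at
    0; this allows the three successive limits to be chained. *)
Lemma integral01_cvg mu (f_ : nat -> T -> \bar R) f :
  (mu setT < +oo)%E ->
  (forall n, ae_measurable mu (f_ n)) ->
  (forall n x, 0 <= f_ n x <= 1)%E -> (forall x, 0 <= f x)%E ->
  {ae mu, forall x, f_ n x @[n --> \oo] --> f x} ->
  ae_measurable mu f /\
  (\int[mu]_x f_ n x @[n --> \oo] --> \int[mu]_x f x)%E.
Proof.
move=> muoo mf f01 f0 ff.
have f_0 n x : (0 <= f_ n x)%E by case/andP: (f01 n x).
have /choice[g gP] n : exists g, [/\ measurable_fun setT g, (forall x, 0 <= g x)%E &
    {ae mu, forall x, f_ n x = g x}].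
  by have [g [? ?] ?] := ae_measurable_ge0 (f_0 n) (mf n); exists g.
pose h x := maxe 0%E (limn_esup (g ^~ x)).
have mh : measurable_fun setT h.
  apply: measurable_maxe => //.
  by apply: measurable_fun_limn_esup => n; have [] := gP n.
have fgE : {ae mu, forall x, forall n, f_ n x = g n x}.
  by apply/ae_foralln => n; have [] := gP n.
have gf : {ae mu, forall x, g n x @[n --> \oo] --> f x}.
  move: fgE ff; apply: filterS2 => x E; rewrite (_ : f_ ^~ x = g ^~ x)//.
  exact/funext.
have fh : {ae mu, forall x, f x = h x}.
  apply: filterS gf => x gfx; rewrite /h is_cvg_limn_esupE.
    by rewrite (cvg_lim _ gfx)// max_r.
  by apply/cvg_ex; exists (f x).
have h0 x : (0 <= h x)%E.
  by rewrite /h le_max lexx.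
split; first by exists h.
rewrite (ge0_integral_ae_version mh f0 h0 fh).
rewrite (_ : (fun n => _) = (fun n => \int[mu]_x g n x)%E); last first.
  apply/funext => n; have [mg g0 fg] := gP n.
  exact: ge0_integral_ae_version.
have [] := @dominated_convergence _ T R mu setT measurableT g h (cst 1%E) => //.
- by move=> n; have [] := gP n.
- by move: gf fh; apply: filterS2 => x gfx <- _.
- apply/integrableP; split => //.
  under eq_integral do rewrite /= normr1.
  by rewrite integral_cst// mul1e.
- apply: filterS fgE => x E n _; rewrite -E gee0_abs//.
  by case/andP: (f01 n x).
Qed.

End AeMeasurable.

Lemma ae_measurable01 d (T : measurableType d) (R : realType)
    (mu : {measure set T -> \bar R}) (f : T -> \bar R) :
  (forall x, 0 <= f x <= 1)%E -> ae_measurable mu f ->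
  exists2 g, measurable_fun setT g /\ (forall x, 0 <= g x <= 1)%E &
    {ae mu, forall x, f x = g x}.
Proof.
move=> f01 [g mg fg]; exists (fun x => mine 1%E (maxe 0%E (g x))).
  split; first by apply: measurable_mine => //; exact: measurable_maxe.
  by move=> x; rewrite le_min ge_min lexx lee01 le_max lexx.
apply: filterS fg => x <-; have /andP[f0 f1] := f01 x.
by rewrite max_r// min_r.
Qed.

(** Recovers a function from countably many of its level sets, so that versions of these sets
    combine into a version of the function. *)
Lemma ereal_sup_rat (R : realType) (q : nat -> R) (y : \bar R) :
  (forall a b : R, a < b -> exists n, a < q n < b) ->
  y = ereal_sup (range (fun n => if ((q n)%:E < y)%E then (q n)%:E else -oo%E)).
Proof.
move=> qd; apply/eqP; rewrite eq_le; apply/andP; split; last first.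
  apply: ge_ereal_sup => _ [n _ <-]; case: ifPn => [/ltW//|_]; exact: leNye.
set S := ereal_sup _.
have qS n : ((q n)%:E < y)%E -> ((q n)%:E <= S)%E.
  by move=> qy; apply: ereal_sup_ubound; exists n => //; rewrite qy.
rewrite leNgt; apply/negP => Sy.
have [n /andP[Sq qy]] : exists n, (S < (q n)%:E)%E && ((q n)%:E < y)%E.
  case: S Sy {qS} => [s| |].
  - case: y => [y| |] //.
    + rewrite lte_fin => sy; have [n /andP[sq qy]] := qd _ _ sy.
      by exists n; rewrite !lte_fin sq qy.
    + have s1 : s < s + 1 by rewrite ltrDl.
      have [n /andP[sq _]] := qd _ _ s1.
      by move=> _; exists n; rewrite lte_fin sq ltry.
  - by rewrite ltNge leey.
  - case: y => [y| |] // _.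
    + have y1y : y - 1 < y by rewrite ltrBlDr ltrDl.
      have [n /andP[_ qy]] := qd _ _ y1y.
      by exists n; rewrite ltNyr lte_fin qy.
    + by have [n _] := qd 0 1 ltr01; exists n; rewrite ltNyr ltry.
by have := le_lt_trans (qS _ qy) Sq; rewrite ltxx.
Qed.

(** * Versions under a given initial law and the Markov property for them *)

Section Versions.
Context {R : realType} {E : pmetricType R} {d : measure_display}
  {W : measurableType d}.
Notation history X t := (g_sigma_algebraType (path_events X [set s | 0 <= s <= t])).
Notation future X := (g_sigma_algebraType (path_events X [set s | 0 <= s])).
Notation cem := (borel (cemetery E)).

Variables (X : process E W) (hX : hunt_process X).

Definition law_from (nu : giry cem R) : giry (future X) R :=
  giry_bind nu (measurable_future_law hX).

Lemma law_fromE nu (N : set (future X)) : measurable N ->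
  law_from nu N = (\int[nu]_z Prob X z N)%E.
Proof.
move=> mN; rewrite /law_from /giry_bind /= giry_int_map//.
exact: measurable_giry_ev.
Qed.

(** The completion provides, for each rational level, an event of the uncompleted sigma-algebra that
    differs from the level set on a null set. The supremum of the levels over these events is the
    version; it depends on [nu]. *)
Lemma augmented_version (D : set R) (nu : probability cem R) (f : W -> \bar R) :
  D `<=` [set s | 0 <= s] ->
  (forall U : set (\bar R), measurable U ->
     augmented X <<s path_events X D >> (f @^-1` U)) ->
  exists2 g : g_sigma_algebraType (path_events X D) -> \bar R,
    measurable_fun setT g & {ae law_from nu, forall w : future X, f w = g w}.
Proof.
move=> D0 fU.
pose q n : R := oapp ratr 0 (unpickle n : option rat).
have qd (a b : R) : a < b -> exists n, a < q n < b.
  move=> /rat_in_itvoo[r]; rewrite in_itv/= => abr.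
  by exists (pickle r); rewrite /q pickleK.
have /choice[BN BNP] n : exists BN : set W * set W,
    [/\ <<s path_events X D >> BN.1, filtration0_infty X BN.2,
      (\int[nu]_z Prob X z BN.2 = 0)%E &
      ((f @^-1` [set y | (q n)%:E < y]%E) `\` BN.1) `|`
      (BN.1 `\` (f @^-1` [set y | (q n)%:E < y]%E)) `<=` BN.2].
  have mU : measurable [set y : \bar R | ((q n)%:E < y)%E].
    rewrite (_ : mkset _ = `](q n)%:E, +oo[%classic); first exact: emeasurable_itv.
    by apply/seteqP; split => y /=; rewrite in_itv/= andbT.
  by have [B [N [? ? ? ?]]] := fU _ mU nu; exists (B, N).
pose G n w : \bar R := if w \in (BN n).1 then (q n)%:E else -oo%E.
exists (fun w => ereal_sup (range (G ^~ w))).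
  rewrite (_ : (fun _ => _) = (fun w => esups (G ^~ w) 0%N)); last first.
    apply/funext => w; rewrite /esups /sdrop; congr ereal_sup.
    by apply/seteqP; split => _ [n _ <-]; exists n.
  apply: measurable_fun_esups => n; apply: measurable_fun_ifT => //.
  have mB : measurable ((BN n).1 : set (g_sigma_algebraType (path_events X D))).
    by have [] := BNP n.
  apply: (measurable_fun_bool true); rewrite setTI.
  by rewrite (_ : _ @^-1` _ = (BN n).1)//; apply/seteqP; split => w /= => [/set_mem|/mem_set].
have [N [mN N0 NP]] : (law_from nu).-negligible (\bigcup_n (BN n).2).
  apply: negligible_bigcup => n; have [_ FN N0 _] := BNP n.
  by exists (BN n).2; split => //; apply: etrans N0; exact: law_fromE.
exists N; split => // w /= fg; apply: NP; apply: contrapT => nN; apply: fg.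
rewrite {1}(ereal_sup_rat (f w) qd); congr ereal_sup.
congr (_ @` _); apply/funext => n; rewrite /G.
have [_ _ _ BNn] := BNP n.
have [fq|fq] := boolP ((q n)%:E < f w)%E.
  rewrite mem_set//; apply: contrapT => nB; apply: nN; exists n => //.
  by apply: BNn; left.
rewrite memNset// => B; apply: nN; exists n => //.
by apply: BNn; right; split => //; apply/negP.
Qed.

Lemma ae_law_from_dirac z (P : W -> Prop) :
  {ae law_from (dirac z : probability cem R), forall w : future X, P w} ->
  {ae Prob X z, forall w, P w}.
Proof.
move=> [N [mN + NP]]; rewrite law_fromE// integral_dirac//.
  rewrite diracT mul1e => N0.
  by exists N; split => //; exact: (future_measurable hX).
exact: (measurable_Prob_future hX).
Qed.

Section PathLaw.
Variables (t : R) (t0 : 0 <= t) (z : cem).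

(** The law of X_t as an initial distribution: [augmented] ranges over probabilities, whereas
    [transition] has values in sub-probabilities. *)
Definition path_law : set cem -> \bar R := transition hX t0 z.

HB.instance Definition _ := Measure.on path_law.

Let path_law_setT : path_law setT = 1%E.
Proof. exact: probability_setT. Qed.

HB.instance Definition _ := Measure_isProbability.Build _ _ _ path_law path_law_setT.

End PathLaw.

Lemma law_from_path_law t (t0 : 0 <= t) z (N : set (future X)) : measurable N ->
  law_from (path_law t0 z : probability cem R) N =
  (\int[Prob X z]_w Prob X (path_at X t w) N)%E.
Proof.
move=> mN; rewrite law_fromE//.
have := @giry_int_map _ _ _ _ _ _ (measurable_path hX t0) (Prob X z)
  (fun y : cem => Prob X y N).
apply => //; exact: (measurable_Prob_future hX).
Qed.

(** By the Markov property, a null set for the process started with the law of X_t is null for the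
    shifted path, and also for almost every restart from X_t. Versions chosen for that initial law
    therefore serve on both sides of the Markov property. *)
Lemma ae_law_from_path t (t0 : 0 <= t) z (P : W -> Prop) :
  {ae law_from (path_law t0 z : probability cem R), forall w : future X, P w} ->
  {ae Prob X z, forall w, P (theta X t w)} /\
  {ae Prob X z, forall w, {ae Prob X (path_at X t w), forall w', P w'}}.
Proof.
move=> [N [mN + NP]]; rewrite law_from_path_law// => N0; split.
  exists (theta X t @^-1` N); split.
  - rewrite -[X in measurable X]setTI.
    exact: (measurable_theta hX t0).
  - have := markov_set hX z t0 (@measurableT _ (history X t)) mN.
    by rewrite setTI => ->.
  - by move=> w nP; exact: NP.
have mPN : measurable_fun setT (fun w => Prob X (path_at X t w) N).
  exact: measurableT_comp (measurable_Prob_future hX mN) (measurable_path hX t0).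
have : {ae Prob X z, forall w, Prob X (path_at X t w) N = 0%E}.
  have [+ _] := ae_eq_integral_abs (Prob X z) measurableT mPN.
  under eq_integral do rewrite gee0_abs//.
  by move=> /(_ N0); apply: filterS => w; apply.
apply: filterS => w Nw; exists N; split => //.
exact: (future_measurable hX).
Qed.

Lemma markov_ae t (t0 : 0 <= t) z (g F : W -> \bar R)
    (h : history X t -> \bar R) :
  (forall w, 0 <= g w <= 1)%E -> measurable_fun setT h ->
  {ae Prob X z, forall w, g w = h w} ->
  (forall w, 0 <= F w <= 1)%E ->
  ae_measurable (law_from (path_law t0 z : probability cem R)) (F : future X -> _) ->
  let E_F w := (\int[Prob X (path_at X t w)]_w' F w')%E in
  [/\ ae_measurable (Prob X z) (fun w => g w * F (theta X t w))%E,
      ae_measurable (Prob X z) (fun w => g w * E_F w)%E &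
      (\int[Prob X z]_w (g w * F (theta X t w)) = \int[Prob X z]_w (g w * E_F w))%E].
Proof.
move=> g01 mh gh F01 mF EF.
have g0 w : (0 <= g w)%E by case/andP: (g01 w).
have F0 w : (0 <= F w)%E by case/andP: (F01 w).
have [G [mG G01] FG] :=
  @ae_measurable01 _ (future X) _ _ F F01 mF.
have G0 w : (0 <= G w)%E by case/andP: (G01 w).
have [FGt FGE] := ae_law_from_path FG.
pose EG w := (\int[Prob X (path_at X t w)]_w' G w')%E.
have mGt : measurable_fun setT (fun w => G (theta X t w)).
  exact: measurableT_comp mG (measurable_theta hX t0).
have mEG : measurable_fun setT EG.
  exact: measurableT_comp (measurable_expectation hX mG G0) (measurable_path hX t0).
have EG01 w : (0 <= EG w <= 1)%E.
  rewrite integral_ge0//=; apply: (@le_trans _ _ (\int[Prob X (path_at X t w)]_w' 1)%E).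
    apply: ge0_le_integral => //.
    - exact: measurableT_comp mG (measurable_id_future hX).
    - by move=> w' _; case/andP: (G01 w').
  by rewrite integral_cst// mul1e probability_le1.
(* [h] agrees with the nonnegative [g] only almost surely; its absolute value is nonnegative
   everywhere and still depends on the past only. *)
have mh' : measurable_fun setT (fun w : W => `|h w|%E).
  apply: measurableT_comp => //.
  exact: (measurableT_comp mh (measurable_id_history hX (t := t))).
have gh' : {ae Prob X z, forall w, g w = `|h w|%E}.
  by apply: filterS gh => w <-; rewrite gee0_abs.
have FGEt : {ae Prob X z, forall w, EF w = EG w}.
  apply: filterS FGE => w FGw; apply: ge0_integral_ae_version => //.
  exact: measurableT_comp mG (measurable_id_future hX).
have E1 : {ae Prob X z, forall w, (g w * F (theta X t w) = `|h w| * G (theta X t w))%E}.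
  by move: gh' FGt; apply: filterS2 => w -> ->.
have E2 : {ae Prob X z, forall w, (g w * EF w = `|h w| * EG w)%E}.
  by move: gh' FGEt; apply: filterS2 => w -> ->.
split.
- by exists (fun w => `|h w| * G (theta X t w))%E => //; exact: emeasurable_funM.
- by exists (fun w => `|h w| * EG w)%E => //; exact: emeasurable_funM.
rewrite (ge0_integral_ae_version _ _ _ E1); last 3 first.
- exact: emeasurable_funM.
- by move=> w; rewrite mule_ge0.
- by move=> w; rewrite mule_ge0.
rewrite (ge0_integral_ae_version _ _ _ E2); last 3 first.
- exact: emeasurable_funM.
- by move=> w; rewrite mule_ge0// integral_ge0.
- by move=> w; rewrite mule_ge0//; case/andP: (EG01 w).
apply: (@integral_sub_sigma_weight _ _ _ _ (path_events X [set s | 0 <= s <= t])) => //.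
- by move=> A; exact: (history_measurable hX).
- by apply: measurableT_comp mh.
- by move=> L FL; exact: (markov_future hX).
Qed.

End Versions.

Lemma ae_measurable_bigmax d (T : measurableType d) (R : realType)
    (mu : {measure set T -> \bar R}) (I : Type) (s : seq I)
    (F : I -> T -> \bar R) :
  (forall i, ae_measurable mu (F i)) ->
  ae_measurable mu (fun x => \big[maxe/0%E]_(i <- s) F i x).
Proof.
move=> mF; elim: s => [|i s IH].
  under eq_fun do rewrite big_nil.
  by apply: measurable_ae_measurable; exact: measurable_cst.
under eq_fun do rewrite big_cons.
exact: ae_measurable_max.
Qed.

(** * Right-continuity of paths and the lifetime *)

Section Paths.
Context {R : realType} {E : pmetricType R} {d : measure_display}
  {W : measurableType d}.
Notation cem := (borel (cemetery E)).
Variables (X : process E W) (hX : hunt_process X).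

Lemma path_right_open t w (O : set (cemetery E)) : 0 <= t -> open O ->
  O (path_at X t w) ->
  exists2 e, 0 < e & forall s, t <= s < t + e -> O (path_at X s w).
Proof.
move=> t0 oO OXt.
have : \forall s \near t^'+, O (path_at X s w).
  apply: (@hunt_right_continuous _ _ _ _ X hX t w t0 O).
  by apply: open_nbhs_nbhs; split.
rewrite /at_right => /nbhs_ballP[e /= e0 He]; exists e => // s /andP[].
rewrite le_eqVlt => /orP[/eqP <- //|ts se].
apply: He => //=; rewrite /ball/= ltr0_norm ?subr_lt0// opprB.
by rewrite ltrBlDl.
Qed.

Lemma alive_open : open [set z : cemetery E | z <> None].
Proof.
rewrite (_ : mkset _ = Some @` setT).
  by apply: one_point_compactification_open_some; exact: openT.
by apply/seteqP; split => [[z|]//= _|_ [z _ <-]//]; exists z.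
Qed.

(** Being alive is an open condition, so by right-continuity a path alive at t stays alive for a
    while; this makes the inequality strict. *)
Lemma lifetime_gt t w : 0 <= t ->
  (t%:E < lifetime X w)%E <-> path_at X t w <> None.
Proof.
move=> t0; split.
  move=> tz Xt; move: tz; rewrite ltNge => /negP; apply.
  by apply: ereal_inf_lbound; exists t.
move=> Xt; have [e e0 He] := path_right_open t0 alive_open Xt.
apply: (@lt_le_trans _ _ (t + e)%:E); first by rewrite lte_fin ltrDl.
apply: le_ereal_inf_tmp => _ [s [s0 Xs] <-]; rewrite lee_fin leNgt.
apply/negP => ste; have [ts|st] := leP t s.
  by apply: (He s) => //; rewrite ts.
by apply: Xt; exact: (hunt_absorbing hX s0 (ltW st)).
Qed.

Lemma lifetime_le t w : 0 <= t ->
  (lifetime X w <= t%:E)%E <-> path_at X t w = None.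
Proof.
move=> t0; rewrite leNgt; split => [/negP zt|Xt].
  by apply: contrapT => /(lifetime_gt w t0).
by apply/negP => /(lifetime_gt w t0).
Qed.

Lemma lifetime_ge0 w : (0 <= lifetime X w)%E.
Proof. by apply: le_ereal_inf_tmp => _ [s [s0 _] <-]; rewrite lee_fin. Qed.

End Paths.

(** * Visits along a time grid *)

Section MaxHit.
Context {R : realType} {E : pmetricType R}.
Notation cem := (borel (cemetery E)).

(* The truncation makes [0 <= surv <= 1] hold on every path, also where A < 0
   outside the defining set of A. *)
Definition surv d (W : measurableType d) (A : R -> W -> \bar R) (t : R) (w : W)
    : \bar R := mine 1%E (expeR (- A t w))%E.

(** The grid starts at r and not at 0, as exit times range over t > 0. The set U lies in E in all
    uses, so a dead path makes no visit; with A = 0 this is the indicator of a visit. *)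
Definition maxhit d (W : measurableType d) (X : process E W)
    (A : R -> W -> \bar R) (U : set (cemetery E)) (r : R) (n : nat) (w : W)
    : \bar R :=
  \big[maxe/0%E]_(i < n)
    ((\1_U (path_at X (i.+1%:R * r) w))%:E * surv A (i.+1%:R * r) w)%E.

(** What holds on the defining set of A. The clause on shifted paths is listed because it comes from
    the stability of that set under shifts. *)
Definition regular d (W : measurableType d) (X : process E W)
    (A : R -> W -> \bar R) (w : W) : Prop :=
  [/\ forall t : R, 0 <= t -> (0 <= A t w)%E,
      forall t : R, 0 <= t -> (t%:E < lifetime X w)%E -> (A t w < +oo)%E,
      forall s t : R, 0 <= s -> 0 <= t ->
        A (t + s) w = (A t w + A s (theta X t w))%E,
      forall s t : R, 0 <= s -> 0 <= t -> (0 <= A s (theta X t w))%E &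
      {within `[0, +oo[%classic, continuous (fun t : R => A t w)}].

Section OneProcess.
Context d (W : measurableType d).
Variables (X : process E W) (hX : hunt_process X).
Notation history t := (g_sigma_algebraType (path_events X [set s | 0 <= s <= t])).
Notation future := (g_sigma_algebraType (path_events X [set s | 0 <= s])).

(* With A = 0 the limits taken under P^res serve for X as well. *)
Lemma pcaf_zero : pcaf X (fun _ _ => 0%E).
Proof.
have FU (D : set R) (U : set (\bar R)) : augmented X <<s path_events X D >>
    ((fun _ : W => (0 : \bar R)%E) @^-1` U).
  move=> nu; exists ((fun _ : W => (0 : \bar R)%E) @^-1` U), set0; split.
  - have [U0|U0] := pselect (U (0 : \bar R)%E).
      rewrite (_ : _ @^-1` _ = setT).
        exact: (@measurableT _ (g_sigma_algebraType (path_events X D))).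
      by apply/seteqP; split.
    rewrite (_ : _ @^-1` _ = set0).
      exact: (@measurable0 _ (g_sigma_algebraType (path_events X D))).
    by apply/seteqP; split.
  - exact: (@measurable0 _ future).
  - by apply: integral0_eq => z _; rewrite measure0.
  - by rewrite setDv setU0.
split; first by move=> t U t0 mU; exact: (FU [set s | 0 <= s <= t] U).
exists setT; split => //.
- rewrite (_ : setT = (fun _ : W => (0 : \bar R)%E) @^-1` setT)//.
  exact: (FU [set s | 0 <= s] setT).
- by move=> x; exact: aeW.
- move=> w _; split => //; split; first by move=> s t _ _; rewrite adde0.
  by apply: continuous_subspaceT => t; exact: cvg_cst.
Qed.

Variables (A : R -> W -> \bar R) (pA : pcaf X A).

Lemma pcaf_regular x : {ae Prob X (Some x), forall w, regular X A w}.
Proof.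
have [_ [L [_ aeL thL LP]]] := pA.
apply: filterS (aeL x) => w Lw.
have [A00 Age0 Afin _ [Aadd Acont]] := LP _ Lw; split => //.
move=> s t s0 t0; have [_ + _ _ _] := LP _ (thL _ _ t0 Lw); exact.
Qed.

Lemma surv01 t w : (0 <= surv A t w <= 1)%E.
Proof. by rewrite /surv le_min lee01 expeR_ge0 ge_min lexx. Qed.

Lemma regular_surv t w : regular X A w -> 0 <= t ->
  surv A t w = expeR (- A t w).
Proof.
move=> [A0 _ _ _ _] t0; rewrite /surv min_r//.
by rewrite -expeR0 lee_expeR oppe_le0; exact: A0.
Qed.

Lemma regular_survD s t w : regular X A w -> 0 <= s -> 0 <= t ->
  surv A (t + s) w = (surv A t w * surv A s (theta X t w))%E.
Proof.
move=> rw s0 t0; rewrite !(regular_surv rw)// ?addr_ge0//.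
have [A0 _ AD Ath _] := rw.
rewrite /surv min_r; last by rewrite -expeR0 lee_expeR oppe_le0; exact: Ath.
rewrite -expeRD AD// oppeD//.
by rewrite ge0_adde_def// inE; [exact: A0|exact: Ath].
Qed.

Lemma measurable_surv_op : measurable_fun setT (fun y : \bar R => mine 1%E (expeR (- y))%E).
Proof.
apply: measurable_mine => //.
by apply: measurableT_comp; [exact: measurable_expeR|exact: oppe_measurable].
Qed.

Lemma surv_history_version t (z : cem) : 0 <= t ->
  exists2 h : history t -> \bar R,
    measurable_fun setT h & {ae Prob X z, forall w, surv A t w = h w}.
Proof.
move=> t0; have [augA _] := pA.
have [|g mg Ag] := @augmented_version _ _ _ _ X hX [set s | 0 <= s <= t]
  (dirac z : probability cem R) (A t) _ (fun U mU => augA t U t0 mU).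
  by move=> s /= /andP[].
exists (fun w => mine 1%E (expeR (- g w))%E).
  exact: measurableT_comp measurable_surv_op mg.
apply: (@ae_law_from_dirac _ _ _ _ X hX z (fun w => surv A t w = mine 1%E (expeR (- g w))%E)).
by apply: filterS Ag => w; rewrite /surv => ->.
Qed.

Lemma surv_ae_measurable nu t : 0 <= t ->
  ae_measurable (law_from hX (nu : probability cem R)) (surv A t : future -> \bar R).
Proof.
move=> t0; have [augA _] := pA.
have [|g mg Ag] := @augmented_version _ _ _ _ X hX [set s | 0 <= s <= t]
  nu (A t) _ (fun U mU => augA t U t0 mU).
  by move=> s /= /andP[].
exists (fun w => mine 1%E (expeR (- g w))%E); last first.
  by apply: filterS Ag => w; rewrite /surv => ->.
move=> _ Y mY; rewrite setTI.
apply: (@path_events_sub _ _ _ _ X [set s | 0 <= s <= t]).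
  by move=> s /= /andP[].
have mh : measurable_fun setT (fun w : history t => mine 1%E (expeR (- g w))%E).
  exact: measurableT_comp measurable_surv_op mg.
by have := mh measurableT Y mY; rewrite setTI.
Qed.

Variables (V : set E) (mV : measurable (V : set (borel E))).
Let U : set (cemetery E) := Some @` V.
Let U' : set (cemetery E) := Some @` (~` V).

Let mU : measurable (U : set cem). Proof. exact: measurable_Some_image. Qed.
Let mU' : measurable (U' : set cem).
Proof. by apply: measurable_Some_image; exact: measurableC. Qed.

Lemma maxhit01 r n w : (0 <= maxhit X A U r n w <= 1)%E.
Proof.
apply/andP; split.
  rewrite /maxhit; elim/big_ind : _ => // [x y x0 y0|i _].
    by rewrite le_max x0.
  by rewrite mule_ge0// ?lee_fin//; case/andP: (surv01 (i.+1%:R * r) w).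
rewrite /maxhit; elim/big_ind : _ => // [x y x1 y1|i _].
  by rewrite ge_max x1.
have /andP[s0 s1] := surv01 (i.+1%:R * r) w.
rewrite indicE; case: (_ \in _); last by rewrite mul0e.
by rewrite mul1e.
Qed.

Lemma maxhit_ae_measurable nu r n : 0 <= r ->
  ae_measurable (law_from hX (nu : probability cem R))
    (maxhit X A U r n : future -> \bar R).
Proof.
move=> r0; apply: ae_measurable_bigmax => i.
have ir0 : 0 <= i.+1%:R * r by rewrite mulr_ge0.
apply: ae_measurableM; last exact: surv_ae_measurable.
apply: measurable_ae_measurable; apply/measurable_EFinP.
have mI : measurable_fun setT (\1_U : cem -> R) by exact: measurable_indic.
exact: (measurableT_comp mI (measurable_path_future (X := X) ir0)).
Qed.

(** A visit at time r settles the maximum, since the later values carry the factor [surv A r w] and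
    another factor at most 1. Without one, that factor comes out and the shifted path continues;
    after death every term vanishes. *)
Lemma maxhit_recl r n w : 0 <= r -> regular X A w ->
  maxhit X A U r n.+1 w =
  (surv A r w * (\1_U (path_at X r w))%:E +
   surv A r w * (\1_U' (path_at X r w))%:E * maxhit X A U r n (theta X r w))%E.
Proof.
move=> r0 rw; have rS i : (i.+2%:R * r = r + i.+1%:R * r :> R).
  by rewrite -[i.+2]add1n natrD mulrDl mul1r.
have /andP[s0 s1] := surv01 r w.
have sfin : surv A r w \is a fin_num.
  by rewrite ge0_fin_numE// (le_lt_trans s1)// ltry.
have -> : maxhit X A U r n.+1 w =
    maxe ((\1_U (path_at X r w))%:E * surv A r w)%E
         (surv A r w * maxhit X A U r n (theta X r w))%E.
  rewrite /maxhit big_ord_recl mul1r; congr (maxe _ _).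
  rewrite (big_endo (fun y => surv A r w * y)%E); last 2 first.
  - by move=> y z; rewrite maxe_pMr.
  - by rewrite mule0.
  apply: eq_bigr => i _; rewrite rS regular_survD ?mulr_ge0//.
  by rewrite (hunt_shift hX) ?mulr_ge0// muleCA.
have /andP[M0 M1] := maxhit01 r n (theta X r w).
case Xr : (path_at X r w) => [y|].
  have [Vy|Vy] := pselect (V y).
    rewrite !indicE mem_set; last by exists y.
    rewrite memNset; last by move=> [z nVz [zy]]; apply: nVz; rewrite zy.
    rewrite mul1e mule1 mule0 mul0e adde0 max_l//.
    by rewrite -[leRHS]mule1 lee_wpmul2l.
  rewrite !indicE memNset; last by move=> [z Vz [zy]]; apply: Vy; rewrite -zy.
  rewrite mem_set; last by exists y.
  by rewrite mul0e mule0 add0e mule1 max_r// mule_ge0.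
rewrite !indicE memNset; last by move=> [].
rewrite memNset; last by move=> [].
rewrite mul0e !mule0 mul0e add0e.
suff -> : maxhit X A U r n (theta X r w) = 0%E by rewrite mule0 maxxx.
rewrite /maxhit; elim/big_ind : _ => // [y z -> ->|i _]; first by rewrite maxxx.
rewrite (hunt_shift hX) ?mulr_ge0// (hunt_absorbing hX r0 _ Xr) ?lerDl ?mulr_ge0//.
by rewrite indicE memNset ?mul0e// => -[].
Qed.

Lemma maxhit_step r n x : 0 <= r ->
  (\int[Prob X (Some x)]_w maxhit X A U r n.+1 w =
   \int[Prob X (Some x)]_w (surv A r w *
     ((\1_U (path_at X r w))%:E + (\1_U' (path_at X r w))%:E *
       \int[Prob X (path_at X r w)]_w' maxhit X A U r n w')))%E.
Proof.
move=> r0.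
have s0 w : (0 <= surv A r w)%E by case/andP: (surv01 r w).
have [h mh sh] := surv_history_version (Some x) r0.
have mI (B : set cem) : measurable B ->
    measurable_fun setT (fun w : history r => (\1_B (path_at X r w))%:E : \bar R).
  move=> mB; apply/measurable_EFinP.
  have mIB : measurable_fun setT (\1_B : cem -> R) by exact: measurable_indic.
  apply: (measurableT_comp mIB (measurable_path_history (X := X) _)).
  by rewrite r0 lexx.
have mhW (f : history r -> \bar R) : measurable_fun setT f ->
    measurable_fun setT (f : W -> \bar R).
  by move=> mf; exact: (measurableT_comp mf (measurable_id_history hX (t := r))).
have s1 (B : set cem) w : (0 <= surv A r w * (\1_B (path_at X r w))%:E <= 1)%E.
  rewrite indicE; case: (_ \in _); last by rewrite mule0 lexx lee01.
  by rewrite mule1 surv01.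
have mg (B : set cem) : measurable B ->
    {ae Prob X (Some x), forall w, (surv A r w * (\1_B (path_at X r w))%:E =
                                    h w * (\1_B (path_at X r w))%:E)%E}.
  by move=> mB; apply: filterS sh => w ->.
have mgh (B : set cem) : measurable B ->
    measurable_fun setT (fun w : history r => (h w * (\1_B (path_at X r w))%:E)%E).
  by move=> mB; apply: emeasurable_funM => //; exact: mI.
have mgU : ae_measurable (Prob X (Some x))
    (fun w => surv A r w * (\1_U (path_at X r w))%:E)%E.
  exists (fun w : W => h w * (\1_U (path_at X r w))%:E)%E; last exact: mg.
  exact: mhW (mgh _ mU).
have [m1 m2 eq12] := markov_ae (s1 U') (mgh _ mU') (mg _ mU') (maxhit01 r n)
  (maxhit_ae_measurable (path_law hX r0 (Some x)) n r0).
have M0 w : (0 <= maxhit X A U r n w)%E by case/andP: (maxhit01 r n w).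
rewrite (@ge0_integral_ae _ _ _ _ _ (fun w =>
  surv A r w * (\1_U (path_at X r w))%:E +
  surv A r w * (\1_U' (path_at X r w))%:E * maxhit X A U r n (theta X r w))%E).
- rewrite ge0_integralD_ae//; last 2 first.
  + by move=> w; rewrite mule_ge0// lee_fin.
  + by move=> w; rewrite mule_ge0// mule_ge0// lee_fin.
  rewrite eq12 -ge0_integralD_ae//; last 2 first.
  + by move=> w; rewrite mule_ge0// lee_fin.
  + by move=> w; rewrite mule_ge0 ?integral_ge0// mule_ge0// lee_fin.
  apply: eq_integral => w _; rewrite -muleA -ge0_muleDr ?mule_ge0 ?integral_ge0 ?lee_fin//.
- by apply: ae_measurable2 m1 => // *; exact: emeasurable_funD.
- by move=> w; case/andP: (maxhit01 r n.+1 w).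
- by move=> w; rewrite adde_ge0// mule_ge0// ?mule_ge0// lee_fin.
- by apply: filterS (pcaf_regular x) => w; exact: maxhit_recl.
Qed.

End OneProcess.
End MaxHit.

Lemma measurable_bigmaxe d (T : measurableType d) (R : realType)
    (I : Type) (s : seq I) (F : I -> T -> \bar R) :
  (forall i, measurable_fun setT (F i)) ->
  measurable_fun setT (fun x => \big[maxe/0%E]_(i <- s) F i x).
Proof.
move=> mF; elim: s => [|i s IH].
  by under eq_fun do rewrite big_nil; exact: measurable_cst.
by under eq_fun do rewrite big_cons; exact: measurable_maxe.
Qed.

(** * Transfer of grid visits between the process and its resurrection *)

Section Subprocess.
Context {R : realType} {E : pmetricType R} {d d' : measure_display}
  {W : measurableType d} {W' : measurableType d'}.
Notation cem := (borel (cemetery E)).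
Variables (X : process E W) (Y : process E W') (A : R -> W' -> \bar R).
Hypotheses (hX : hunt_process X) (hY : hunt_process Y) (pA : pcaf Y A).
Hypothesis XY : subprocess X Y A.
Variables (V : set E) (mV : measurable (V : set (borel E))).
Let U : set (cemetery E) := Some @` V.
Let zero : R -> W -> \bar R := fun _ _ => 0%E.

Let surv_zero t w : surv zero t w = 1%E.
Proof. by rewrite /surv oppe0 expeR0 minxx. Qed.

Let measurable_maxhit0 r n : 0 <= r ->
  measurable_fun setT (fun z : cem => \int[Prob X z]_w maxhit X zero U r n w)%E.
Proof.
move=> r0; apply: (measurable_expectation hX); last first.
  by move=> w; case/andP: (maxhit01 X zero V r n w).
apply: measurable_bigmaxe => i.
apply: (eq_measurable_fun (fun w : g_sigma_algebraType (path_events X [set s | 0 <= s]) =>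
    (\1_U (path_at X (i.+1%:R * r) w))%:E)).
  by move=> w _; rewrite [surv _ _ _]surv_zero mule1.
apply/measurable_EFinP.
have mI : measurable_fun setT (\1_U : cem -> R).
  by apply: measurable_indic; exact: measurable_Some_image.
have ir0 : 0 <= i.+1%:R * r by rewrite mulr_ge0.
exact: (measurableT_comp mI (measurable_path_future (X := X) ir0)).
Qed.

(** Each step of the induction is one application of the subprocess identity at time r, to a
    function that already contains the expectation over the remaining grid. *)
Lemma maxhit_subprocess r n x : 0 < r ->
  (\int[Prob X (Some x)]_w maxhit X zero U r n w =
   \int[Prob Y (Some x)]_w maxhit Y A U r n w)%E.
Proof.
move=> r_gt0; have r0 := ltW r_gt0.
elim: n x => [|n IH] x.
  by rewrite !integral0_eq// => w _; rewrite /maxhit big_ord0.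
rewrite (maxhit_step hX (pcaf_zero X) mV)// (maxhit_step hY pA mV)//.
pose Q z := (\int[Prob X z]_w maxhit X zero U r n w)%E.
have Q01 z : (0 <= Q z <= 1)%E.
  rewrite integral_ge0/=; last by move=> w _; case/andP: (maxhit01 X zero V r n w).
  rewrite (@le_trans _ _ (\int[Prob X z]_w 1)%E)//.
    apply: ge0_le_lower_integral => w; by case/andP: (maxhit01 X zero V r n w).
  by rewrite integral_cst// mul1e probability_le1.
have Qfin z : Q z \is a fin_num.
  by have /andP[Q0 /le_lt_trans Q1] := Q01 z; rewrite ge0_fin_numE// Q1// ltry.
(* The value seen at time r: 1 in V, and outside V the expected maximum over n further steps, which
   by induction is the same for Y. *)
pose f y : R := \1_V y + \1_(~` V) y * fine (Q (Some y)).
have f0 y : 0 <= f y.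
  by rewrite addr_ge0// mulr_ge0// fine_ge0//; case/andP: (Q01 (Some y)).
have mf : borel_fun f.
  rewrite /borel_fun; apply: measurable_funD; first exact: measurable_indic.
  apply: measurable_funM; first by apply: measurable_indic; exact: measurableC.
  apply: (@measurableT_comp _ _ _ _ _ _ (@fine R)) => //.
  exact: (measurableT_comp (measurable_maxhit0 n r0) measurable_Some).
have oappE (z : cemetery E) (q : \bar R) : (forall y, z = Some y -> q = Q (Some y)) ->
    ((\1_U z)%:E + (\1_(Some @` (~` V) : set (cemetery E)) z)%:E * q =
     oapp (EFin \o f) 0 z)%E.
  case: z => [y|] Hq /=; last first.
    by rewrite !indicE !memNset ?mul0e ?adde0// => -[].
  rewrite /f EFinD EFinM fineK// -(Hq y)//.
  have SE (B : set E) : \1_(Some @` B) (Some y : cemetery E) = \1_B y :> R.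
    rewrite !indicE; have [By|By] := pselect (B y).
      by rewrite !mem_set//; exists y.
    by rewrite !memNset// => -[z Bz [zy]]; apply: By; rewrite -zy.
  by rewrite !SE.
transitivity (esemigroup X r (EFin \o f) x).
  rewrite /esemigroup [RHS]integral_mkcond; apply: eq_integral => w _.
  rewrite surv_zero mul1e patchE oappE; last by move=> y ->.
  case: ifPn => // /negP; rewrite inE => rz.
  case Xr : (path_at X r w) => [y|] //=; exfalso; apply: rz.
  by apply/(lifetime_gt hX w r0); rewrite Xr.
rewrite XY//.
rewrite [LHS]integral_mkcond; apply/esym.
have s0 w : (0 <= surv A r w)%E by case/andP: (surv01 A r w).
have o0 z : (0 <= oapp (EFin \o f) 0 z)%E by case: z => [y|]//=; rewrite lee_fin.
transitivity (\int[Prob Y (Some x)]_w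
    (surv A r w * oapp (EFin \o f) 0%E (path_at Y r w)))%E.
  apply: eq_integral => w _; congr (_ * _)%E; apply: oappE => y ->.
  exact/esym/IH.
apply/esym; apply: ge0_integral_ae.
- have [h mh sh] := surv_history_version hY pA (Some x : cem) r0.
  apply: ae_measurableM.
    exists h => //.
    exact: (measurableT_comp mh (measurable_id_history hY (t := r))).
  apply: measurable_ae_measurable.
  have mof : measurable_fun setT (oapp (EFin \o f) 0%E : cem -> \bar R).
    by apply: measurable_oapp; exact/measurable_EFinP.
  exact: (measurableT_comp mof (measurable_path hY r0)).
- move=> w; rewrite patchE; case: ifPn => // _.
  by rewrite mule_ge0// expeR_ge0.
- by move=> w; rewrite mule_ge0.
- apply: filterS (pcaf_regular pA x) => w rw; rewrite patchE.
  case: ifPn => [_|/negP]; first by rewrite (regular_surv rw).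
  rewrite inE => rz.
  case Yr : (path_at Y r w) => [y|] /=; last by rewrite mule0.
  by exfalso; apply: rz; apply/(lifetime_gt hY w r0); rewrite Yr.
Qed.

End Subprocess.

(** * Exit times and passage to the limit *)

Section ExitTimes.
Context {R : realType} {E : pmetricType R} {d : measure_display}
  {W : measurableType d}.
Notation cem := (borel (cemetery E)).
Notation history X t := (g_sigma_algebraType (path_events X [set s | 0 <= s <= t])).
Variables (X : process E W) (hX : hunt_process X).

Lemma exit_time_ge0 F w : (0 <= exit_time X F w)%E.
Proof. by apply: le_ereal_inf_tmp => _ [s [s0 _] <-]; rewrite lee_fin ltW. Qed.

Lemma exit_time_lt F w s : (exit_time X F w < s%:E)%E ->
  exists t, [/\ 0 < t, t < s, (exit_time X F w <= t%:E)%E &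
    ~ (Some @` F) (path_at X t w)].
Proof.
move=> /ereal_inf_lt[_ [t [t0 nF] <-]]; rewrite lte_fin => ts.
by exists t; split => //; apply: ereal_inf_lbound; exists t.
Qed.

Lemma exit_time_le F w t : 0 < t -> ~ (Some @` F) (path_at X t w) ->
  (exit_time X F w <= t%:E)%E.
Proof. by move=> t0 nF; apply: ereal_inf_lbound; exists t. Qed.

(** The complement of a compact set is open in the cemetery space, so an exit at a real time is
    followed at once by a rational time outside F. *)
Lemma exit_time_stopping F : compact F -> stopping_time X (exit_time X F).
Proof.
move=> cF; split=> [w|t t0 v tv]; first exact: exit_time_ge0.
(* Times decreasing to t within ]t, v]: an exit time equal to t is detected only just after t, hence
   in the history up to v. *)
pose s j := t + (v - t) / j.+1%:R.
have ts j : t < s j by rewrite ltrDl divr_gt0// subr_gt0.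
have sv j : s j <= v.
  rewrite -lerBrDl ler_pdivrMr// ler_peMr ?subr_ge0 ?(ltW tv)//.
  by rewrite ler1n.
rewrite (_ : mkset _ = \bigcap_j \bigcup_(q : rat)
  [set w | 0 < (ratr q : R) < s j /\ (~` (Some @` F)) (path_at X (ratr q) w)]); last first.
  apply/seteqP; split => w /=.
    move=> wt j _.
    have [|u [u0 us _ nF]] := @exit_time_lt F w (s j).
      by rewrite (le_lt_trans wt)// lte_fin.
    have [e e0 He] := path_right_open hX (ltW u0) (open_None_compl cF) nF.
    have /rat_in_itvoo[q] : u < Num.min (u + e) (s j) by rewrite lt_min ltrDl e0.
    rewrite in_itv/= lt_min => /and3P[uq que qs].
    exists q => //; split; first by rewrite (lt_trans u0 uq).
    by apply: He; rewrite (ltW uq).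
  move=> Hw; apply/lee_addgt0Pr => e e0.
  have [j jN] : exists j, s j < t + e.
    have [j] := ltr_add_invr (divr_gt0 e0 (etrans (subr_gt0 t v) tv)).
    rewrite add0r ltr_pdivlMr ?subr_gt0// => je.
    by exists j; rewrite /s ltrD2l mulrC.
  have [q _ [/andP[q0 qs] nF]] := Hw j I.
  apply: le_trans (exit_time_le q0 nF) _.
  by rewrite -EFinD lee_fin ltW// (lt_trans qs).
apply: (@bigcapT_measurable _ (history X v)) => j.
apply: (@bigcupT_measurable_rat _ (history X v)) => q.
have [/andP[q0 qs]|nq] := pselect (0 < (ratr q : R) < s j); last first.
  rewrite (_ : [set w | _ /\ _] = set0).
    exact: (@measurable0 _ (history X v)).
  by apply/seteqP; split => // w [].
rewrite (_ : [set w | _ /\ _] = path_at X (ratr q) @^-1` (~` (Some @` F))); last first.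
  by apply/seteqP; split => [w []//|w nF]; split => //; rewrite q0.
have mp : measurable_fun setT (path_at X (ratr q) : history X v -> cem).
  by apply: measurable_path_history; rewrite ltW//= (le_trans (ltW qs)).
have mO : measurable (~` (Some @` F) : set cem).
  by apply: sub_sigma_algebra; exact: open_None_compl.
by have := mp measurableT _ mO; rewrite setTI.
Qed.

Section Exhaustion.
Variables (K : nat -> set E) (hK : compact_exhaustion K).

Let tau n w := exit_time X (K n) w.
Definition exhaust_time w : \bar R := ereal_sup (range (tau ^~ w)).

Lemma exh_sub n m : (n <= m)%N -> K n `<=` K m.
Proof.
elim: m => [|m IH]; first by rewrite leqn0 => /eqP ->.
rewrite leq_eqVlt => /orP[/eqP -> //|nm].
apply: subset_trans (IH nm) _; apply: subset_trans (@exh_interior _ _ _ hK m) _.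
exact: interior_subset.
Qed.

Lemma exit_time_exh n m w : (n <= m)%N -> (tau n w <= tau m w)%E.
Proof.
move=> nm; apply: le_ereal_inf => _ [t [t0 nK] <-]; exists t => //; split => //.
by move=> [y Ky yX]; apply: nK; exists y => //; exact: exh_sub Ky.
Qed.

(** From the interior of K_m the path could not leave K_m at once, contrary to the infimum defining
    [tau m w]. *)
Lemma exit_time_outside_interior n m w : (n <= m)%N -> (tau m w < +oo)%E ->
  ~ (Some @` interior (K n)) (path_at X (fine (tau m w)) w).
Proof.
move=> nm tfin.
have tnum : tau m w \is a fin_num by rewrite ge0_fin_numE// exit_time_ge0.
have t0 : 0 <= fine (tau m w) by rewrite fine_ge0// exit_time_ge0.
have oI : open (Some @` interior (K m) : set (cemetery E)).
  by apply: one_point_compactification_open_some; exact: open_interior.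
have sI : interior (K n) `<=` interior (K m) by apply: interiorS; exact: exh_sub.
move=> [y Iy yX].
have [|e e0 He] := path_right_open hX t0 oI (w := w).
  by exists y => //; exact: sI.
have [|t [t_gt0 te tt nK]] := @exit_time_lt (K m) w (fine (tau m w) + e).
  by rewrite EFinD fineK// lteDl// lte_fin.
apply: nK; have [|z Iz zX] := He t.
  by rewrite te andbT -lee_fin fineK.
by exists z => //; exact: interior_subset Iz.
Qed.

(** By quasi-left-continuity the positions at the exit times converge to the position at their
    supremum. A limit in E would have a neighbourhood inside some K_n, which the later exit
    positions avoid. *)
Lemma exhaust_None z : {ae Prob X z, forall w, (exhaust_time w < +oo)%E ->
  path_at X (fine (exhaust_time w)) w = None}.
Proof.
have nd n w : (tau n w <= tau n.+1 w)%E by exact: exit_time_exh.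
have cv w : tau n w @[n --> \oo] --> exhaust_time w.
  by apply: ereal_nondecreasing_cvgn; apply/nondecreasing_seqP => n; exact: nd.
have stop n : stopping_time X (tau n).
  by apply: exit_time_stopping; exact: exh_compact.
have := @hunt_quasi_left_continuous _ _ _ _ X hX tau exhaust_time stop nd cv z.
apply: filterS => w qlc toof.
have {qlc} qlc := qlc toof.
case Xt : (path_at X (fine (exhaust_time w)) w) => [y|]//; exfalso.
have [n _ Kny] : (\bigcup_n K n) y by rewrite (exh_cover hK).
have oI : open (Some @` interior (K n.+1) : set (cemetery E)).
  by apply: one_point_compactification_open_some; exact: open_interior.
have /qlc[N _ HN] : nbhs (path_at X (fine (exhaust_time w)) w)
    (Some @` interior (K n.+1) : set (cemetery E)).
  apply: open_nbhs_nbhs; split => //; rewrite Xt; exists y => //.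
  exact: (exh_interior hK).
have := HN (maxn N n.+1) (leq_maxl _ _).
apply: exit_time_outside_interior; first exact: leq_maxr.
apply: le_lt_trans toof; apply: ereal_sup_ubound.
by exists (maxn N n.+1).
Qed.

Lemma exhaust_time_lifetime z : {ae Prob X z, forall w, (exhaust_time w < +oo)%E ->
  (lifetime X w <= exhaust_time w)%E}.
Proof.
apply: filterS (exhaust_None z) => w None_w toof.
have t0 : (0 <= exhaust_time w)%E.
  by apply: le_trans (exit_time_ge0 (K 0) w) _; apply: ereal_sup_ubound; exists 0%N.
have tnum : exhaust_time w \is a fin_num by rewrite ge0_fin_numE.
rewrite -(fineK tnum); apply/(lifetime_le hX); first exact: fine_ge0.
exact: None_w.
Qed.

End Exhaustion.
End ExitTimes.

Lemma cvge_from_below (R : realType) (u : nat -> \bar R) (l : \bar R) :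
  l \is a fin_num -> (forall n, u n <= l)%E ->
  (forall c : R, (c%:E < l)%E -> \forall n \near \oo, (c%:E < u n)%E) ->
  u n @[n --> \oo] --> l.
Proof.
move=> lfin ul cu; rewrite -(fineK lfin).
have ufin : \forall n \near \oo, u n \is a fin_num.
  have := cu (fine l - 1) _; rewrite -{2}(fineK lfin) lte_fin ltrBlDr ltrDl.
  move=> /(_ ltr01); apply: filterS => n cun.
  rewrite fin_numElt (lt_trans _ cun) ?ltNyr//=.
  by rewrite (le_lt_trans (ul n))// ltey_eq lfin.
apply/fine_cvgP; split => //; apply/cvgrPdist_lt => e e0.
have := cu (fine l - e) _; rewrite -{2}(fineK lfin) lte_fin ltrBlDr ltrDl.
move=> /(_ e0); move: ufin; apply: filterS2 => n un cun /=.
have fu : fine (u n) <= fine l by apply: fine_le.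
rewrite ger0_norm ?subr_ge0// ltrBlDr -ltrBlDl.
by rewrite -lte_fin fineK.
Qed.

Section RegularPaths.
Context {R : realType} {E : pmetricType R} {d : measure_display}
  {W : measurableType d}.
Variables (X : process E W) (hX : hunt_process X) (A : R -> W -> \bar R).

Lemma regular_le s t w : regular X A w -> 0 <= s -> s <= t -> (A s w <= A t w)%E.
Proof.
move=> [A0 _ AD Ath _] s0 st; rewrite -(subrK s t) addrC AD ?subr_ge0//.
by rewrite leeDl// Ath// subr_ge0.
Qed.

Lemma regular_surv_le s t w : regular X A w -> 0 <= s -> s <= t ->
  (surv A t w <= surv A s w)%E.
Proof.
move=> rw s0 st; have t0 := le_trans s0 st.
rewrite !(regular_surv rw)// lee_expeR leeNl oppeK.
exact: regular_le.
Qed.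

Lemma regular_surv_cvg (s : R) w : regular X A w -> 0 <= s ->
  surv A u w @[u --> within [set v | 0 <= v] (nbhs s)] --> surv A s w.
Proof.
move=> rw s0; have [_ _ _ _ cA] := rw.
have cs : A u w @[u --> within [set v | 0 <= v] (nbhs s)] --> A s w.
  have : A u w @[u --> nbhs_subspace (s : subspace `[0, +oo[%classic)] --> A s w.
    exact: cA.
  rewrite -nbhs_subspace_in; last by rewrite /= in_itv/= s0.
  rewrite (_ : [set` `[0, +oo[] = [set v | 0 <= v])//.
  by apply/seteqP; split => v /=; rewrite in_itv/= andbT.
rewrite (regular_surv rw)//.
have : expeR (- A u w) @[u --> within [set v | 0 <= v] (nbhs s)] --> expeR (- A s w).
  have e : expeR (- y) @[y --> A s w] --> expeR (- A s w).
    apply: (@cvg_comp _ _ _ -%E (@expeR R) _ (nbhs (- A s w)%E)).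
      exact: oppe_continuous.
    exact: expeR_continuous.
  exact: cvg_comp cs e.
apply: cvg_trans; apply: near_eq_cvg.
rewrite /prop_near1 /within/=; apply: nearW => u u0.
by rewrite (regular_surv rw).
Qed.

Lemma regular_surv_gt (s : R) w (c : \bar R) : regular X A w -> 0 <= s ->
  (c < surv A s w)%E ->
  exists2 e, 0 < e & forall u, s <= u < s + e -> (c < surv A u w)%E.
Proof.
move=> rw s0 cs.
have : \forall u \near within [set v | 0 <= v] (nbhs s), (c < surv A u w)%E.
  have oc : nbhs (surv A s w) [set y | (c < y)%E].
    by apply: open_nbhs_nbhs; split => //; exact: open_ereal_gt_ereal.
  exact: (regular_surv_cvg rw s0 oc).
move=> /nbhs_ballP[e /= e0 He]; exists e => // u /andP[su us].
apply: He; last exact: le_trans su.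
by rewrite /ball/= ler0_norm ?subr_le0// opprB ltrBlDl.
Qed.

Section Hits.
Variables (K : nat -> set E) (hK : compact_exhaustion K).
Let U n : set (cemetery E) := Some @` (~` K n).

Lemma closed_exh n : closed (K n).
Proof.
by apply: compact_closed; [exact: metric_hausdorff|exact: exh_compact].
Qed.

Lemma measurable_exhC n : measurable (~` K n : set (borel E)).
Proof. by apply: sub_sigma_algebra; apply: closed_openC; exact: closed_exh. Qed.

Let oU n : open (U n).
Proof.
apply: one_point_compactification_open_some.
by apply: closed_openC; exact: closed_exh.
Qed.

Let U_alive n s w : U n (path_at X s w) <->
  path_at X s w <> None /\ ~ (Some @` K n) (path_at X s w).
Proof.
split => [[y nKy <-]|[]].
  by split => // -[z Kz [zy]]; apply: nKy; rewrite -zy.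
by case: (path_at X s w) => [y|] // _ nK; exists y => // Ky; apply: nK; exists y.
Qed.

Lemma exit_lt_lifetimeP n w : (exit_time X (K n) w < lifetime X w)%E <->
  exists2 s, 0 < s & U n (path_at X s w).
Proof.
split => [/ereal_inf_lt[_ [s [s0 nK] <-]] sz|[s s0 /U_alive[Xs nK]]].
  exists s => //; apply/U_alive; split => //.
  by apply/(lifetime_gt hX w (ltW s0)).
apply: le_lt_trans (exit_time_le s0 nK) _.
by apply/(lifetime_gt hX w (ltW s0)).
Qed.

Definition suphit (T : R) n w : \bar R :=
  ereal_sup [set ((\1_(U n) (path_at X s w))%:E * surv A s w)%E | s in `]0, T]%classic].

Lemma suphit01 T n w : 0 < T -> (0 <= suphit T n w <= 1)%E.
Proof.
move=> T0.
have v01 s : (0 <= (\1_(U n) (path_at X s w))%:E * surv A s w <= 1)%E.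
  rewrite indicE; case: (_ \in _); last by rewrite mul0e lexx lee01.
  by rewrite mul1e surv01.
apply/andP; split; last by apply: ge_ereal_sup => _ [s _ <-]; case/andP: (v01 s).
have /andP[v0 _] := v01 T; apply: le_trans v0 _.
by apply: ereal_sup_ubound; exists T => //=; rewrite in_itv/= T0 lexx.
Qed.

(** U_n is open and [surv] continuous in time, so a nearly optimal time has an interval of nearly
    optimal times to its right, and a fine grid meets it. *)
Lemma maxhit_cvg_suphit T n w : 0 < T -> regular X A w ->
  maxhit X A (U n) (T / N.+1%:R) N.+1 w @[N --> \oo] --> suphit T n w.
Proof.
move=> T0 rw; have /andP[Z0 Z1] := suphit01 n w T0.
have Zfin : suphit T n w \is a fin_num.
  by rewrite ge0_fin_numE// (le_lt_trans Z1)// ltry.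
apply: cvge_from_below => //.
  move=> N; rewrite /maxhit; elim/big_ind : _ => //.
    by move=> y z yZ zZ; rewrite ge_max yZ.
  move=> i _; apply: ereal_sup_ubound.
  exists (i.+1%:R * (T / N.+1%:R)) => //=; rewrite in_itv/=; apply/andP; split.
    by rewrite mulr_gt0// divr_gt0.
  by rewrite mulrCA ler_piMr ?(ltW T0)// ler_pdivrMr// mul1r ler_nat ltn_ord.
move=> c /ereal_sup_gt[_ [s + <-] cs]; rewrite /= in_itv/= => /andP[s0 sT].
have maxhit_ge N (i : 'I_N.+1) :
    ((\1_(U n) (path_at X (i.+1%:R * (T / N.+1%:R)) w))%:E *
      surv A (i.+1%:R * (T / N.+1%:R)) w <=
     maxhit X A (U n) (T / N.+1%:R) N.+1 w)%E.
  exact: (le_bigmax _ (fun i : 'I_N.+1 => ((\1_(U n) (path_at X (i.+1%:R * (T / N.+1%:R)) w))%:E *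
      surv A (i.+1%:R * (T / N.+1%:R)) w)%E) i).
have [c0|c0] := ltP c 0.
  apply: nearW => N; apply: (@lt_le_trans _ _ 0%E); first by rewrite lte_fin.
  by case/andP: (maxhit01 X A (~` K n) (T / N.+1%:R) N.+1 w).
have [Us|nUs] := pselect (U n (path_at X s w)); last first.
  by move: cs; rewrite indicE memNset// mul0e lte_fin ltNge c0.
rewrite indicE mem_set// mul1e in cs.
(* At s = T the interval to the right would leave ]0, T], but T is itself the last point of every
   grid. *)
move: sT; rewrite le_eqVlt => /orP[/eqP sT|sT].
  apply: nearW => N; apply: lt_le_trans (maxhit_ge N ord_max) => /=.
  by rewrite mulrCA divff ?mulr1// -sT indicE mem_set// mul1e.
have [e1 e10 H1] := path_right_open hX (ltW s0) (@oU n) Us.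
have [e2 e20 H2] := regular_surv_gt rw (ltW s0) cs.
(* The bound T - s keeps the grid time found below T, hence its index in range. *)
pose e := Num.min (Num.min e1 e2) (T - s).
have e0 : 0 < e by rewrite !lt_min e10 e20 subr_gt0.
have := near_infty_natSinv_lt (PosNum (divr_gt0 e0 T0)).
apply: filterS => N /=; rewrite ltr_pdivlMr// mulrC => Ne.
set q := T / N.+1%:R in Ne *.
have q0 : 0 < q by rewrite divr_gt0.
(* The grid time number i is the last one at or before s, so number i + 1 is the first after s, at
   distance at most q. *)
have /andP[is_ si] := truncn_itv (divr_ge0 (ltW s0) (ltW q0)).
set i := Num.trunc (s / q) in is_ si.
rewrite ler_pdivlMr// in is_; rewrite ltr_pdivrMr// in si.
have iqe : i.+1%:R * q < s + e.
  by rewrite -[i.+1]addn1 natrD mulrDl mul1r ler_ltD.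
have iT : i.+1%:R * q < T.
  by apply: lt_le_trans iqe _; rewrite -lerBrDl ge_min lexx orbT.
have iN : (i < N.+1)%N.
  rewrite -(ltn_add2r 1) !addn1 -(ltr_nat R).
  apply: (@lt_le_trans _ _ N.+1%:R); last by rewrite ler_nat.
  by rewrite -(ltr_pM2r q0) (lt_le_trans iT)// /q mulrCA divff ?mulr1.
apply: lt_le_trans (maxhit_ge N (Ordinal iN)) => /=.
rewrite -/q indicE mem_set ?mul1e.
  apply: H2; rewrite (ltW si)/=; apply: lt_le_trans iqe _.
  by rewrite lerD2l !ge_min lexx orbT.
apply: H1; rewrite (ltW si)/=; apply: lt_le_trans iqe _.
by rewrite lerD2l !ge_min lexx.
Qed.

Definition killed_at_boundary T w : \bar R :=
  if `[< Omega_p X K w /\ (lifetime X w <= T%:E)%E >]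
  then surv A (fine (lifetime X w)) w else 0%E.

Lemma suphit_cvg T w : 0 < T -> regular X A w ->
  ((exhaust_time X K w < +oo)%E -> (lifetime X w <= exhaust_time X K w)%E) ->
  suphit T n w @[n --> \oo] --> killed_at_boundary T w.
Proof.
move=> T0 rw zex; rewrite /killed_at_boundary.
have subU n m s : (n <= m)%N -> U m (path_at X s w) -> U n (path_at X s w).
  move=> nm [y nK <-]; exists y => // Ky; apply: nK.
  exact: (exh_sub hK nm).
case: asboolP => [[Op zT]|nOp]; last first.
  (* If every U_n were visited by time T, then the exit times and, by the last hypothesis, the
     lifetime would be at most T, and the path would belong to the excluded event. *)
  have [n nhit] : exists n, forall s, 0 < s <= T -> ~ U n (path_at X s w).
    apply: contrapT => /forallNP allhit; apply: nOp.
    have hit n : exists2 s, 0 < s <= T & U n (path_at X s w).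
      apply: contrapT => nh; apply: (allhit n) => s sT Us.
      by apply: nh; exists s.
    have exT : (exhaust_time X K w <= T%:E)%E.
      apply: ge_ereal_sup => _ [n _ <-].
      have [s /andP[s0 sT] /U_alive[_ nK]] := hit n.
      by apply: le_trans (exit_time_le s0 nK) _; rewrite lee_fin.
    have zT : (lifetime X w <= T%:E)%E.
      apply: (le_trans _ exT); apply: zex.
      by rewrite (le_lt_trans exT)// ltry.
    split => // n; apply/andP; split; last by apply: le_lt_trans zT _; rewrite ltry.
    apply/exit_lt_lifetimeP.
    by have [s /andP[s0 _] Us] := hit n; exists s.
  apply: cvg_near_cst.
  exists n => // m /= nm; apply/eqP; rewrite eq_le; apply/andP; split.
    apply: ge_ereal_sup => _ [s + <-]; rewrite /= in_itv/= => sT.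
    by rewrite indicE memNset ?mul0e// => /(subU _ _ _ nm); exact: nhit.
  by case/andP: (suphit01 m w T0).
have /andP[_ zoo] := Op 0%N.
have z0 := lifetime_ge0 X w.
have zfin : lifetime X w \is a fin_num by rewrite ge0_fin_numE.
set z := fine (lifetime X w).
have zE : lifetime X w = z%:E by rewrite fineK.
have tfin n : exit_time X (K n) w \is a fin_num.
  rewrite ge0_fin_numE ?exit_time_ge0//.
  by have /andP[tz _] := Op n; exact: lt_trans tz zoo.
have t0 n : 0 <= fine (exit_time X (K n) w) by rewrite fine_ge0// exit_time_ge0.
have tz n : fine (exit_time X (K n) w) <= z.
  by rewrite fine_le//; have /andP[/ltW] := Op n.
have exz : exhaust_time X K w = z%:E.
  apply/eqP; rewrite eq_le; apply/andP; split.
    by apply: ge_ereal_sup => _ [n _ <-]; rewrite -(fineK (tfin n)) lee_fin.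
  rewrite -zE zex//; apply: (@le_lt_trans _ _ z%:E); last exact: ltry.
  by apply: ge_ereal_sup => _ [n _ <-]; rewrite -(fineK (tfin n)) lee_fin.
have tcvg : fine (exit_time X (K n) w) @[n --> \oo] --> z.
  apply/fine_cvg; rewrite -exz; apply: ereal_nondecreasing_cvgn => n m.
  exact: exit_time_exh.
have z00 : 0 <= z by rewrite fine_ge0.
(* Some visit occurs before z, where [surv] is at least its value at z; and no visit precedes the
   exit time, which bounds the supremum from above. The exit times tend to z. *)
apply: (@squeeze_cvge _ _ _ _ (cst (surv A z w)) _
  (fun n => surv A (fine (exit_time X (K n) w)) w)).
- apply: nearW => n; apply/andP; split.
    have /exit_lt_lifetimeP[s s0 Us] : (exit_time X (K n) w < lifetime X w)%E.
      by have /andP[] := Op n.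
    have sz : s < z.
      by rewrite -lte_fin -zE; apply/(lifetime_gt hX w (ltW s0)); case/U_alive: Us.
    apply: le_trans (regular_surv_le rw (ltW s0) (ltW sz)) _.
    apply: ereal_sup_ubound; exists s; last by rewrite indicE mem_set// mul1e.
    by rewrite /= in_itv/= s0 -lee_fin (le_trans _ zT)// zE lee_fin ltW.
  apply: ge_ereal_sup => _ [s + <-]; rewrite /= in_itv/= => /andP[s0 _].
  rewrite indicE; have [Us|nUs] := pselect (U n (path_at X s w)); last first.
    by rewrite memNset// mul0e; case/andP: (surv01 A (fine (exit_time X (K n) w)) w).
  rewrite mem_set// mul1e; apply: regular_surv_le => //.
  rewrite -lee_fin fineK//; case/U_alive: Us => _ nK; exact: exit_time_le.
- exact: cvg_cst.
- apply: (cvg_comp _ _ _ (regular_surv_cvg rw z00)).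
  move=> P wP.
  have : \forall n \near \oo, 0 <= fine (exit_time X (K n) w) ->
      P (fine (exit_time X (K n) w)) by exact: (tcvg _ wP).
  rewrite /fmap /= => H; near=> n.
  by have : 0 <= fine (exit_time X (K n) w) -> P (fine (exit_time X (K n) w));
    [near: n|apply; exact: t0].
Unshelve. all: by end_near. Qed.

Lemma killed_at_boundary_cvg w :
  killed_at_boundary n.+1%:R w @[n --> \oo] -->
  (if `[< Omega_p X K w >] then surv A (fine (lifetime X w)) w else 0%E).
Proof.
case: asboolP => [Op|nOp]; last first.
  apply: cvg_near_cst; apply: nearW => n.
  by rewrite /killed_at_boundary; case: asboolP => // -[].
have /andP[_ zoo] := Op 0%N.
have zfin : lifetime X w \is a fin_num by rewrite ge0_fin_numE// lifetime_ge0.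
apply: cvg_near_cst.
exists (Num.trunc (fine (lifetime X w))).+1 => // n /= zn.
rewrite /killed_at_boundary; case: asboolP => // -[]; split => //.
rewrite -(fineK zfin) lee_fin.
have /andP[_ /ltW/le_trans] := truncn_itv (fine_ge0 (lifetime_ge0 X w)); apply.
by rewrite ler_nat (leq_trans zn).
Qed.

Lemma measurable_lifetime_fin : measurable [set w | (lifetime X w < +oo)%E].
Proof.
rewrite (_ : mkset _ = \bigcup_n (path_at X n%:R @^-1` [set None])).
  apply: bigcupT_measurable => n.
  have mN := @measurable_None R E.
  by have := measurable_path hX (ler0n R n) measurableT mN; rewrite setTI.
apply/seteqP; split => w /=.
  move=> zoo; have zfin : lifetime X w \is a fin_num by rewrite ge0_fin_numE// lifetime_ge0.
  exists (Num.trunc (fine (lifetime X w))).+1 => //=.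
  apply/(lifetime_le hX) => //; rewrite -(fineK zfin) lee_fin ltW//.
  by have /andP[] := truncn_itv (fine_ge0 (lifetime_ge0 X w)).
move=> [n _ /= Xn]; apply: (@le_lt_trans _ _ (n%:R : R)%:E); last exact: ltry.
exact/(lifetime_le hX).
Qed.

Lemma measurable_Omega_p : measurable (Omega_p X K).
Proof.
have mzoo := measurable_lifetime_fin.
rewrite (_ : Omega_p X K = \bigcap_n ([set w | (lifetime X w < +oo)%E] `&`
   \bigcup_(q : rat) [set w | 0 < (ratr q : R) /\ U n (path_at X (ratr q) w)])).
  apply: bigcapT_measurable => n; apply: measurableI => //.
  apply: bigcupT_measurable_rat => q.
  have [q0|nq] := pselect (0 < (ratr q : R)); last first.
    rewrite (_ : [set w | _ /\ _] = set0); first exact: measurable0.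
    by apply/seteqP; split => // w [].
  rewrite (_ : [set w | _ /\ _] = path_at X (ratr q) @^-1` U n); last first.
    by apply/seteqP; split => [w []|w].
  have mUn : measurable (U n : set (borel (cemetery E))).
    by apply: measurable_Some_image; exact: measurable_exhC.
  by have := measurable_path hX (ltW q0) measurableT mUn; rewrite setTI.
apply/seteqP; split => w /=.
  move=> Op n _; have /andP[tz zoo] := Op n; split => //.
  have [s s0 Us] := (exit_lt_lifetimeP n w).1 tz.
  have [e e0 He] := path_right_open hX (ltW s0) (@oU n) Us.
  have /rat_in_itvoo[q] : s < s + e by rewrite ltrDl.
  rewrite in_itv/= => /andP[sq qe]; exists q => //; split.
    exact: lt_trans sq.
  by apply: He; rewrite (ltW sq).
move=> Hw n; have [zoo [q _ [q0 Uq]]] := Hw n I.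
by rewrite zoo andbT; apply/exit_lt_lifetimeP; exists (ratr q).
Qed.

Hypothesis pA : pcaf X A.

Lemma maxhit_ae_measurableW x n r j : 0 <= r ->
  ae_measurable (Prob X (Some x)) (maxhit X A (U n) r j).
Proof.
move=> r0.
have [g mg Mg] := maxhit_ae_measurable hX pA (measurable_exhC n)
  (dirac (Some x : borel (cemetery E))) j r0.
exists g; first exact: (measurableT_comp mg (measurable_id_future hX)).
exact: (@ae_law_from_dirac _ _ _ _ X hX (Some x)
  (fun w => maxhit X A (U n) r j w = g w)).
Qed.

(** The iterated limit is the form in which the two processes agree term by term. T goes to infinity
    last: a path that lives forever may visit every U_n, but if its exit times stay bounded it has
    almost surely died. *)
Lemma maxhit_limit x :
  ae_measurable (Prob X (Some x))
    ((fun w => expeR (- at_time A (lifetime X w) w)%E) \_ (Omega_p X K)) /\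
  (limn (fun T : nat => limn (fun n => limn (fun N =>
    \int[Prob X (Some x)]_w maxhit X A (U n) (T.+1%:R / N.+1%:R) N.+1 w))) =
  \int[Prob X (Some x)]_(w in Omega_p X K)
     expeR (- at_time A (lifetime X w) w))%E.
Proof.
have Poo : (Prob X (Some x) setT < +oo)%E.
  by rewrite (@le_lt_trans _ _ 1%E)// ?probability_le1// ltry.
have reg := pcaf_regular pA x.
have zex := exhaust_time_lifetime hX hK (Some x).
have kb01 T w : (0 <= killed_at_boundary T w <= 1)%E.
  by rewrite /killed_at_boundary; case: asboolP => _; rewrite ?surv01// lexx lee01.
have L1 (T n : nat) : ae_measurable (Prob X (Some x)) (suphit T.+1%:R n) /\
    (\int[Prob X (Some x)]_w maxhit X A (U n) (T.+1%:R / N.+1%:R) N.+1 w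
      @[N --> \oo] --> \int[Prob X (Some x)]_w suphit T.+1%:R n w)%E.
  apply: integral01_cvg => //.
  - by move=> N; apply: maxhit_ae_measurableW; rewrite divr_ge0.
  - by move=> N w; exact: maxhit01.
  - by move=> w; case/andP: (suphit01 n w (ltr0Sn R T)).
  - by apply: filterS reg => w; exact: maxhit_cvg_suphit.
have L2 (T : nat) : ae_measurable (Prob X (Some x)) (killed_at_boundary T.+1%:R) /\
    (\int[Prob X (Some x)]_w suphit T.+1%:R n w
      @[n --> \oo] --> \int[Prob X (Some x)]_w killed_at_boundary T.+1%:R w)%E.
  apply: integral01_cvg => //.
  - by move=> n; have [] := L1 T n.
  - by move=> n w; exact: suphit01.
  - by move=> w; case/andP: (kb01 T.+1%:R w).
  - by move: reg zex; apply: filterS2 => w; exact: suphit_cvg.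
have [mL L3] : ae_measurable (Prob X (Some x))
    (fun w => if `[< Omega_p X K w >] then surv A (fine (lifetime X w)) w else 0%E) /\
    (\int[Prob X (Some x)]_w killed_at_boundary n.+1%:R w @[n --> \oo] -->
     \int[Prob X (Some x)]_w
       if `[< Omega_p X K w >] then surv A (fine (lifetime X w)) w else 0)%E.
  apply: integral01_cvg => //.
  - by move=> n; have [] := L2 n.
  - by move=> w; case: asboolP => // _; case/andP: (surv01 A (fine (lifetime X w)) w).
  - by apply: aeW => w; exact: killed_at_boundary_cvg.
have boundaryE : {ae Prob X (Some x), forall w,
    ((fun w => expeR (- at_time A (lifetime X w) w)%E) \_ (Omega_p X K)) w =
    if `[< Omega_p X K w >] then surv A (fine (lifetime X w)) w else 0%E}.
  apply: filterS reg => w rw; rewrite patchE.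
  case: asboolP => [Op|nOp]; last by rewrite memNset.
  rewrite mem_set//; have /andP[_ zoo] := Op 0%N.
  have zfin : lifetime X w \is a fin_num by rewrite ge0_fin_numE// lifetime_ge0.
  rewrite (regular_surv rw) ?fine_ge0 ?lifetime_ge0//.
  by rewrite -[in LHS](fineK zfin).
split; first exact: ae_measurable_eq boundaryE mL.
rewrite (_ : (fun T : nat => _) = (fun T : nat =>
    \int[Prob X (Some x)]_w killed_at_boundary T.+1%:R w)%E); last first.
  apply/funext => T; rewrite (_ : (fun n : nat => _) = (fun n : nat =>
    \int[Prob X (Some x)]_w suphit T.+1%:R n w)%E).
    by apply/cvg_lim => //; have [] := L2 T.
  by apply/funext => n; apply/cvg_lim => //; have [] := L1 T n.
rewrite (cvg_lim _ L3)// [RHS]integral_mkcond; apply/esym.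
apply: ge0_integral_ae => //.
- by move=> w; rewrite patchE; case: ifPn => // _; exact: expeR_ge0.
- by move=> w; case: asboolP => // _; case/andP: (surv01 A (fine (lifetime X w)) w).
Qed.

End Hits.
End RegularPaths.

(** * Survival forever *)

Section Survival.
Context {R : realType} {E : pmetricType R} {d : measure_display}
  {W : measurableType d}.
Variables (X : process E W) (hX : hunt_process X) (A : R -> W -> \bar R).
Hypothesis pA : pcaf X A.

Lemma regular_at_infty w : regular X A w -> A n%:R w @[n --> \oo] --> at_time A +oo%E w.
Proof.
(* A is monotone on nonnegative times only; freezing it at 0 before makes it monotone on the whole
   line. *)
move=> rw; pose g t := A (Num.max 0 t) w.
have ndg : {homo g : s t / s <= t >-> (s <= t)%E}.
  move=> s t st; apply: (regular_le rw); first by rewrite le_max lexx.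
  by rewrite ge_max le_max lexx /= le_max st orbT.
have Ag : A t w @[t --> +oo] --> ereal_sup (range g).
  apply: cvg_trans (nondecreasing_cvge ndg); apply: near_eq_cvg.
  near=> t; rewrite /g max_r//; near: t; exact: nbhs_pinfty_ge.
rewrite /at_time (cvg_lim _ Ag)//.
exact: (cvg_comp _ _ cvgr_idn Ag).
Unshelve. all: by end_near. Qed.

Lemma alive_measurable t : 0 <= t -> measurable [set w | (t%:E < lifetime X w)%E].
Proof.
move=> t0; rewrite (_ : mkset _ = ~` (path_at X t @^-1` [set None])).
  apply: measurableC; have mN := @measurable_None R E.
  by have := measurable_path hX t0 measurableT mN; rewrite setTI.
by apply/seteqP; split => w /=; rewrite (lifetime_gt hX w t0).
Qed.

Lemma surv_ae_measurableW x t : 0 <= t -> ae_measurable (Prob X (Some x)) (surv A t).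
Proof.
move=> t0; have [h mh sh] := surv_history_version hX pA (Some x : borel (cemetery E)) t0.
by exists h => //; exact: (measurableT_comp mh (measurable_id_history hX (t := t))).
Qed.

Lemma restrict_ae_measurable x (D : set W) (f : W -> \bar R) : measurable D ->
  ae_measurable (Prob X (Some x)) f -> ae_measurable (Prob X (Some x)) (f \_ D).
Proof.
move=> mD [g mg fg]; exists (g \_ D).
  exact: (iffLR (measurable_restrictT g mD) (measurable_funTS mg)).
by apply: filterS fg => w; rewrite !patchE => ->.
Qed.

Lemma survival_limit x :
  ae_measurable (Prob X (Some x))
    ((fun w => expeR (- at_time A +oo w)%E) \_ [set w | lifetime X w = +oo%E]) /\
  (limn (fun n : nat => \int[Prob X (Some x)]_(w in [set w | (n.+1%:R%:E < lifetime X w)%E])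
      expeR (- A n.+1%:R w)) =
   \int[Prob X (Some x)]_(w in [set w | lifetime X w = +oo]) expeR (- at_time A +oo w))%E.
Proof.
have Poo : (Prob X (Some x) setT < +oo)%E.
  by rewrite (@le_lt_trans _ _ 1%E)// ?probability_le1// ltry.
have reg := pcaf_regular pA x.
pose D n := [set w | ((n.+1%:R : R)%:E < lifetime X w)%E].
have mf n : ae_measurable (Prob X (Some x)) (surv A n.+1%:R \_ (D n)).
  apply: restrict_ae_measurable; last exact: surv_ae_measurableW.
  exact: alive_measurable.
have f01 n w : (0 <= (surv A n.+1%:R \_ (D n)) w <= 1)%E.
  by rewrite patchE; case: ifPn => _; rewrite ?surv01// lexx lee01.
pose f w := ((fun w => expeR (- at_time A +oo w)) \_ [set w | lifetime X w = +oo%E]) w.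
have f0 w : (0 <= f w)%E by rewrite /f patchE; case: ifPn => // _; exact: expeR_ge0.
have cv : {ae Prob X (Some x), forall w,
    (surv A n.+1%:R \_ (D n)) w @[n --> \oo] --> f w}.
  apply: filterS reg => w rw; rewrite /f patchE.
  have [zoo|zfin] := pselect (lifetime X w = +oo%E).
    rewrite mem_set//.
    have e : expeR (- y) @[y --> at_time A +oo w] --> expeR (- at_time A +oo w).
      apply: (@cvg_comp _ _ _ -%E (@expeR R) _ (nbhs (- at_time A +oo w)%E)).
        exact: oppe_continuous.
      exact: expeR_continuous.
    have := cvg_comp _ _ (regular_at_infty rw) e.
    rewrite -cvg_shiftS/=; apply: cvg_trans; apply: near_eq_cvg.
    apply: nearW => n /=; rewrite patchE mem_set/=; last by rewrite /D /= zoo ltry.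
    by rewrite (regular_surv rw).
  rewrite memNset//; apply: cvg_near_cst.
  have z : lifetime X w \is a fin_num.
    by rewrite fin_numE; apply/andP; split; apply/eqP => // zNoo;
      have := lifetime_ge0 X w; rewrite zNoo.
  exists (Num.trunc (fine (lifetime X w))).+1 => // n /= zn.
  rewrite patchE memNset// /D /= -(fineK z) lte_fin => /lt_le_trans.
  have /andP[_ zt] := truncn_itv (fine_ge0 (lifetime_ge0 X w)).
  move=> /(_ _ (ltW zt)); rewrite ltr_nat ltnNge => /negP; apply.
  by rewrite (leq_trans (leqW zn)).
have [mL /cvg_lim L] := integral01_cvg Poo mf f01 f0 cv.
split; first exact: mL.
rewrite [RHS]integral_mkcond -/f -L//; congr (limn _).
apply/funext => n; rewrite (integral_mkcond (D n)).
apply: ge0_integral_ae => //.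
- by move=> w; rewrite patchE; case: ifPn => // _; exact: expeR_ge0.
- by move=> w; case/andP: (f01 n w).
- by apply: filterS reg => w rw; rewrite !patchE (regular_surv rw).
Qed.

End Survival.

Lemma borel_continuous (R : realType) (E : pmetricType R) (u : E -> R) :
  continuous u -> borel_fun u.
Proof.
move=> cu; rewrite /borel_fun.
apply: (@measurability _ _ (borel E) R setT u (@RGenOpens.G R)).
  exact: RGenOpens.measurableE.
move=> _ [_ [a [b ->]] <-]; rewrite setTI; apply: sub_sigma_algebra.
by apply: open_comp => [x _|]; [exact: cu|exact: interval_open].
Qed.

Lemma dominated_cvg_ae d (T : measurableType d) (R : realType)
    (mu : {measure set T -> \bar R}) (f_ : nat -> T -> \bar R) (f h : T -> \bar R) :
  (forall n, measurable_fun setT (f_ n)) -> measurable_fun setT f ->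
  mu.-integrable setT h ->
  (forall x, f_ n x @[n --> \oo] --> f x) ->
  (forall n x, `|f_ n x| <= h x)%E ->
  (\int[mu]_x f_ n x)%E @[n --> \oo] --> (\int[mu]_x f x)%E.
Proof.
move=> mf_ mf ih ff fh.
have [] := @dominated_convergence _ T R mu setT measurableT f_ f h mf_ mf _ ih _ => //.
- by apply: aeW => x _; exact: ff.
- by apply: aeW => x n _; exact: fh.
Qed.

(** * No killing inside the state space *)

Section Cutoffs.
Context {R : realType} {E : pmetricType R}.
Variables (m k : {measure set (borel E) -> \bar R}) (D Dres : L2form E).
Variables (K : nat -> set E) (hK : compact_exhaustion K).

Lemma C0_clip (v : E -> R) : C0 v -> C0 (fun x => Num.min (Num.max 0 (v x)) 1).
Proof.
move=> [cv cpt]; split.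
  move=> x; apply: (@continuous_min R E (fun y => Num.max 0 (v y)) (cst 1)).
    apply: (@continuous_max R E (cst 0) v); last exact: cv.
    exact: cst_continuous.
  exact: cst_continuous.
apply: (subclosed_compact _ cpt); first exact: closed_closure.
apply: closure_subset => x /=; apply: contra_neq => ->.
by rewrite maxxx min_l.
Qed.

Lemma cutoff_exists (F : L2form E) (hF : regular_dirichlet_form m F) n :
  exists u : E -> R, [/\ fdom F u, C0 u, forall x, 0 <= u x <= 1 & forall x, K n x -> u x = 1].
Proof.
(* The plateau 2 leaves a margin: a core function within 1 of f exceeds 1 on K_n, and clipping it to
   [0, 1] stays in the domain by the Markov property of the form and gives exactly 1 there. *)
have [|||| f [cf f0 f2 frange]] := @urysohn_ext_itv E R
    (@pseudometric_normal R E) (~` interior (K n.+1)) (K n) 0 2.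
- by apply: open_closedC; exact: open_interior.
- exact: (closed_exh hK).
- by apply/seteqP; split => // x [nI Kx]; apply: nI; exact: (exh_interior hK).
- by [].
have Cf : C0 f.
  split => //; apply: (subclosed_compact _ (@exh_compact _ _ _ hK n.+1)).
    exact: closed_closure.
  apply: (subset_trans (closure_subset _ (B := K n.+1))).
    move=> x /= fx; apply: contrapT => nK; move/eqP: fx; apply.
    apply: f0; exists x => // Ix; apply: nK; exact: interior_subset Ix.
  by have /closure_id <- := @closed_exh _ _ _ hK n.+1.
have [v [vD Cv fv]] := rdf_unif_core hF Cf ltr01.
exists (fun x => Num.min (Num.max 0 (v x)) 1); split.
- by have [] := df_markov (rdf_dirichlet hF) vD.
- exact: C0_clip.
- by move=> x; rewrite le_min ler01 andbT ge_min lexx orbT le_max lexx.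
- move=> x Kx; have fx : f x = 2 by apply: f2; exists x.
  have := fv x; rewrite fx ltr_distlC => /andP[v1 _].
  have {}v1 : 1 < v x by move: v1; rewrite ltrBlDr; lra.
  by rewrite max_r ?min_r// ltW// (lt_trans ltr01).
Qed.

Lemma C0_sub_exh (u : E -> R) : C0 u ->
  exists N, forall i, (N <= i)%N -> tsupport u `<=` K i.
Proof.
move=> [_ /compact_near_coveringP cpt].
have := cpt nat \oo (fun i x => K i x) _ _.
have cov x : tsupport u x -> \forall x' \near x & i \near \oo, K i x'.
  move=> _; have [n _ Knx] : (\bigcup_n K n) x by rewrite (exh_cover hK).
  exists (interior (K n.+1), [set i | (n.+1 <= i)%N]) => /=.
    split; last by exists n.+1.
    apply: open_nbhs_nbhs; split; first exact: open_interior.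
    exact: (exh_interior hK).
  move=> [x' i] /= [Ix' ni]; apply: (exh_sub hK ni); exact: interior_subset Ix'.
by move=> /(_ _ cov)[N _ HN]; exists N => i; exact: HN.
Qed.

Lemma eform_zero (F : L2form E) (hF : dirichlet_form m F) : eform F (cst 0) (cst 0) = 0.
Proof.
have d0 := df_0 hF; have [lin _ _] := df_sym hF.
have := lin 1 _ _ _ d0 d0 d0; rewrite (_ : (fun x => _) = cst 0); last first.
  by apply/funext => x; rewrite /cst mulr0 addr0.
by rewrite mul1r => /eqP; rewrite -subr_eq0 opprD addrA subrr sub0r oppr_eq0 => /eqP.
Qed.

(** Lets core functions stand for themselves in the identity between the two forms, with the empty
    exceptional set. *)
Lemma continuous_qc_version (F : L2form E) (hF : dirichlet_form m F) (u : E -> R) :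
  continuous u -> qc_version m F u u.
Proof.
move=> cu; split; [exact: borel_continuous| |exact: aeW].
move=> e e0; exists set0; split; first exact: open0.
  apply: (@le_lt_trans _ _ 0%E); last by rewrite lte_fin.
  apply: ereal_inf_lbound; exists (cst 0).
    by split; [exact: (df_0 hF)|by apply: aeW].
  rewrite /eform1 eform_zero// add0r /inner.
  by rewrite /Rintegral integral0_eq// => x _; rewrite mulr0.
exact: continuous_subspaceT.
Qed.

Hypothesis hk : killing_measure D k.
Hypothesis hres : resurrected_form m D k Dres.

(* As v is constant near the support of u, strong locality leaves only the jump
   part of E^res(u, v), and dominated convergence applies as v increases to 1. *)
Lemma resurrected_small (u : E -> R) (e : R) : fdom Dres u -> C0 u -> 0 < e ->
  exists v : E -> R, [/\ fdom Dres v, C0 v, forall x, 0 <= v x <= 1,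
    forall x, u x != 0 -> v x = 1 & eform Dres u v < e].
Proof.
move=> uDr Cu e0.
have [hDr _ domE formE] := hres.
have resD v : fdom Dres v -> C0 v -> fdom D v.
  move=> vD Cv; have : (fdom Dres `&` C0) v by [].
  by rewrite domE => -[].
have uD := resD _ uDr Cu.
have [_ [Ec [J [_ Eloc _ Jfin BD]]]] := hk.
have [N HN] := C0_sub_exh Cu.
have /choice[v vP] := cutoff_exists hDr.
have u_v j x : (N.+1 <= j)%N -> u x != 0 -> v j x = 1.
  move=> Nj ux; have [_ _ _ ->//] := vP j.
  apply: (exh_sub hK (ltnW Nj)).
  by apply: HN => //; exact: subset_closure.
pose g j (z : borel E * borel E) : R := (u z.1 - u z.2) * (v j z.1 - v j z.2).
(* The k-integral of the Beurling-Deny formula cancels against the one that defines the resurrected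
   form. *)
have resE j : (N.+1 <= j)%N -> eform Dres u (v j) = \int[J]_z g j z.
  move=> Nj; have [vDr Cv _ v1] := vP j.
  have vD := resD _ vDr Cv.
  have := formE u (v j) u (v j) uD vD
    (continuous_qc_version (rdf_dirichlet hDr) (proj1 Cu))
    (continuous_qc_version (rdf_dirichlet hDr) (proj1 Cv)).
  rewrite BD// Eloc//; last first.
    exists 1, (interior (K N.+1)); split; first exact: open_interior.
      by apply: subset_trans (HN N (leqnn N)) _ => x; exact: (exh_interior hK).
    by move=> x Ix; apply: v1; apply: (exh_sub hK Nj); exact: interior_subset Ix.
  by rewrite add0r => /addIr <-.
have mu1 : measurable_fun setT (u : borel E -> R) by apply: borel_continuous; case: Cu.
have mv j : measurable_fun setT (v j : borel E -> R).
  by apply: borel_continuous; have [_ []] := vP j.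
have mg j : measurable_fun setT (EFin \o g j).
  apply/measurable_EFinP; apply: measurable_funM; apply: measurable_funB.
  - exact: (measurableT_comp mu1 measurable_fst).
  - exact: (measurableT_comp mu1 measurable_snd).
  - exact: (measurableT_comp (mv j) measurable_fst).
  - exact: (measurableT_comp (mv j) measurable_snd).
have sqint w : fdom D w -> C0 w ->
    J.-integrable setT (fun z => (((w z.1 - w z.2) ^+ 2)%:E)).
  move=> wD Cw; have mw : measurable_fun setT (w : borel E -> R).
    by apply: borel_continuous; case: Cw.
  apply/integrableP; split.
    apply/measurable_EFinP; apply: measurable_funX; apply: measurable_funB.
      exact: (measurableT_comp mw measurable_fst).
    exact: (measurableT_comp mw measurable_snd).
  under eq_integral do rewrite gee0_abs ?lee_fin ?sqr_ge0//.
  exact: Jfin.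
have [v0Dr Cv0 v001 _] := vP N.+1.
(* The bound |ab| <= a^2 + b^2 reduces this to the finite jump energies of u and of the cutoff. *)
have intg : J.-integrable setT (EFin \o g N.+1).
  apply: (@le_integrable _ _ _ J setT measurableT _
    ((fun z => ((u z.1 - u z.2) ^+ 2)%:E) \+
     (fun z => ((v N.+1 z.1 - v N.+1 z.2) ^+ 2)%:E))%E) => //.
    move=> z _ /=; rewrite lee_fin [leRHS]ger0_norm; last by rewrite addr_ge0 ?sqr_ge0.
    rewrite /g; set a := u z.1 - _; set b := v _ z.1 - _.
    rewrite normrM -(real_normK (num_real a)) -(real_normK (num_real b)).
    have := sqr_ge0 (`|a| - `|b|); have := normr_ge0 a; have := normr_ge0 b.
    nra.
  by apply: integrableD => //; apply: sqint => //; exact: resD.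
(* From index M on, [v j] is 1 on the support of [v N.+1] and so dominates it. As both equal 1 where
   u does not vanish, [g N.+1] dominates the later integrands. *)
have [M HM] := C0_sub_exh Cv0.
pose L := maxn N.+1 M.
have gcvg z : g (j + L)%N z @[j --> \oo] --> (0 : R).
  have [n1 _ Kn1] : (\bigcup_n K n) z.1 by rewrite (exh_cover hK).
  have [n2 _ Kn2] : (\bigcup_n K n) z.2 by rewrite (exh_cover hK).
  apply: cvg_near_cst; exists (maxn n1 n2) => // j /=; rewrite geq_max => /andP[j1 j2].
  have [_ _ _ v1] := vP (j + L)%N.
  rewrite /g !v1 ?subrr ?mulr0//.
    by apply: (exh_sub hK _ Kn2); rewrite (leq_trans j2)// leq_addr.
  by apply: (exh_sub hK _ Kn1); rewrite (leq_trans j1)// leq_addr.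
have gdom j z : `|g (j + L)%N z| <= `|g N.+1 z|.
  have NL : (N.+1 <= j + L)%N by rewrite (leq_trans (leq_maxl _ M))// leq_addl.
  have ML : (M <= j + L)%N by rewrite (leq_trans (leq_maxr N.+1 _))// leq_addl.
  have [_ _ vj01 vj1] := vP (j + L)%N.
  have mono x : v N.+1 x <= v (j + L)%N x.
    have [->|vx] := eqVneq (v N.+1 x) 0; first by case/andP: (vj01 x).
    rewrite vj1; first by case/andP: (v001 x).
    by apply: HM => //; exact: subset_closure.
  rewrite /g !normrM; have [ux|ux] := eqVneq (u z.1) 0; last first.
    rewrite !(u_v _ _ _ ux)//; apply: ler_wpM2l => //.
    have /andP[_ a1] := vj01 z.2; have /andP[_ b1] := v001 z.2.
    by rewrite !ger0_norm ?subr_ge0// lerD2l lerN2.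
  have [uy|uy] := eqVneq (u z.2) 0; first by rewrite ux uy subrr normr0 !mul0r.
  rewrite !(u_v _ _ _ uy)//; apply: ler_wpM2l => //.
  have /andP[_ a1] := vj01 z.1; have /andP[_ b1] := v001 z.1.
  by rewrite !ler0_norm ?subr_le0// !opprB lerD2l lerN2.
have intgj : (\int[J]_z (EFin \o g (j + L)%N) z)%E @[j --> \oo] --> (0%:E : \bar R).
  rewrite [X in _ --> X](_ : _ = (\int[J]_z cst 0%E z)%E); last by rewrite integral0.
  apply: (@dominated_cvg_ae _ _ R J _ _ (fun z => `|g N.+1 z|%:E)) => //.
  - exact: integrable_abse intg.
  - by move=> z; apply/fine_cvgP; split; [exact: nearW|exact: gcvg].
have fintgj : fine (\int[J]_z (EFin \o g (j + L)%N) z)%E @[j --> \oo] --> 0.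
  exact: (fine_cvg intgj).
have [j0 _ Hj] : \forall j \near \oo,
    `|0 - fine (\int[J]_z (EFin \o g (j + L)%N) z)%E| < e.
  by apply: (cvgrPdist_lt _ _).1 fintgj e e0.

have [vDr Cv v01 _] := vP (j0 + L)%N.
have NL : (N.+1 <= j0 + L)%N by rewrite (leq_trans (leq_maxl _ M))// leq_addl.
exists (v (j0 + L)%N); split => //; first by move=> x; exact: u_v.
rewrite resE//; have := Hj j0 (leqnn _); rewrite /= sub0r normrN.
by move=> /(le_lt_trans (ler_norm _)).
Qed.

End Cutoffs.

Section Killing.
Context {R : realType} {E : pmetricType R} {d : measure_display}
  {W : measurableType d}.
Notation cem := (borel (cemetery E)).
Notation history X t := (g_sigma_algebraType (path_events X [set s | 0 <= s <= t])).
Notation future X := (g_sigma_algebraType (path_events X [set s | 0 <= s])).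
Variables (X : process E W) (hX : hunt_process X).

Lemma esemigroupE t (f : E -> \bar R) x : 0 <= t ->
  esemigroup X t f x = (\int[Prob X (Some x)]_w oapp f 0 (path_at X t w))%E.
Proof.
move=> t0; rewrite /esemigroup integral_mkcond; apply: eq_integral => w _.
rewrite patchE; case: ifPn => // /negP; rewrite inE => tz.
case Xt : (path_at X t w) => [y|] //=; exfalso; apply: tz.
by apply/(lifetime_gt hX w t0); rewrite Xt.
Qed.

Lemma measurable_esemigroup t (f : E -> R) : 0 <= t -> borel_fun f ->
  (forall y, 0 <= f y) ->
  measurable_fun setT (fun x : borel E => esemigroup X t (EFin \o f) x).
Proof.
move=> t0 mf f0.
have mof : measurable_fun setT (oapp (EFin \o f) 0%E : cem -> \bar R).
  by apply: measurable_oapp; exact/measurable_EFinP.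
have of0 z : (0 <= oapp (EFin \o f) 0 z)%E by case: z => [y|]//=; rewrite lee_fin.
rewrite (_ : (fun _ => _) = (fun x : borel E =>
    \int[Prob X (Some x)]_w oapp (EFin \o f) 0 (path_at X t w))%E).
  exact: (measurableT_comp (measurable_Eat hX t0 mof of0) measurable_Some).
by apply/funext => x; rewrite esemigroupE.
Qed.

Definition dead t (x : E) : \bar R := Prob X (Some x) (path_at X t @^-1` [set None]).

Lemma measurable_dead t : 0 <= t -> measurable_fun setT (dead t : borel E -> \bar R).
Proof.
move=> t0; have mN := @measurable_None R E.
exact: (measurableT_comp (hunt_kernel hX t0 mN) measurable_Some).
Qed.

Lemma measurable_dead_event t : 0 <= t -> measurable (path_at X t @^-1` [set None]).
Proof.
move=> t0; have mN := @measurable_None R E.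
by have := measurable_path hX t0 measurableT mN; rewrite setTI.
Qed.

Lemma esemigroup_dead t (v : E -> R) x : 0 <= t -> borel_fun v ->
  (forall y, 0 <= v y <= 1) ->
  (esemigroup X t (EFin \o v) x + dead t x <= 1)%E.
Proof.
move=> t0 mv v01; rewrite esemigroupE// /dead.
have -> : Prob X (Some x) (path_at X t @^-1` [set None]) =
    (\int[Prob X (Some x)]_w (\1_(path_at X t @^-1` [set None]) w)%:E)%E.
  by rewrite integral_indic ?setIT//; exact: measurable_dead_event.
have mof : measurable_fun setT (oapp (EFin \o v) 0%E : cem -> \bar R).
  by apply: measurable_oapp; exact/measurable_EFinP.
have mN : measurable_fun setT (fun w => (\1_(path_at X t @^-1` [set None]) w)%:E : \bar R).
  by apply/measurable_EFinP; apply: measurable_indic; exact: measurable_dead_event.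
rewrite -ge0_integralD//; last 2 first.
- by move=> w _; case: (path_at X t w) => [y|]//=; rewrite lee_fin; case/andP: (v01 y).
- exact: (measurableT_comp mof (measurable_path hX t0)).
rewrite (@le_trans _ _ (\int[Prob X (Some x)]_w 1)%E)//; last first.
  by rewrite integral_cst// mul1e probability_le1.
apply: ge0_le_lower_integral => w.
  rewrite adde_ge0 ?lee_fin//.
  by case: (path_at X t w) => [y|]//=; rewrite lee_fin; case/andP: (v01 y).
rewrite indicE; case Xt : (path_at X t w) => [y|]/=.
  rewrite memNset; last by rewrite /= Xt.
  by rewrite adde0 lee_fin; case/andP: (v01 y).
by rewrite mem_set// add0e.
Qed.

Lemma esemigroup0 (f : E -> R) x : borel_fun f -> (forall y, 0 <= f y) ->
  esemigroup X 0 (EFin \o f) x = (f x)%:E.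
Proof.
move=> mf f0; rewrite esemigroupE//.
have m0 : measurable [set w | path_at X 0 w = Some x].
  have := @measurable_Some_image R E [set x].
  rewrite image_set1 => mS.
  have mx : measurable ([set x] : set (borel E)).
    rewrite -[X in measurable X]setCK; apply: measurableC; apply: sub_sigma_algebra.
    apply: closed_openC; apply: accessible_closed_set1.
    by apply: hausdorff_accessible; exact: metric_hausdorff.
  by have := measurable_path hX (lexx 0) measurableT (mS mx); rewrite setTI.
have mof : measurable_fun setT (fun w => oapp (EFin \o f) 0%E (path_at X 0 w)).
  have mo : measurable_fun setT (oapp (EFin \o f) 0%E : cem -> \bar R).
    by apply: measurable_oapp; exact/measurable_EFinP.
  exact: (measurableT_comp mo (measurable_path hX (lexx 0))).
transitivity (\int[Prob X (Some x)]_w (cst (f x)%:E) w)%E; last first.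
  rewrite integral_cst// -[RHS]mule1; congr (_ * _)%E.
  exact: probability_setT.
apply: ge0_ae_eq_integral => //.
- by move=> w _; case: (path_at X 0 w) => [y|]//=; rewrite lee_fin.
- by move=> w _; rewrite lee_fin.
exists (~` [set w | path_at X 0 w = Some x]); split.
- exact: measurableC.
- have P0 : Prob X (Some x) (~` [set w | path_at X 0 w = Some x]) = 0%E.
    by rewrite probability_setC// (hunt_normal hX) subee.
  exact: P0.
- by move=> w /= nf Xw; apply: nf => _; rewrite Xw.
Qed.

Variables (m k : {measure set (borel E) -> \bar R}) (D Dres : L2form E).
Variables (K : nat -> set E) (hK : compact_exhaustion K).
Hypotheses (m_radon : radon m) (hk : killing_measure D k).
Hypotheses (hres : resurrected_form m D k Dres) (Xas : associated m X Dres).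

Lemma killing_rate (u : E -> R) (e : R) : fdom Dres u -> C0 u ->
  (forall y, 0 <= u y <= 1) -> 0 < e ->
  \forall t \near 0^'+, (\int[m]_y ((u y)%:E * dead t y) <= (e * t)%:E)%E.
Proof.
move=> uD Cu u01 e0.
have [v [vD Cv v01 uv uve]] := resurrected_small hK hk hres uD Cu e0.
have [hDr _ _ _] := hres.
have [_ symD _] := df_sym (rdf_dirichlet hDr).
rewrite symD// in uve.
have [_ _ /(_ _ _ vD uD) cvgE] := Xas.
have mu1 : borel_fun u by apply: borel_continuous; case: Cu.
have mv1 : borel_fun v by apply: borel_continuous; case: Cv.
have near1 : \forall t \near 0^'+, t^-1 * inner m (v \- semigroup X t v) u < e.
  exact: (cvgr_lt _ cvgE).
near=> t.
have t_gt0 : 0 < t by [].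
have t0 := ltW t_gt0.
have sfin y : esemigroup X t (EFin \o v) y \is a fin_num.
  have := esemigroup_dead y t0 mv1 v01.
  have e00 : (0 <= esemigroup X t (EFin \o v) y)%E.
    rewrite esemigroupE// integral_ge0// => w _.
    by case: (path_at X t w) => [z|]//=; rewrite lee_fin; case/andP: (v01 z).
  rewrite ge0_fin_numE// => h; apply: (@le_lt_trans _ _ 1%E); last exact: ltry.
  by apply: le_trans h; rewrite leeDl.
pose F y := (v y - semigroup X t v y) * u y.
have deadF y : ((u y)%:E * dead t y <= (F y)%:E)%E.
  have [uy|uy] := eqVneq (u y) 0; first by rewrite /F uy mul0e mulr0.
  rewrite /F uv// mulrC EFinM lee_wpmul2l//; first by rewrite lee_fin; case/andP: (u01 y).
  rewrite EFinB /semigroup fineK// leeBrDl//.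
  exact: esemigroup_dead.
have dead0 y : (0 <= dead t y)%E by [].
have F0 y : 0 <= F y.
  rewrite -lee_fin; apply: le_trans (deadF y).
  by rewrite mule_ge0// lee_fin; case/andP: (u01 y).
have Fu y : F y <= \1_(tsupport u) y.
  have [uy|uy] := eqVneq (u y) 0; first by rewrite /F uy mulr0.
  rewrite indicE mem_set; last exact: subset_closure.
  have /andP[u0 u1] := u01 y; have /andP[v0 v1] := v01 y.
  apply: le_trans u1; rewrite /F ler_piMl// lerBlDr (le_trans v1)// lerDl.
  rewrite /semigroup fine_ge0// esemigroupE// integral_ge0// => w _.
  by case: (path_at X t w) => [z|]//=; rewrite lee_fin; case/andP: (v01 z).
have mF : measurable_fun setT (F : borel E -> R).
  apply: measurable_funM => //; apply: measurable_funB => //.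
  apply: (@measurableT_comp _ _ _ _ _ _ (@fine R)) => //.
  by apply: measurable_esemigroup => // y; case/andP: (v01 y).
have mts : measurable (tsupport u : set (borel E)).
  rewrite -[Z in measurable Z]setCK; apply: measurableC; apply: sub_sigma_algebra.
  by apply: closed_openC; exact: closed_closure.
(* [inner] is the [fine] of an integral and would be 0 for an infinite one; finiteness comes from
   the compact support of u, as m is Radon. *)
have intF : (\int[m]_y (F y)%:E \is a fin_num)%E.
  rewrite ge0_fin_numE; last by apply: integral_ge0 => y _; rewrite lee_fin.
  apply: (@le_lt_trans _ _ (\int[m]_y (\1_(tsupport u) y)%:E)%E).
    by apply: ge0_le_lower_integral => y; rewrite lee_fin.
  by rewrite integral_indic// setIT; apply: m_radon; case: Cu.
have innerE : (inner m (v \- semigroup X t v) u)%:E = (\int[m]_y (F y)%:E)%E.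
  by rewrite /inner /Rintegral fineK.
apply: (@le_trans _ _ (\int[m]_y (F y)%:E)%E).
  apply: ge0_le_lower_integral => // y.
  by rewrite mule_ge0// lee_fin; case/andP: (u01 y).
rewrite -innerE lee_fin -ler_pdivrMr// mulrC ltW//.
near: t; exact: near1.
Unshelve. all: by end_near. Qed.

(** Symmetry against the constant 1 turns the left side into the integral of f p_t 1, and p_t 1 <=
    1. *)
Lemma esemigroup_contract t (f : E -> R) : 0 <= t -> borel_fun f ->
  (forall y, 0 <= f y) ->
  (\int[m]_y esemigroup X t (EFin \o f) y <= \int[m]_y (f y)%:E)%E.
Proof.
move=> t0 mf f0; have [sym _ _] := Xas.
have s0 (g : E -> R) y : (forall y, 0 <= g y) -> (0 <= esemigroup X t (EFin \o g) y)%E.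
  move=> g0; rewrite esemigroupE//; apply: integral_ge0 => w _.
  by case: (path_at X t w) => [z|]//=; rewrite lee_fin.
move: t0; rewrite le_eqVlt => /orP[/eqP t0|t0].
  rewrite -t0; apply: ge0_le_lower_integral => y; rewrite esemigroup0// lee_fin//.
have m1 : borel_fun (cst 1 : E -> R) by exact: measurable_cst.
have := sym t f (cst 1) t0 mf m1 f0 (fun=> ler01).
under eq_integral do rewrite /= mule1.
move=> ->; apply: ge0_le_lower_integral => y.
  by rewrite mule_ge0 ?lee_fin ?s0.
rewrite -[leRHS]mule1 lee_wpmul2l ?lee_fin//.
have := @esemigroup_dead t (cst 1) y (ltW t0) m1 _.
move=> /(_ (fun z => introT andP (conj ler01 (lexx 1)))); apply: le_trans.
by rewrite leeDl.
Qed.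

(* Some step of every grid of [0, T] leads from K_n to the cemetery; a path with
   lifetime at most T that never leaves K_n before its lifetime does this. *)
Definition inside_killed n (T : R) : set W :=
  \bigcap_N \bigcup_(i < N.+1)
    (path_at X (i%:R * (T / N.+1%:R)) @^-1` (Some @` K n) `&`
     path_at X (i%:R * (T / N.+1%:R) + T / N.+1%:R) @^-1` [set None]).

Let mKn n : measurable (K n : set (borel E)).
Proof.
rewrite -[Z in measurable Z]setCK; apply: measurableC.
exact: measurable_exhC.
Qed.

Let mstep (n : nat) (s t : R) : 0 <= s -> 0 <= t ->
  measurable (path_at X s @^-1` (Some @` K n) `&` path_at X (s + t) @^-1` [set None]
    : set (future X)).
Proof.
move=> s0 t0; apply: measurableI.
  have mS : measurable (Some @` K n : set cem) by exact: measurable_Some_image.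
  by have := measurable_path_future (X := X) s0 measurableT mS; rewrite setTI.
have mN := @measurable_None R E.
by have := measurable_path_future (X := X) (addr_ge0 s0 t0) measurableT mN; rewrite setTI.
Qed.

Lemma measurable_inside_killed n T : 0 < T ->
  measurable (inside_killed n T : set (future X)).
Proof.
move=> T0; apply: bigcapT_measurable => N; apply: bigcup_measurable => i _.
have T0' : 0 <= T / N.+1%:R by rewrite divr_ge0// ltW.
by apply: mstep => //; rewrite mulr_ge0.
Qed.

(** The Markov property at s writes the left side as the m-integral of p_s f, and contraction
    removes p_s: the bound is the same for every step of the grid. *)
Let step_le n (u : E -> R) s t : 0 <= s -> 0 <= t -> C0 u ->
  (forall y, 0 <= u y <= 1) -> (forall y, K n y -> u y = 1) ->
  (\int[m]_y Prob X (Some y)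
     (path_at X s @^-1` (Some @` K n) `&` path_at X (s + t) @^-1` [set None])
   <= \int[m]_y ((u y)%:E * dead t y))%E.
Proof.
move=> s0 t0 Cu u01 uK.
pose f y : R := \1_(K n) y * fine (dead t y).
have dfin y : dead t y \is a fin_num by exact: fin_num_measure (measurable_dead_event t0).
have f0 y : 0 <= f y by rewrite mulr_ge0// fine_ge0.
have mf : borel_fun f.
  apply: measurable_funM; first by apply: measurable_indic; exact: mKn.
  exact: (@measurableT_comp _ _ _ _ _ _ (@fine R)) (measurable_dead t0).
have mN := @measurable_None R E.
apply: (@le_trans _ _ (\int[m]_y (f y)%:E)%E); last first.
  apply: ge0_le_lower_integral => y; first by rewrite lee_fin.
  rewrite /f EFinM fineK// lee_wpmul2r// lee_fin indicE.
  have [Ky|nKy] := pselect (K n y); first by rewrite mem_set// uK.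
  by rewrite memNset//; case/andP: (u01 y).
apply: le_trans (esemigroup_contract s0 mf f0).
apply: ge0_le_lower_integral => // y.
rewrite esemigroupE// (markov_time hX)//; last first.
  have mS : measurable (Some @` K n : set cem) by exact: measurable_Some_image.
  have mp : measurable_fun setT (path_at X s : history X s -> cem).
    by apply: measurable_path_history; rewrite s0 lexx.
  by have := mp measurableT _ mS; rewrite setTI.
rewrite integral_mkcond le_eqVlt; apply/orP; left; apply/eqP.
apply: eq_integral => w _; rewrite patchE.
case Xs : (path_at X s w) => [z|] /=; last first.
  by rewrite memNset//= Xs => -[].
rewrite /f indicE; have [Kz|nKz] := pselect (K n z).
  rewrite mem_set; last by rewrite /= Xs; exists z.
  by rewrite mem_set// mul1r fineK.
rewrite memNset; last by rewrite /= Xs => -[z' Kz' [zz]]; apply: nKz; rewrite -zz.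
by rewrite memNset// mul0r.
Qed.

Lemma inside_killed_ae0 n T : 0 < T ->
  (\int[m]_y Prob X (Some y) (inside_killed n T) = 0)%E.
Proof.
move=> T0; have [hDr _ _ _] := hres.
have [u [uD Cu u01 uK]] := cutoff_exists hK hDr n.
apply/eqP; rewrite eq_le integral_ge0// andbT; apply/lee_addgt0Pr => e e0.
rewrite add0e.
(* At the rate e / T each of the N + 1 steps of length T / (N + 1) costs at most e / (N + 1), so the
   total is at most e. *)
have := killing_rate uD Cu u01 (divr_gt0 e0 T0).
rewrite /at_right => /nbhs_ballP[r /= r0 Hr].
have [N] := ltr_add_invr (divr_gt0 r0 T0); rewrite add0r ltr_pdivlMr// => Nr.
pose q := T / N.+1%:R.
have q0 : 0 < q by rewrite divr_gt0.
have {}Hr : (\int[m]_y ((u y)%:E * dead q y) <= (e / T * q)%:E)%E.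
  apply: Hr => //=; rewrite /ball/= sub0r normrN gtr0_norm//.
  by rewrite /q mulrC.
pose S i := path_at X (i%:R * q) @^-1` (Some @` K n) `&`
            path_at X (i%:R * q + q) @^-1` [set None].
have iq0 i : 0 <= i%:R * q by rewrite mulr_ge0// ltW.
have mSf i : measurable (S i : set (future X)) by apply: mstep => //; exact: ltW.
have mS i : measurable (S i) by exact: (future_measurable hX).
have mPS i : measurable_fun setT (fun y : borel E => Prob X (Some y) (S i)).
  exact: (measurableT_comp (measurable_Prob_future hX (mSf i)) measurable_Some).
apply: (@le_trans _ _ (\int[m]_y \sum_(i < N.+1) Prob X (Some y) (S i))%E).
  apply: ge0_le_lower_integral => // y.
  apply: (@le_trans _ _ (Prob X (Some y) (\big[setU/set0]_(i < N.+1) S i))).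
    apply: le_measure; rewrite ?inE.
    - by apply: (future_measurable hX); exact: measurable_inside_killed.
    - exact: bigsetU_measurable.
    - by rewrite -bigcup_mkord => w /(_ N I).
  exact: Boole_inequality.
rewrite ge0_integral_sum//.
apply: (@le_trans _ _ (\sum_(i < N.+1) (e / T * q)%:E)%E).
  apply: lee_sum => i _; apply: le_trans Hr.
  by apply: step_le => //; exact: ltW.
rewrite sumEFin lee_fin sumr_const card_ord -mulr_natr /q.
rewrite -!mulrA [T^-1 * _]mulrA mulVf ?gt_eqF// mul1r mulVf ?mulr1//.
Qed.

End Killing.

Lemma ae_measurable_integral0 d (T : measurableType d) (R : realType)
    (mu : {measure set T -> \bar R}) (f : T -> \bar R) :
  ae_measurable mu f -> (forall x, 0 <= f x)%E -> (\int[mu]_x f x = 0)%E ->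
  {ae mu, forall x, f x = 0%E}.
Proof.
move=> mf f0 If; have [g [mg g0] fg] := ae_measurable_ge0 f0 mf.
have Ig : (\int[mu]_x g x = 0)%E by rewrite -If; apply/esym; exact: ge0_integral_ae_version.
have [+ _] := ae_eq_integral_abs mu measurableT mg.
under eq_integral do rewrite gee0_abs//.
by move=> /(_ Ig); move: fg; apply: filterS2 => x -> ->.
Qed.

Section AbsoluteContinuity.
Context {R : realType} {E : pmetricType R} {d : measure_display}
  {W : measurableType d}.
Variables (X : process E W) (hX : hunt_process X).
Variables (m : {measure set (borel E) -> \bar R}) (D : L2form E).
Hypotheses (m_supp : full_support m) (Xas : associated m X D).
Hypothesis X_sf : strong_feller X.

(* Strong Feller and full support turn "m-almost everywhere" into "everywhere". *)
Lemma esemigroup_null (h : E -> R) t x : 0 < t -> borel_fun h ->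
  (forall y, 0 <= h y <= 1) -> (\int[m]_y (h y)%:E = 0)%E ->
  esemigroup X t (EFin \o h) x = 0%E.
Proof.
move=> t_gt0 mh h01 Ih; have t0 := ltW t_gt0.
have h0 y : 0 <= h y by case/andP: (h01 y).
have [sym _ _] := Xas.
have m1 : borel_fun (cst 1 : E -> R) by exact: measurable_cst.
have s0 (g : E -> R) y : (forall y, 0 <= g y) -> (0 <= esemigroup X t (EFin \o g) y)%E.
  move=> g0; rewrite esemigroupE//; apply: integral_ge0 => w _.
  by case: (path_at X t w) => [z|]//=; rewrite lee_fin.
have s1 y : (esemigroup X t (EFin \o h) y <= 1)%E.
  by apply: le_trans (esemigroup_dead hX y t0 mh h01); rewrite leeDl.
have sfin y : esemigroup X t (EFin \o h) y \is a fin_num.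
  by rewrite ge0_fin_numE ?s0// (le_lt_trans (s1 y))// ltry.
have Is : (\int[m]_y esemigroup X t (EFin \o h) y = 0)%E.
  have := sym t h (cst 1) t_gt0 mh m1 h0 (fun=> ler01).
  under eq_integral do rewrite /= mule1.
  move=> ->; apply/eqP; rewrite eq_le; apply/andP; split; last first.
    by apply: integral_ge0 => y _; rewrite mule_ge0 ?lee_fin ?s0.
  rewrite -Ih; apply: ge0_le_lower_integral => y.
    by rewrite mule_ge0 ?lee_fin ?s0.
  rewrite -[leRHS]mule1 lee_wpmul2l ?lee_fin//.
  have := esemigroup_dead hX y t0 m1 (fun z => introT andP (conj ler01 (lexx 1))).
  by apply: le_trans; rewrite leeDl.
have hb : bounded h.
  by exists 1 => y; rewrite ger0_norm//; case/andP: (h01 y).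
have [_ cs] := X_sf t_gt0 mh hb.
(* An open set by the strong Feller property and m-null by symmetry, hence empty by full support. *)
pose U := [set y | semigroup X t h y != 0].
have oU : open U.
  rewrite (_ : U = semigroup X t h @^-1` (~` [set 0])).
    apply: open_comp => [y _|]; first exact: cs.
    by apply: closed_openC; exact: closed_eq.
  by apply/seteqP; split => y /= /eqP.
have mU0 : m U = 0%E.
  have ms := measurable_esemigroup hX t0 mh h0.
  have [N [mN N0 NP]] := ae_measurable_integral0 (measurable_ae_measurable m ms)
    (fun y => s0 h y h0) Is.
  apply: (subset_measure0 _ mN _ N0); first exact: sub_sigma_algebra.
  move=> y /= /eqP sy; apply: NP => /= e; apply: sy.
  by rewrite /semigroup e.
have sx0 : semigroup X t h x = 0.
  apply/eqP/negPn/negP => Ux; have := m_supp oU (ex_intro _ x Ux).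
  by rewrite mU0 ltxx.
by rewrite -(fineK (sfin x)) -/(semigroup X t h x) sx0.
Qed.

End AbsoluteContinuity.

Section NoInsideKilling.
Context {R : realType} {E : pmetricType R} {d d' : measure_display}
  {W : measurableType d} {W' : measurableType d'}.
Notation history X t := (g_sigma_algebraType (path_events X [set s | 0 <= s <= t])).
Variables (m k : {measure set (borel E) -> \bar R}) (D Dres : L2form E).
Variables (X : process E W) (Y : process E W') (A : R -> W' -> \bar R).
Variables (K : nat -> set E) (hK : compact_exhaustion K).
Hypotheses (hX : hunt_process X) (hY : hunt_process Y) (pA : pcaf Y A).
Hypotheses (XY : subprocess X Y A).
Hypotheses (m_radon : radon m) (m_supp : full_support m).
Hypotheses (Xas : associated m X D) (X_sf : strong_feller X).
Hypotheses (hk : killing_measure D k) (hres : resurrected_form m D k Dres).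
Hypothesis Yas : associated m Y Dres.

(** For X the value is the integral of h along Y weighted by exp(- A_t). The weight is positive
    while Y is alive, because A_t is finite there, so h must vanish almost surely at Y_t. *)
Lemma esemigroup_null_res (h : E -> R) t x : 0 < t -> borel_fun h ->
  (forall y, 0 <= h y <= 1) -> (\int[m]_y (h y)%:E = 0)%E ->
  esemigroup Y t (EFin \o h) x = 0%E.
Proof.
move=> t_gt0 mh h01 Ih; have t0 := ltW t_gt0.
have h0 y : 0 <= h y by case/andP: (h01 y).
have := esemigroup_null hX m_supp Xas X_sf x t_gt0 mh h01 Ih.
rewrite XY// integral_mkcond => I0.
have mo : measurable_fun setT (oapp (EFin \o h) 0%E : borel (cemetery E) -> \bar R).
  by apply: measurable_oapp; exact/measurable_EFinP.
have mol : measurable_fun setT (fun w => oapp (EFin \o h) 0%E (path_at Y t w)).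
  exact: (measurableT_comp mo (measurable_path hY t0)).
have o0 z : (0 <= oapp (EFin \o h) 0 z)%E by case: z => [y|]//=; rewrite lee_fin.
have reg := pcaf_regular pA x.
have {}I0 : (\int[Prob Y (Some x)]_w (surv A t w * oapp (EFin \o h) 0 (path_at Y t w)) = 0)%E.
  rewrite -[RHS]I0; apply/esym; apply: ge0_integral_ae.
  - apply: ae_measurableM; first exact: (surv_ae_measurableW hY pA).
    exact: measurable_ae_measurable.
  - by move=> w; rewrite patchE; case: ifPn => // _; rewrite mule_ge0// expeR_ge0.
  - by move=> w; rewrite mule_ge0//; case/andP: (surv01 A t w).
  - apply: filterS reg => w rw; rewrite patchE.
    case: ifPn => [_|/negP]; first by rewrite (regular_surv rw).
    rewrite inE => tz.
    case Yt : (path_at Y t w) => [y|] /=; last by rewrite mule0.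
    by exfalso; apply: tz; apply/(lifetime_gt hY w t0); rewrite Yt.
have ae0 : {ae Prob Y (Some x), forall w,
    (surv A t w * oapp (EFin \o h) 0 (path_at Y t w) = 0)%E}.
  apply: ae_measurable_integral0 => //.
  - apply: ae_measurableM; first exact: (surv_ae_measurableW hY pA).
    exact: measurable_ae_measurable.
  - by move=> w; rewrite mule_ge0//; case/andP: (surv01 A t w).
rewrite esemigroupE//.
transitivity (\int[Prob Y (Some x)]_w (cst 0%E w))%E; last exact: integral0.
apply: ge0_integral_ae => //; first exact: measurable_ae_measurable (measurable_cst _).
move: ae0 reg; apply: filterS2 => w e rw.
case Yt : (path_at Y t w) => [y|]//; rewrite Yt in e.
have tz : (t%:E < lifetime Y w)%E by apply/(lifetime_gt hY w t0); rewrite Yt.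
move/eqP: e; rewrite mule_eq0 => /orP[|/eqP //].
rewrite (regular_surv rw)// expeR_eq0 => /eqP Aoo.
have [_ /(_ t t0 tz) + _ _ _] := rw.
by rewrite -[A t w]oppeK Aoo.
Qed.

(** An m-almost everywhere statement says nothing about the given starting point x; waiting for a
    time s > 0 replaces x by Y_s, whose law does not charge m-null sets. *)
Lemma inside_killed_null n T s x : 0 < T -> 0 < s ->
  Prob Y (Some x) ([set w | (s%:E < lifetime Y w)%E] `&`
                   theta Y s @^-1` inside_killed Y K n T) = 0%E.
Proof.
move=> T0 s_gt0; have s0 := ltW s_gt0.
have mG := measurable_inside_killed (X := Y) hK n T0.
have aliveE : [set w | (s%:E < lifetime Y w)%E] = path_at Y s @^-1` (~` [set None]).
  by apply/seteqP; split => w /=; rewrite (lifetime_gt hY w s0).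
rewrite (markov_set hY) //; last first.
  rewrite aliveE.
  have mp : measurable_fun setT (path_at Y s : history Y s -> borel (cemetery E)).
    by apply: measurable_path_history; rewrite s0 lexx.
  have mN : measurable (~` [set None] : set (borel (cemetery E))).
    by apply: measurableC; exact: measurable_None.
  by have := mp measurableT _ mN; rewrite setTI.
pose h y : R := fine (Prob Y (Some y) (inside_killed Y K n T)).
have mG' : measurable (inside_killed Y K n T) by exact: (future_measurable hY).
have hfin y : Prob Y (Some y) (inside_killed Y K n T) \is a fin_num.
  exact: fin_num_measure.
have mh : borel_fun h.
  apply: (@measurableT_comp _ _ _ _ _ _ (@fine R)) => //.
  exact: (measurableT_comp (measurable_Prob_future hY mG) measurable_Some).
have h01 y : 0 <= h y <= 1.
  by rewrite /h fine_ge0//= -lee_fin fineK// probability_le1.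
have Ih : (\int[m]_y (h y)%:E = 0)%E.
  under eq_integral do rewrite /h fineK//.
  exact: (inside_killed_ae0 hY hK m_radon hk hres Yas n T0).
rewrite -(esemigroup_null_res x s_gt0 mh h01 Ih) /esemigroup.
apply: eq_integral => w; rewrite inE /= => /(lifetime_gt hY w s0).
by case: (path_at Y s w) => [y|]//= _; rewrite fineK.
Qed.

(** Countably many cutoffs n, horizons T and waiting times 1 / (j + 1) suffice, and a path dying
    inside some K_n would belong to one of the excluded null events. *)
Lemma no_inside_killing x : {ae Prob Y (Some x), forall w,
  (lifetime Y w < +oo)%E -> Omega_p Y K w}.
Proof.
have bad n (T j : nat) : {ae Prob Y (Some x), forall w,
    ~ ([set w | ((j.+1%:R^-1 : R)%:E < lifetime Y w)%E] `&`
       theta Y j.+1%:R^-1 @^-1` inside_killed Y K n T.+1%:R) w}.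
  exists ([set w | ((j.+1%:R^-1 : R)%:E < lifetime Y w)%E] `&`
       theta Y j.+1%:R^-1 @^-1` inside_killed Y K n T.+1%:R); split.
  - apply: measurableI; first by apply: (alive_measurable hY); rewrite invr_ge0.
    have mG := measurable_inside_killed (X := Y) hK n (ltr0Sn R T).
    have j0 : 0 <= (j.+1%:R^-1 : R) by rewrite invr_ge0.
    by have := measurable_theta hY j0 measurableT mG; rewrite setTI.
  - by apply: inside_killed_null => //; rewrite invr_gt0.
  - by move=> w /= /contrapT.
have {}bad : {ae Prob Y (Some x), forall w, forall n T j : nat,
    ~ ([set w | ((j.+1%:R^-1 : R)%:E < lifetime Y w)%E] `&`
       theta Y j.+1%:R^-1 @^-1` inside_killed Y K n T.+1%:R) w}.
  apply/ae_foralln => n; apply/ae_foralln => T; apply/ae_foralln => j.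
  exact: bad.
(* As p_0 1 = 1, no mass is left for death at time 0. *)
have start : {ae Prob Y (Some x), forall w, path_at Y 0 w <> None}.
  exists (path_at Y 0 @^-1` [set None]); split.
  - exact: (measurable_dead_event hY).
  - apply/eqP; rewrite eq_le measure_ge0 andbT.
    have m0 : borel_fun (cst 1 : E -> R) by exact: measurable_cst.
    have := esemigroup_dead hY x (lexx 0) m0 (fun z => introT andP (conj ler01 (lexx 1))).
    by rewrite (esemigroup0 hY)// /dead -[leRHS]adde0 leeD2lE.
  - by move=> w /= /contrapT.
move: bad start; apply: filterS2 => w bad start zoo n; rewrite zoo andbT.
have z0 := lifetime_ge0 Y w.
have zfin : lifetime Y w \is a fin_num by rewrite ge0_fin_numE.
have z_gt0 : 0 < fine (lifetime Y w).
  by rewrite -lte_fin fineK//; apply/(lifetime_gt hY).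
set z := fine (lifetime Y w) in z_gt0.
have zE : lifetime Y w = z%:E by rewrite fineK.
rewrite ltNge; apply/negP => zt.
have inK t : 0 < t -> t < z -> (Some @` K n) (path_at Y t w).
  move=> t0 tz; apply: contrapT => nK; have := exit_time_le t0 nK.
  by move=> /(le_trans zt); rewrite zE lee_fin leNgt tz.
(* The waiting time must end before the lifetime; from then until death the path is in K_n by
   [inK]. *)
have [j] := ltr_add_invr z_gt0; rewrite add0r => jz.
have zT : z <= (Num.trunc z).+1%:R.
  by have /andP[_ /ltW] := truncn_itv (ltW z_gt0).
apply: (bad n (Num.trunc z) j).
set s : R := j.+1%:R^-1; have s_gt0 : 0 < s by rewrite invr_gt0.
have s0 := ltW s_gt0.
split => /=; first by rewrite zE lte_fin.
set T : R := (Num.trunc z).+1%:R in zT *.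
move=> N _; set q := T / N.+1%:R.
have T_gt0 : 0 < T by rewrite ltr0n.
have q0 : 0 <= q by rewrite divr_ge0// ltW.
have iq i : 0 <= i%:R * q by rewrite mulr_ge0.
have exdead : exists i, path_at Y (s + (i%:R * q + q)) w == None.
  exists N; apply/eqP/(lifetime_le hY); first by rewrite addr_ge0// addr_ge0.
  rewrite zE lee_fin (le_trans zT)// (_ : _ + q = T) ?lerDr//.
  by rewrite /q -{2}[T / _]mul1r -mulrDl -natr1 mulrC divfK// -natr1 lt0r_neq0.
(* The first step that ends dead. Its start is alive, by minimality or, for the first step, because
   s < z; hence it is in K_n. *)
pose i := ex_minn exdead.
have iP : path_at Y (s + (i%:R * q + q)) w = None /\
    forall i', path_at Y (s + (i'%:R * q + q)) w = None -> (i <= i')%N.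
  rewrite /i; case: ex_minnP => i0 /eqP di0 mi0; split => // i' /eqP; exact: mi0.
have [di mi] := iP.
exists i => /=.
  rewrite ltnS; apply: mi; apply/(lifetime_le hY); first by rewrite addr_ge0// addr_ge0.
  rewrite zE lee_fin (le_trans zT)// (_ : _ + q = T) ?lerDr//.
  by rewrite /q -{2}[T / _]mul1r -mulrDl -natr1 mulrC divfK// -natr1 lt0r_neq0.
split; rewrite /= (hunt_shift hY)//; last by rewrite addr_ge0.
apply: inK; first by rewrite ltr_pwDl.
rewrite -lte_fin -zE; apply/(lifetime_gt hY); first exact: addr_ge0.
case: i mi {iP di} => [|i] mi.
  by rewrite mul0r addr0; apply/(lifetime_gt hY w s0); rewrite zE lte_fin.
move=> di; have := mi i; rewrite ltnn (_ : i%:R * q + q = i.+1%:R * q).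
  by move=> /(_ di).
by rewrite -{2}[q]mul1r -mulrDl natr1.
Qed.

End NoInsideKilling.

(** * Assembly of the three identities *)

Lemma at_time_zero d (W : measurableType d) (R : realType) (z : \bar R) (w : W) : (0 <= z)%E ->
  at_time (fun _ _ => 0%E) z w = 0%E.
Proof. by case: z => [t| |] //= _; exact: lim_cst. Qed.

Theorem corollary2p9 (R : realType) (E : pmetricType R)
  (m k : {measure set (borel E) -> \bar R}) (D Dres : L2form E)
  (d dres : measure_display) (W : measurableType d)
  (Wres : measurableType dres)
  (X : process E W) (Xres : process E Wres)
  (A : R -> Wres -> \bar R) (K : nat -> set E)
  (E_locally_compact : locally_compact [set: E])
  (E_separable : separable E)
  (m_radon : radon m) (m_full_support : full_support m)
  (D_regular : regular_dirichlet_form m D)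
  (X_hunt : hunt_process X) (X_associated : associated m X D)
  (X_irreducible : irreducible m X) (X_strong_feller : strong_feller X)
  (k_killing : killing_measure D k)
  (Dres_resurrected : resurrected_form m D k Dres)
  (Xres_hunt : hunt_process Xres) (Xres_associated : associated m Xres Dres)
  (A_pcaf : pcaf Xres A) (A_revuz : revuz m Xres A k)
  (X_subprocess : subprocess X Xres A)
  (K_exhaustion : compact_exhaustion K)
  (x : E) :
  [/\ Prob X (Some x)
        [set w | lifetime X w = lifetime_p X K w /\
                 (lifetime_p X K w < +oo)%E]
      = (\int[Prob Xres (Some x)]_(w in [set w | (lifetime Xres w < +oo)%E])
           expeR (- at_time A (lifetime Xres w) w))%E,
      Prob X (Some x)
        [set w | lifetime X w = lifetime_i X K w /\
                 (lifetime_i X K w < +oo)%E]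
      = (1 - \int[Prob Xres (Some x)]_w
               expeR (- at_time A (lifetime Xres w) w))%E &
      Prob X (Some x) [set w | lifetime X w = +oo%E]
      = (\int[Prob Xres (Some x)]_(w in [set w | lifetime Xres w = +oo%E])
           expeR (- at_time A +oo w))%E].
Proof.
have zero_pcaf := pcaf_zero X.
have [mp pE] := maxhit_limit Xres_hunt K_exhaustion A_pcaf x.
have [_ pXE] := maxhit_limit X_hunt K_exhaustion zero_pcaf x.
have [minf infE] := survival_limit Xres_hunt A_pcaf x.
have [_ infXE] := survival_limit X_hunt zero_pcaf x.
have mOp := measurable_Omega_p X_hunt K_exhaustion.
have mfin := measurable_lifetime_fin X_hunt.
have mfinres := measurable_lifetime_fin Xres_hunt.
have infC d0 (W0 : measurableType d0) (Z : process E W0) :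
    [set w | lifetime Z w = +oo%E] = ~` [set w | (lifetime Z w < +oo)%E].
  apply/seteqP; split => w /=; first by move=> ->; rewrite ltxx.
  by move=> /negP; rewrite -leNgt leye_eq => /eqP.
have minfX : measurable [set w | lifetime X w = +oo%E] by rewrite infC; exact: measurableC.
have nik := no_inside_killing K_exhaustion X_hunt Xres_hunt A_pcaf X_subprocess
  m_radon m_full_support X_associated X_strong_feller k_killing Dres_resurrected
  Xres_associated x.
have finOp : {ae Prob Xres (Some x), forall w,
    ((fun w => expeR (- at_time A (lifetime Xres w) w)%E)
       \_ [set w | (lifetime Xres w < +oo)%E]) w =
    ((fun w => expeR (- at_time A (lifetime Xres w) w)%E) \_ (Omega_p Xres K)) w}.
  apply: filterS nik => w finOp; rewrite !patchE.
  have [zoo|zoo] := pselect (lifetime Xres w < +oo)%E.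
    by rewrite !mem_set//; exact: finOp.
  by rewrite !memNset// => Op; have /andP[_ /zoo] := Op 0%N.
have exp0 (S : set Wres) (f : Wres -> \bar R) w :
    (0 <= ((fun w => expeR (- f w)%E) \_ S) w)%E.
  by rewrite patchE; case: ifP => // _; exact: expeR_ge0.
have finE : (\int[Prob Xres (Some x)]_(w in [set w | (lifetime Xres w < +oo)%E])
      expeR (- at_time A (lifetime Xres w) w) =
    \int[Prob Xres (Some x)]_(w in Omega_p Xres K)
      expeR (- at_time A (lifetime Xres w) w))%E.
  rewrite integral_mkcond [RHS]integral_mkcond; apply: ge0_integral_ae => //.
have part1 : Prob X (Some x) (Omega_p X K) =
    (\int[Prob Xres (Some x)]_(w in [set w | (lifetime Xres w < +oo)%E])
       expeR (- at_time A (lifetime Xres w) w))%E.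
  rewrite finE -pE.
  transitivity (\int[Prob X (Some x)]_(w in Omega_p X K)
      expeR (- at_time (fun _ _ => 0) (lifetime X w) w))%E.
    under eq_integral do rewrite at_time_zero ?lifetime_ge0// oppe0 expeR0.
    by rewrite integral_cst// mul1e.
  rewrite -pXE; congr (limn _); apply/funext => T; congr (limn _).
  apply/funext => n; congr (limn _); apply/funext => N.
  have mV : measurable (~` K n : set (borel E)).
    exact: (measurable_exhC K_exhaustion).
  exact: (maxhit_subprocess X_hunt Xres_hunt A_pcaf X_subprocess mV _ x
    (divr_gt0 (ltr0Sn R T) (ltr0Sn R N))).
have part3 : Prob X (Some x) [set w | lifetime X w = +oo%E] =
    (\int[Prob Xres (Some x)]_(w in [set w | lifetime Xres w = +oo])
       expeR (- at_time A +oo w))%E.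
  rewrite -infE.
  transitivity (\int[Prob X (Some x)]_(w in [set w | lifetime X w = +oo])
      expeR (- at_time (fun _ _ => 0) +oo w))%E.
    under eq_integral do rewrite at_time_zero// oppe0 expeR0.
    by rewrite integral_cst// mul1e.
  rewrite -infXE; congr (limn _); apply/funext => n.
  have m1 : borel_fun (cst 1 : E -> R) by exact: measurable_cst.
  have n0 : 0 < n.+1%:R :> R by [].
  have := X_subprocess n.+1%:R (cst 1) x n0 m1 (fun=> ler01).
  have one (d0 : measure_display) (W0 : measurableType d0) (Z : process E W0) w :
      hunt_process Z -> (n.+1%:R%:E < lifetime Z w)%E ->
      oapp (EFin \o cst (1%R : R)) 0%E (path_at Z n.+1%:R w) = 1%E.
    move=> hZ /(lifetime_gt hZ w (ltW n0)).
    by case: (path_at Z n.+1%:R w).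
  rewrite /esemigroup => e1.
  transitivity (\int[Prob X (Some x)]_(w in [set w | n.+1%:R%:E < lifetime X w])
      oapp (EFin \o cst (1%R : R)) 0 (path_at X n.+1%:R w))%E.
    by apply: eq_integral => w; rewrite inE => nz; rewrite oppe0 expeR0 one.
  rewrite e1; apply: eq_integral => w; rewrite inE => nz.
  by rewrite (one _ _ Xres)// mule1.
split.
- rewrite -part1; congr (Prob X (Some x) _); apply/seteqP; split => w /=.
    rewrite /lifetime_p; case: asboolP => [//|_ [_]].
    by rewrite ltxx.
  move=> Op; have /andP[_ zoo] := Op 0%N.
  by rewrite /lifetime_p; case: asboolP.
- have -> : [set w | lifetime X w = lifetime_i X K w /\ (lifetime_i X K w < +oo)%E] =
      ~` (Omega_p X K `|` [set w | lifetime X w = +oo%E]).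
    apply/seteqP; split => w /=; rewrite /lifetime_i; case: asboolP => Op.
    - by move=> [_]; rewrite ltxx.
    - by move=> [_ zoo] [//|zE]; rewrite zE ltxx in zoo.
    - by move=> /not_orP[].
    - by move=> /not_orP[_ zoo]; split => //; rewrite ltey; apply/eqP.
  rewrite probability_setC; last exact: measurableU.
  congr (1 - _)%E; rewrite measureU//; last first.
    apply/seteqP; split => // w [Op zE]; have /andP[_] := Op 0%N.
    by rewrite zE ltxx.
  (* Splitting the integral over finite and infinite lifetimes needs additivity, which fails for
     lower integrals in general. The version is the sum of the two versions that the limit lemmas
     provide. *)
  have mall : ae_measurable (Prob Xres (Some x))
      (fun w => expeR (- at_time A (lifetime Xres w) w)%E).
    apply: (@ae_measurable_eq _ _ _ _ _ (fun w =>
      ((fun w => expeR (- at_time A (lifetime Xres w) w)%E) \_ (Omega_p Xres K)) w +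
      ((fun w => expeR (- at_time A +oo w)%E) \_ [set w | lifetime Xres w = +oo%E]) w)%E).
      apply: filterS finOp => w <-; rewrite !patchE.
      have [zoo|/negP] := pselect (lifetime Xres w < +oo)%E.
        rewrite mem_set// memNset ?adde0//= => zE; by rewrite zE ltxx in zoo.
      rewrite -leNgt leye_eq => /eqP zE.
      by rewrite memNset/= ?zE ?ltxx// mem_set// add0e.
    by apply: ae_measurable2 minf => // *; exact: emeasurable_funD.
  rewrite (ge0_integral_setT_split mfinres mall); last by move=> w; exact: expeR_ge0.
  rewrite -infC; congr (_ + _)%E; first exact: part1.
  apply: etrans part3 _.
  by apply: eq_integral => w; rewrite inE /= => ->.
- exact: part3.
Qed.
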